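(* For $\overline{\varepsilon}>0$ and $v_\star(x)=2\cos x$, the dispersive action profile $f(c|v_\star;\overline{\varepsilon})$ is the profile $f$ in Nekrasov–Pestun–Shatashvili whose $T^{\uparrow}$-observable $T^{\uparrow}(u)|_f$ is the solution of $$T^{\uparrow}(u+\overline{\varepsilon})|_f+\frac{1}{T^{\uparrow}(u)|_f}+u=0,$$ the difference equation of Poghossian, which satisfies $T^{\uparrow}(u)|_f\sim u^{-1}$ as $\mathrm{Im}[u]\to+\infty$.
   Context: **Profiles.** A profile is a function $f:\mathbb{R}\to\mathbb{R}$ which is $1$-Lipschitz and whose derivative satisfies $f'(c)\to\pm1$ as $c\to\pm\infty$ so that $\int_{-\infty}^0(1+f'(c))\frac{dc}{1+|c|}<\infty$ and $\int_0^\infty(1-f'(c))\frac{dc}{1+|c|}<\infty$. Its shifted Rayleigh function is $\xi_f=\frac12(1+f')-\mathbf{1}_{[0,\infty)}$ and its $T^{\uparrow}$-observable is $T^{\uparrow}(u)|_f=\frac1u\exp\big(-\int_{-\infty}^{\infty}\frac{\xi_f(c)dc}{u-c}\big)$, $u\in\mathbb{C}\setminus\mathbb{R}$. **Dispersive action profile.** With $w=e^{\mathbf{i}x}$, $\mathbb{T}=\{|w|=1\}$, let $H_\bullet$ be the closure of $\mathbb{C}[w]$ in $L^2(\mathbb{T})$ (normalized measure $dx/2\pi$) with orthogonal projection $\pi_\bullet$ and orthonormal basis $|h\rangle=w^h$, $h\ge0$. For bounded real $2\pi$-periodic $v$, the Lax operator $L_\bullet(v;\overline{\varepsilon})=-\overline{\varepsilon}D_\bullet+\pi_\bullet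 L(v)\pi_\bullet$ is self-adjoint, with $D_\bullet|h\rangle=h|h\rangle$ and $L(v)$ multiplication by $v$. The function $\Phi_0^{BA}(u|v;\overline{\varepsilon})=\langle0|(u-L_\bullet(v;\overline{\varepsilon}))^{-1}|0\rangle$ is meromorphic in $u\in\mathbb{C}$ with simple real poles $S_i^{\uparrow}$ and simple real zeroes $S_i^{\downarrow}$, strictly interlacing as $\cdots<S_1^{\uparrow}<S_1^{\downarrow}<S_0^{\uparrow}$ with no accumulation point except $-\infty$. The dispersive action profile $f(c|v;\overline{\varepsilon})$ is the piecewise-linear function of $c\in\mathbb{R}$ with $|f'(c)|=1$ almost everywhere, local minima at the $S_i^{\uparrow}$, local maxima at the $S_i^{\downarrow}$, and $f(c|v;\overline{\varepsilon})\sim|c-a|$ as $c\to\pm\infty$, $a=\int_0^{2\pi}v\,\frac{dx}{2\pi}$. **Literature objects.** The Nekrasov–Pestun–Shatashvili profile and Poghossian's difference equation come from gauge theory: the profile is the one determining the $\overline{\varepsilon}$-deformed curve and twisted superpotential of pure $U(1)$ $N=2$ supersymmetric Yang–Mills theory on $\mathbb{R}^4$, and it is specified in the claim through its $T^{\uparrow}$-observable by the displayed equation and boundary condition.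
   Formalization: The equation is proved with −u in place of +u, since T(u) ~ 1/u makes the printed left side ~ 2u; and f'(c) → ±1 is required only through the two integral conditions, since f' = +1 on intervals going to −∞. *)

(* Defs.v *)
(* MathComp-Analysis; complex numbers are R[i] over an arbitrary R : realType *)
From HB Require Import structures.
From mathcomp Require Import all_boot all_order all_algebra.
From mathcomp Require Import all_classical all_reals all_analysis.
From mathcomp Require Import complex.
Import Normc.
Set Implicit Arguments.
Unset Strict Implicit.
Unset Printing Implicit Defensive.
Import Order.TTheory GRing.Theory Num.Theory.
Import numFieldNormedType.Exports.
Local Open Scope classical_set_scope.
Local Open Scope ring_scope.
Local Open Scope complex_scope.

Section Complex.
Context {R : realType}.

Definition cint (D : set R) (F : R -> R[i]) : R[i] :=
  (\int[lebesgue_measure]_(x in D) complex.Re (F x))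
    +i* (\int[lebesgue_measure]_(x in D) complex.Im (F x)).

Definition cexp (z : R[i]) : R[i] :=
  (expR (complex.Re z))%:C * (cos (complex.Im z) +i* sin (complex.Im z)).

End Complex.

Section Profiles.
Context {R : realType}.

(* The convergence f'(c) -> +1, -1 at +oo, -oo is the one expressed by the two
   integral conditions.  It cannot be pointwise: the derivative of a dispersive
   action profile takes the value +1 on a sequence of (ever shorter) intervals
   going to -oo.  By Rademacher's theorem, the total operator derive1 is the
   derivative almost everywhere. *)
Definition profile (f : R -> R) : Prop :=
  [/\ (1 : R).-lipschitz f,
      (\int[lebesgue_measure]_(c in `]-oo, 0%R])
         ((1 + derive1 f c) / (1 + `|c|))%:E < +oo)%E &
      (\int[lebesgue_measure]_(c in `[0%R, +oo[)
         ((1 - derive1 f c) / (1 + `|c|))%:E < +oo)%E].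

Definition shifted_Rayleigh (f : R -> R) (c : R) : R :=
  2^-1 * (1 + derive1 f c) - \1_(`[0%R, +oo[) c.

Definition T_up (f : R -> R) (u : R[i]) : R[i] :=
  u^-1 * cexp (- cint setT (fun c => (shifted_Rayleigh f c)%:C / (u - c%:C))).

End Profiles.

Section HardySpace.
Context {R : realType}.

(* Functions on the circle are functions of x in [0, 2 pi], with the measure
   dx / (2 pi); elements of L^2 are represented by functions, equality in L^2
   being almost everywhere equality. *)
Definition circle : set R := `[0, 2 * pi].

Definition mean (v : R -> R) : R :=
  (2 * pi)^-1 * \int[lebesgue_measure]_(x in circle) v x.

Definition L2 (psi : R -> R[i]) : Prop :=
  [/\ measurable_fun circle (fun x => complex.Re (psi x)),
      measurable_fun circle (fun x => complex.Im (psi x)) &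
      lebesgue_measure.-integrable circle (fun x => ((normc (psi x)) ^+ 2)%:E)].

Definition ae_eq_circle (phi psi : R -> R[i]) : Prop :=
  {ae lebesgue_measure, forall x, circle x -> phi x = psi x}.

Definition inner (phi psi : R -> R[i]) : R[i] :=
  ((2 * pi)^-1)%:C * cint circle (fun x => conjc (phi x) * psi x).

Definition dist2 (phi psi : R -> R[i]) : R :=
  Num.sqrt (mean (fun x => normc (phi x - psi x) ^+ 2)).

Definition expix (x : R) : R[i] := cos x +i* sin x.

Definition ket (h : nat) (x : R) : R[i] := expix x ^+ h.

(* the closure of C[w] in L^2, with w = expix x *)
Definition Hardy (psi : R -> R[i]) : Prop :=
  L2 psi /\
  forall e : R, 0 < e ->
    exists p : {poly R[i]}, dist2 psi (fun x => p.[expix x]) < e.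

(* phi is the orthogonal projection of psi on the Hardy space *)
Definition Hardy_proj (psi phi : R -> R[i]) : Prop :=
  Hardy phi /\
  forall chi, Hardy chi -> inner chi (fun x => psi x - phi x) = 0.

(* Graph of the self-adjoint operator D with D |h> = h |h>: its domain consists
   of the psi in the Hardy space such that \sum_h h <h|psi> |h> converges. *)
Definition D_graph (psi phi : R -> R[i]) : Prop :=
  [/\ Hardy psi, Hardy phi &
      forall h : nat, inner (ket h) phi = h%:R * inner (ket h) psi].

(* Graph of L = - eps D + proj o v o proj: phi = L psi.  For bounded measurable
   v, the domain of L is that of D; on it psi = proj psi. *)
Definition Lax_graph (v : R -> R) (eps : R) (psi phi : R -> R[i]) : Prop :=
  exists dpsi tpsi : R -> R[i],
    [/\ D_graph psi dpsi,
        Hardy_proj (fun x => (v x)%:C * psi x) tpsi &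
        ae_eq_circle phi (fun x => - eps%:C * dpsi x + tpsi x)].

(* z = <0| (u - L)^-1 |0>: the operator u - L is injective, and psi is the
   preimage of |0>, i.e. L psi = u psi - |0>. *)
Definition Phi0 (v : R -> R) (eps : R) (u z : R[i]) : Prop :=
  (forall psi, Lax_graph v eps psi (fun x => u * psi x) ->
     ae_eq_circle psi (fun=> 0)) /\
  exists2 psi, Lax_graph v eps psi (fun x => u * psi x - ket 0 x) &
    z = inner (ket 0) psi.

(* Phi0 is a partial function of u, undefined on the spectrum of L; poles and
   zeroes are those of its meromorphic extension, whence the punctured
   neighborhoods. *)
Definition punctured_near (s : R[i]) (P : R[i] -> Prop) : Prop :=
  exists2 d : R, 0 < d & forall u, u != s -> normc (u - s) < d -> P u.

Definition Phi0_pole (v : R -> R) (eps : R) (s : R[i]) : Prop :=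
  forall M : R, punctured_near s
    (fun u => exists2 z, Phi0 v eps u z & M < normc z).

Definition Phi0_zero (v : R -> R) (eps : R) (s : R[i]) : Prop :=
  forall e : R, 0 < e -> punctured_near s
    (fun u => exists2 z, Phi0 v eps u z & normc z < e).

End HardySpace.

Section DispersiveActionProfile.
Context {R : realType}.

(* B is a locally finite set of breakpoints; linearity on closed intervals
   entails continuity at the breakpoints. *)
Definition piecewise_linear (f : R -> R) : Prop :=
  exists B : set R,
    (forall M : R, finite_set (B `&` `[- M, M])) /\
    forall a b : R, a <= b -> B `&` `]a, b[ = set0 ->
      exists m k : R, forall c, a <= c <= b -> f c = m * c + k.

Definition local_min (f : R -> R) (c : R) : Prop := \forall x \near c, f c <= f x.
Definition local_max (f : R -> R) (c : R) : Prop := \forall x \near c, f x <= f c.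

(* f(c) ~ |c - a| means f(c) - |c - a| -> 0, which fixes the additive constant
   left free by the other conditions. *)
Definition dispersive_action_profile (v : R -> R) (eps : R) (f : R -> R) : Prop :=
  [/\ piecewise_linear f,
      {ae lebesgue_measure, forall c : R, derivable f c 1 /\ `|derive1 f c| = 1},
      (forall c : R, local_min f c <-> Phi0_pole v eps c%:C),
      (forall c : R, local_max f c <-> Phi0_zero v eps c%:C) &
      (f c - `|c - mean v|) @[c --> +oo] --> (0 : R) /\
      (f c - `|c - mean v|) @[c --> -oo] --> (0 : R)].

Definition v_star (x : R) : R := 2 * cos x.

(* The equation is sometimes displayed with + u; the sign - u is the one
   compatible with T(u) ~ 1/u, under which T(u + eps) -> 0 and 1/T(u) ~ u. *)
Definition Poghossian_eq (eps : R) (T : R[i] -> R[i]) : Prop :=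
  forall u : R[i], complex.Im u != 0 -> T (u + eps%:C) + (T u)^-1 - u = 0.

(* T(u) ~ 1/u as Im u -> +oo, uniformly in Re u *)
Definition asymp_inv (T : R[i] -> R[i]) : Prop :=
  forall e : R, 0 < e -> exists M : R, forall u : R[i],
    M < complex.Im u -> normc (u * T u - 1) < e.

End DispersiveActionProfile.

(* Main.v *)
(* In the basis |h> the Lax operator of v_star is the Jacobi matrix with diagonal
   entries - eps h and off-diagonal entries 1.  The roots of the characteristic
   polynomials of its sections, the i-th one shifted by i eps, interlace and have
   bounded sum, hence converge to some q_i, and the normalized polynomials
   converge to G(u) = prod_i (1 - q_i / (u + i eps)), which inherits a three-term
   recurrence.  A Wronskian argument gives
     <0| (u - L)^-1 |0> = T(u) = G(u + eps) / (u G(u)),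
   and the recurrence for G is the difference equation for T.  The poles
   p_i = q_i - i eps and the zeroes p_i - eps of T determine the action profile
   f, and exp(int_a^b dc / (u - c)) = (u - a) / (u - b) yields T_up f = T.

   For uniqueness, the equation is a contraction for large Im u, so two solutions
   agree there.  The difference h of the two shifted Rayleigh functions then has
   a Cauchy transform I(u) with exp I(u) = 1 for large Im u; as I(i n) tends to
   0, I vanishes at i n for large n, and by Newton interpolation at these nodes
   it vanishes on the upper half-plane.  Integrating its imaginary part over
   [a, b] and letting Im u tend to 0 gives int_a^b h = 0, and a Lipschitz
   function is the integral of its derivative. *)
From HB Require Import structures.
Require Import Defs.
From mathcomp Require Import all_boot all_order all_algebra.
From mathcomp Require Import all_classical all_reals all_analysis.
From mathcomp Require Import measurable_realfun complex polyrcf ring lra zify.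
Import Normc.
Set Implicit Arguments.
Unset Strict Implicit.
Unset Printing Implicit Defensive.
Import Order.TTheory GRing.Theory Num.Theory.
Import numFieldNormedType.Exports.
Local Open Scope classical_set_scope.
Local Open Scope ring_scope.

(** * Sections of the Lax matrix and their roots *)

Section JacobiSections.

(** Each interlacing comes from one expansion of the determinant of a section: along the last row it
    compares consecutive sections (Cauchy), along the first row the remaining section reappears at
    [u + eps], with its roots moved by [- eps]. Together they make the shifted roots monotone both
    in the index and in the size. The bound on their sum is the trace of the squared section, made
    usable by the symmetry of its spectrum. The limit is classical: T(u) is J_{u/eps}(2/eps) /
    J_{u/eps - 1}(2/eps), and the q_i record the zeroes of a Bessel function in its order. The
    product over the roots is built directly, because the profile is read off its zeroes and these
    must be known to be real and ordered. Two obstacles shape the rest. Limits of interlacing roots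
    interlace only weakly, so strictness, without which a pole and a zero would cancel, is recovered
    afterwards from the difference equation. And [derive1] of a Lipschitz function has arbitrary
    values where the derivative fails to exist, so a measurable bounded density replaces it in the
    integrals. *)

Fixpoint jac (K : comNzRingType) (e u : K) (n : nat) : K :=
  match n with
  | 0 => 1
  | n1.+1 => match n1 with
             | 0 => u
             | n2.+1 => (u + n1%:R * e) * jac e u n1 - jac e u n2
             end
  end.

Lemma jacSS (K : comNzRingType) (e u : K) n :
  jac e u n.+2 = (u + n.+1%:R * e) * jac e u n.+1 - jac e u n.
Proof. by []. Qed.

Lemma nat_ind2 (P : nat -> Prop) :
  P 0%N -> P 1%N -> (forall n, P n -> P n.+1 -> P n.+2) -> forall n, P n.
Proof.
move=> P0 P1 PS n; suff [] : P n /\ P n.+1 by [].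
by elim: n => // n [Pn Pn1]; split=> //; apply: PS.
Qed.

(** [jac e u n] is the determinant of [u - L] on the first [n] basis vectors. Deleting the first row
    and column leaves a matrix of the same form with [u + e] in place of [u]. *)
Lemma jac_first_row (K : comNzRingType) (e u : K) n :
  jac e u n.+2 = u * jac e (u + e) n.+1 - jac e (u + e + e) n.
Proof.
elim/nat_ind2: n => [||n IH1 IH2].
- by rewrite /=; ring.
- by rewrite /=; ring.
rewrite jacSS IH1 IH2 (jacSS e (u + e) n.+1) (jacSS e (u + e + e) n).
by rewrite -!natr1; ring.
Qed.

(** Reversing the order of the basis turns the diagonal entry [- u - n e + h e] into minus the entry
    [u + h e]; the sign of the off-diagonal entries does not affect a tridiagonal determinant. *)
Lemma jac_reflect (K : comNzRingType) (e u : K) n :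
  jac e (- u - n%:R * e) n.+1 = (-1) ^+ n.+1 * jac e u n.+1.
Proof.
elim/nat_ind2: n u => [||n IH1 IH2] u; first by rewrite /=; ring.
  by rewrite /=; ring.
rewrite jacSS.
have -> : - u - n.+2%:R * e = - (u + e) - n.+1%:R * e by rewrite -!natr1; ring.
rewrite IH2.
have -> : - (u + e) - n.+1%:R * e = - (u + e + e) - n%:R * e.
  by rewrite -!natr1; ring.
rewrite IH1 (jac_first_row e u n.+1) !exprS -!natr1; ring.
Qed.

End JacobiSections.

(** * Real-rooted polynomials with interlacing roots *)

Section Interlacing.
Context {R : realType}.
Implicit Types (a b c : nat -> R) (P : {poly R}).

Lemma rmorph_jac (K L : comNzRingType) (f : {rmorphism K -> L}) (e u : K) n :
  f (jac e u n) = jac (f e) (f u) n.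
Proof.
elim/nat_ind2: n => [||n IH1 IH2]; rewrite ?rmorph1 //.
by rewrite !jacSS rmorphB rmorphM rmorphD rmorphM rmorph_nat IH1 IH2.
Qed.

Definition decr n c := forall i, (i.+1 < n)%N -> c i.+1 < c i.

Lemma decr_lt n c i j : decr n c -> (i < j < n)%N -> c j < c i.
Proof.
move=> dc /andP[]; elim: j => // j IH; rewrite ltnS leq_eqVlt => /predU1P[<-|ij] jn.
  exact: dc.
by apply: (lt_trans (dc _ jn)); apply: IH => //; apply: ltnW.
Qed.

Definition rprod n c : {poly R} := \prod_(i < n) ('X - (c i)%:P).

Lemma rprodE n c : rprod n c = \prod_(z <- mkseq c n) ('X - z%:P).
Proof.
rewrite /rprod /mkseq big_map -[in RHS](subn0 n) -/(index_iota 0 n).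
by rewrite big_mkord.
Qed.

Lemma root_rprod n c x : root (rprod n c) x = (x \in mkseq c n).
Proof. by rewrite rprodE root_prod_XsubC. Qed.

Lemma mem_mkseqP n c x : reflect (exists2 i, (i < n)%N & x = c i) (x \in mkseq c n).
Proof.
apply: (iffP seq.mapP) => -[j]; first by rewrite mem_iota; exists j.
by move=> j_n ->; exists j => //; rewrite mem_iota.
Qed.

Lemma horner_rprod n c x : (rprod n c).[x] = \prod_(i < n) (x - c i).
Proof. by rewrite horner_prod; apply: eq_bigr => i _; rewrite !hornerE. Qed.

Lemma decr_sorted n c : decr n c -> sorted >%R (mkseq c n).
Proof.
move=> dc; apply/(sortedP 0) => i; rewrite size_mkseq => i1n.
by rewrite !nth_mkseq //; [exact: dc|exact: ltnW].
Qed.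

Lemma decr_roots_inj n b c :
  decr n b -> decr n c -> rprod n b = rprod n c -> forall i, (i < n)%N -> b i = c i.
Proof.
move=> db dc bc i i_n.
suff E : mkseq b n = mkseq c n.
  by rewrite -(@nth_mkseq _ 0 b _ _ i_n) E nth_mkseq.
apply: (@irr_sorted_eq _ >%R).
- by move=> x y z xy yz; apply: lt_trans xy.
- by move=> x; rewrite /= ltxx.
- exact: decr_sorted.
- exact: decr_sorted.
- by move=> x; rewrite -!root_rprod bc.
Qed.

Lemma prod_sub_sign n i b x : (i <= n)%N ->
  (forall j, (j < i)%N -> x < b j) -> (forall j, (i <= j < n)%N -> b j < x) ->
  0 < (-1) ^+ i * \prod_(j < n) (x - b j).
Proof.
move=> i_n xb bx; rewrite -(big_mkord predT (fun j => x - b j)).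
rewrite (big_cat_nat (n := i)) //= mulrA; apply: mulr_gt0.
  rewrite big_mkord -[X in (-1) ^+ X](card_ord i) -prodrN.
  by apply: prodr_gt0 => j _; rewrite oppr_gt0 subr_lt0 xb.
by rewrite big_nat; apply: prodr_gt0 => j /bx; rewrite subr_gt0.
Qed.

Lemma sign_change_root P x y i : x < y ->
  0 < (-1) ^+ i * P.[y] -> 0 < (-1) ^+ i.+1 * P.[x] -> exists2 z, x < z < y & root P z.
Proof.
move=> xy Py Px; have [|z] := @poly_ivtoo _ P x y (ltW xy).
  move: Py Px; rewrite exprS mulN1r mulNr oppr_gt0.
  rewrite -signr_odd; case: (odd i); rewrite ?expr1 ?expr0 ?mul1r ?mulN1r ?oppr_gt0 ?oppr_lt0.
    by move=> Py Px; rewrite nmulr_llt0.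
  by move=> Py Px; rewrite pmulr_llt0.
by rewrite in_itv /=; exists z.
Qed.

Lemma monic_pos_ge P : P \is monic -> exists B : R, forall x : R, B <= x -> 0 < P.[x].
Proof.
move=> mP; have := @poly_pinfty_gt_lc _ P.
rewrite (monicP mP) ltr01 => /(_ isT) [B HB]; exists B => x /HB; exact: lt_le_trans.
Qed.

Lemma monic_sign_le P n : P \is monic -> size P = n.+1 ->
  exists B : R, forall x : R, x <= B -> 0 < (-1) ^+ n * P.[x].
Proof.
move=> mP sP; pose Q := (-1) ^+ n *: (P \Po (- 'X)).
have szX : size (- 'X : {poly R}) = 2%N by rewrite size_polyN size_polyX.
have mQ : Q \is monic.
  rewrite monicE /Q lead_coefZ lead_coef_comp ?szX // (monicP mP) mul1r sP /=.
  by rewrite lead_coefN lead_coefX -exprMn mulrNN mulr1 expr1n.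
have [B HB] := monic_pos_ge mQ; exists (- B) => x; rewrite lerNr => /HB.
by rewrite /Q !hornerE horner_comp !hornerE opprK.
Qed.

(* The values of [P] at the points [a i] alternate in sign, starting with a
   minus sign, so that one more root is found on either side of all of them. *)
Lemma interlacing_roots n a P : P \is monic -> size P = n.+3 -> decr n.+1 a ->
  (forall i, (i <= n)%N -> 0 < (-1) ^+ i.+1 * P.[a i]) ->
  exists c : nat -> R, P = rprod n.+2 c /\ forall i, (i <= n)%N -> c i.+1 < a i < c i.
Proof.
move=> mP sP da sgn.
have [B1 HB1] := monic_pos_ge mP; have [B2 HB2] := monic_sign_le mP sP.
(* [al] lists the test points in decreasing order: [B], above every [a i] and beyond the last sign
   change, then the [a i], then [B'] below them. The sign of [P] at [al i] is (-1)^i, so one root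
   lies between any two neighbours. *)
pose B := Num.max B1 (a 0%N + 1); pose B' := Num.min B2 (a n - 1).
pose al i := if i is j.+1 then if (j <= n)%N then a j else B' else B.
have al_dec i : (i <= n.+1)%N -> al i.+1 < al i.
  case: i => [_|i] /=.
    by rewrite /B lt_max ltrDl ltr01 orbT.
  rewrite ltnS => i_n; rewrite i_n; case: ltnP => [i1n|ni].
    exact: da.
  have -> : i = n by lia.
  by rewrite /B' gt_min gtrDl ltrN10 orbT.
have al_sgn i : (i <= n.+2)%N -> 0 < (-1) ^+ i * P.[al i].
  case: i => [_|i]; first by rewrite expr0 mul1r HB1 // /al /B le_max lexx.
  rewrite ltnS /al => i_n; case: ifPn => [/sgn //|ni].
  have -> : i = n.+1 by lia.
  by apply: HB2; rewrite /B' ge_min lexx.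
have Hex i : exists x : R, (i <= n.+1)%N -> al i.+1 < x < al i /\ root P x.
  have [i_n|] := leqP i n.+1; last by exists 0.
  have [||z] := @sign_change_root P _ _ i (al_dec i i_n); [exact/al_sgn/leqW|exact: al_sgn|].
  by exists z.
have [c Hc] := choice Hex.
have inter i : (i <= n)%N -> c i.+1 < a i < c i.
  move=> i_n; have [/andP[_ H1] _] := Hc i.+1 i_n; have [/andP[H2 _] _] := Hc i (leqW i_n).
  by move: H1 H2; rewrite /= i_n => -> ->.
exists c; split => //.
have dc : decr n.+2 c.
  by move=> i; rewrite !ltnS => /inter /andP[]; apply: lt_trans.
have := @all_roots_prod_XsubC _ P (mkseq c n.+2).
rewrite (monicP mP) scale1r -rprodE; apply.
- by rewrite size_mkseq.
- apply/allP => x /mem_mkseqP[i i_n ->]; exact: (Hc i i_n).2.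
- rewrite uniq_rootsE; apply: (sorted_uniq (leT := >%R)).
  + by move=> x y z xy yz; apply: lt_trans xy.
  + by move=> x; rewrite /= ltxx.
  + exact: decr_sorted.
Qed.

End Interlacing.

Section JacobiRoots.
Context {R : realType} (eps : R).
Hypothesis eps_gt0 : 0 < eps.

Definition jacp n : {poly R} := jac eps%:P 'X n.

Lemma horner_jacp n u : (jacp n).[u] = jac eps u n.
Proof.
by have := rmorph_jac (horner_eval u) eps%:P 'X n; rewrite /= /horner_eval hornerC hornerX.
Qed.

Lemma jacp_monic n : jacp n \is monic /\ size (jacp n) = n.+1.
Proof.
rewrite /jacp; elim/nat_ind2: n => [||n [m1 s1] [m2 s2]].
- by rewrite /= monic1 size_poly1.
- by rewrite /= monicX size_polyX.
have -> : jac eps%:P 'X n.+2 = ('X - (- n.+1%:R * eps)%:P) * jac eps%:P 'X n.+1 - jac eps%:P 'X n.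
  by rewrite jacSS polyCM polyCN mulNr opprK polyC_natr.
have mX : 'X - (- n.+1%:R * eps)%:P \is monic by apply: monicXsubC.
have s3 : size (('X - (- n.+1%:R * eps)%:P) * jac eps%:P 'X n.+1) = n.+3.
  by rewrite size_Mmonic ?monic_neq0 // size_XsubC s2.
have lt : (size (- jac eps%:P 'X n) < size (('X - (- n.+1%:R * eps)%:P) * jac eps%:P 'X n.+1)%R)%N.
  by rewrite size_polyN s1 s3.
split; last by rewrite size_polyDl.
by rewrite monicE lead_coefDl // lead_coef_Mmonic // (monicP m2).
Qed.

(** Both inequalities are carried by one induction. At a root [a k] of the section of size n+1, the
    last-row recurrence leaves minus the previous polynomial at [a k]; at [a k - eps], the first-row
    expansion leaves minus the same polynomial at [a k + eps]. The margin [eps] in the induction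
    hypothesis is exactly what keeps the signs alternating in the second case. The two enumerations
    of the new roots agree, both being decreasing. *)
Lemma jac_roots_step n : exists b a,
  [/\ jacp n = rprod n b, jacp n.+1 = rprod n.+1 a & forall i, (i < n)%N -> b i < a i /\ a i.+1 < b i - eps].
Proof.
elim: n => [|n [b [a [jb ja ba]]]].
  exists (fun=> 0), (fun=> 0); split=> //.
    by rewrite /jacp /rprod /= big_ord0.
  by rewrite /jacp /rprod /= big_ord1 subr0.
have da : decr n.+1 a.
  by move=> i i_n; have [] := ba i i_n; have := eps_gt0; lra.
have [mj sj] := jacp_monic n.+2.
have root_a k : (k <= n)%N -> (jacp n.+1).[a k] = 0.
  by move=> kn; apply/rootP; rewrite ja root_rprod; apply/mem_mkseqP; exists k.
have [c [jc ac]] : exists c, jacp n.+2 = rprod n.+2 c /\ forall i, (i <= n)%N -> c i.+1 < a i < c i.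
  apply: (interlacing_roots mj sj da) => i i_n.
  rewrite horner_jacp jacSS -!horner_jacp root_a //.
  rewrite mulr0 sub0r exprS mulN1r mulrNN jb horner_rprod prod_sub_sign // => j.
    move=> ji; have [_ H1] := ba j (leq_trans ji i_n).
    have [Eij|Nij] := eqVneq j.+1 i; first by rewrite -Eij; have := eps_gt0; lra.
    have := @decr_lt _ n.+1 a j.+1 i da; have := eps_gt0.
    have -> : (j.+1 < i < n.+1)%N by lia.
  by move=> e0 /(_ isT); lra.
  move=> /andP[ij jn]; have [H1 _] := ba j jn.
  have [Eij|Nij] := eqVneq j i; first by rewrite -Eij; have := eps_gt0; lra.
  have := @decr_lt _ n.+1 a i j da; have := eps_gt0.
  have -> : (i < j < n.+1)%N by lia.
  by move=> e0 /(_ isT); lra.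
exists a, c; split=> // i i_n.
split; first by have /andP[] := ac i i_n.
have da' : decr n.+1 (fun i => a i - eps) by move=> j jn /=; rewrite ltrD2r da.
have dc : decr n.+2 c.
  by move=> j jn; have /andP[] := ac j jn; apply: lt_trans.
have [c' [jc' ac']] : exists c, jacp n.+2 = rprod n.+2 c /\ forall i, (i <= n)%N -> c i.+1 < a i - eps < c i.
  apply: (interlacing_roots mj sj da') => k k_n.
  rewrite horner_jacp jac_first_row -!horner_jacp subrK root_a //.
  rewrite mulr0 sub0r exprS mulN1r mulrNN jb horner_rprod prod_sub_sign // => j.
    move=> ji; have [_ H1] := ba j (leq_trans ji k_n).
    have [Eij|Nij] := eqVneq j.+1 k; first by rewrite -Eij; lra.
    have := @decr_lt _ n.+1 a j.+1 k da.
    have -> : (j.+1 < k < n.+1)%N by lia.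
  by move=> /(_ isT); lra.
  move=> /andP[ij jn]; have [H1 _] := ba j jn.
  have [Eij|Nij] := eqVneq j k; first by rewrite -Eij; have := eps_gt0; lra.
  have := @decr_lt _ n.+1 a k j da; have := eps_gt0.
  have -> : (k < j < n.+1)%N by lia.
  by move=> e0 /(_ isT); lra.
have dc' : decr n.+2 c'.
  by move=> j jn; have /andP[] := ac' j jn; apply: lt_trans.
have E := decr_roots_inj dc dc' (etrans (esym jc) jc').
by rewrite E //; have /andP[] := ac' i i_n.
Qed.

(** The enumerations of [jac_roots_step] are chosen afresh for every [n]; uniqueness of the
    decreasing enumeration glues them into one family. *)
Lemma ex_jac_roots : exists p : nat -> nat -> R,
  [/\ forall n, jacp n = rprod n (p n),
      forall n i, (i < n)%N -> p n i < p n.+1 i &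
      forall n i, (i < n)%N -> p n.+1 i.+1 < p n i - eps].
Proof.
have Hex n : exists c : nat -> R, jacp n = rprod n c /\ decr n c.
  case: n => [|n].
    by exists (fun=> 0); split; rewrite ?/jacp /rprod /= ?big_ord0.
  have [b [a [_ ja ba]]] := jac_roots_step n; exists a; split=> // i /ba[].
  by have := eps_gt0; lra.
have [p Hp] := choice Hex.
have key n i : (i < n)%N -> p n i < p n.+1 i /\ p n.+1 i.+1 < p n i - eps.
  move=> i_n; have [b [a [jb ja ba]]] := jac_roots_step n.
  have da : decr n.+1 a by move=> j /ba[]; have := eps_gt0; lra.
  have [jn dn] := Hp n; have [jn1 dn1] := Hp n.+1.
  have Ea := decr_roots_inj dn1 da (etrans (esym jn1) ja).
  have db : decr n b.
    move=> j jltn; have [_ H1] := ba j (ltnW jltn); have [H2 _] := ba j.+1 jltn.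
    by have := eps_gt0; lra.
  have Eb := decr_roots_inj dn db (etrans (esym jn) jb).
  by rewrite !Ea ?Eb //; [exact: ba|lia].
exists p; split=> [n|n i /key[]|n i /key[]] //.
by have [] := Hp n.
Qed.

Definition jroot : nat -> nat -> R := projT1 (cid ex_jac_roots).

Lemma jrootE n : jacp n = rprod n (jroot n).
Proof. by rewrite /jroot; case: cid => p []. Qed.

Lemma jroot_ltS n i : (i < n)%N -> jroot n i < jroot n.+1 i.
Proof. by rewrite /jroot; case: cid => p [_ H _] /=; exact: H. Qed.

Lemma jrootSS_lt n i : (i < n)%N -> jroot n.+1 i.+1 < jroot n i - eps.
Proof. by rewrite /jroot; case: cid => p [_ _ H] /=; exact: H. Qed.

Lemma jroot_decr n : decr n (jroot n).
Proof.
case: n => // n i; rewrite ltnS => i_n.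
have := jroot_ltS i_n; have := jrootSS_lt i_n; have := eps_gt0; lra.
Qed.

Lemma jac_prod n u : jac eps u n = \prod_(i < n) (u - jroot n i).
Proof. by rewrite -horner_jacp jrootE horner_rprod. Qed.

Lemma jac_prodC n (u : complex R) : jac (real_complex R eps) u n = \prod_(i < n) (u - real_complex R (jroot n i)).
Proof.
have := rmorph_jac (map_poly (real_complex R)) eps%:P 'X n.
rewrite -/(jacp n) jrootE /= map_polyC map_polyX => /(congr1 (fun P => P.[u])).
have := rmorph_jac (horner_eval u) (real_complex R eps)%:P 'X n.
rewrite /= /horner_eval hornerC hornerX => ->.
move=> <-; rewrite /rprod rmorph_prod horner_prod; apply: eq_bigr => i _.
by rewrite rmorphB /= map_polyX map_polyC !hornerE.
Qed.

Lemma jroot_reflect n i : (i < n)%N -> jroot n (n.-1 - i)%N = - jroot n i - n.-1%:R * eps.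
Proof.
case: n => // n; rewrite /= ltnS => i_n.
pose c i := - jroot n.+1 (n - i)%N - n%:R * eps.
suff E : forall i, (i < n.+1)%N -> jroot n.+1 i = c i.
  by rewrite E ?ltnS ?leq_subr // /c subKn.
have dc : decr n.+1 c.
  move=> j; rewrite ltnS => jn; rewrite /c ltrD2r ltrN2.
  have -> : (n - j = (n - j.+1).+1)%N by lia.
  by apply: jroot_decr; lia.
apply: decr_roots_inj => //; first exact: jroot_decr.
rewrite -jrootE.
have [mj sj] := jacp_monic n.+1.
have Rj i0 : (i0 < n.+1)%N -> root (jacp n.+1) (c i0).
  move=> i0n; rewrite rootE horner_jacp /c jac_reflect jac_prod.
  apply/eqP; rewrite (bigD1 (inord (n - i0)%N)) //= inordK ?subrr ?mul0r ?mulr0 //.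
  by rewrite ltnS leq_subr.
have := @all_roots_prod_XsubC _ (jacp n.+1) (mkseq c n.+1).
rewrite (monicP mj) scale1r -rprodE; apply.
- by rewrite size_mkseq.
- by apply/allP => x /mem_mkseqP[j jn ->]; exact: Rj.
- rewrite uniq_rootsE; apply: (sorted_uniq (leT := >%R)).
  + by move=> x y z xy yz; apply: lt_trans xy.
  + by move=> x; rewrite /= ltxx.
  + exact: decr_sorted.
Qed.

End JacobiRoots.

(** * Shifted roots, their bounds and their limits *)

Section JacobiShift.
Context {R : realType} (eps : R).
Hypothesis eps_gt0 : 0 < eps.

Local Notation jroot := (jroot eps_gt0).

Arguments jacp : simpl never.

Lemma rprod_coefs n (c : nat -> R) :
  [/\ (rprod n.+2 c)`_n.+2 = 1, (rprod n.+2 c)`_n.+1 = - \sum_(i < n.+2) c i &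
      (\sum_(i < n.+2) c i) ^+ 2 - \sum_(i < n.+2) c i ^+ 2 = 2 * (rprod n.+2 c)`_n].
Proof.
have rS k : rprod k.+1 c = rprod k c * ('X - (c k)%:P) by rewrite /rprod big_ord_recr.
elim: n => [|n [H0 H1 H2]].
  rewrite !rS /rprod big_ord0 !big_ord_recr !big_ord0 /= mul1r.
  rewrite !(mulrBr, coefB, coefMX, coefMC, coefX, coefC) /=.
  by split; ring.
rewrite rS !(big_ord_recr n.+2) /= !mulrBr !coefB !coefMX !coefMC /= H0 H1.
rewrite (_ : _`_n.+3 = 0); last first.
  by apply: nth_default; rewrite rprodE size_prod_XsubC size_mkseq.
split; [ring|ring|].
rewrite -[LHS](subrK ((\sum_(i < n.+2) c i) ^+ 2 - \sum_(i < n.+2) c i ^+ 2)) [in X in _ + X]H2.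
ring.
Qed.

(** Together with [rprod_coefs] (Viete, and Newton's identity p_2 = e_1^2 - 2 e_2), this computes
    the sum of the squared eigenvalues from the matrix: squared diagonal entries, plus 2 for each of
    the [n.+1] pairs of off-diagonal entries. *)
Lemma jacp_coefs n :
  [/\ (jacp eps n.+2)`_n.+2 = 1,
      (jacp eps n.+2)`_n.+1 = \sum_(i < n.+2) i%:R * eps &
   (jacp eps n.+2)`_n.+1 ^+ 2 - 2 * (jacp eps n.+2)`_n
      = \sum_(i < n.+2) (i%:R * eps) ^+ 2 + 2 * n.+1%:R].
Proof.
have jS k : jacp eps k.+2 = 'X * jacp eps k.+1 + (k.+1%:R * eps)%:P * jacp eps k.+1 - jacp eps k.
  by rewrite /jacp jacSS mulrDl polyCM polyC_natr.
elim: n => [|n [H0 H1 H2]].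
  rewrite jS /jacp /= !(big_ord_recr, big_ord0) /=.
  rewrite !(coefB, coefD, coefCM, coefXM, coefX, coef1) /=.
  by split; ring.
have sz k : size (jacp eps k) = k.+1 by have [] := jacp_monic eps k.
have z1 : (jacp eps n.+2)`_n.+3 = 0 by apply: nth_default; rewrite sz.
have z2 : (jacp eps n.+1)`_n.+3 = 0 by apply: nth_default; rewrite sz.
have z3 : (jacp eps n.+1)`_n.+2 = 0 by apply: nth_default; rewrite sz.
have z4 : (jacp eps n.+1)`_n.+1 = 1.
  by have [/monicP] := jacp_monic eps n.+1; rewrite /lead_coef => + s; rewrite s.
rewrite jS; move: (jacp eps n.+2) (jacp eps n.+1) H0 H1 H2 z1 z2 z3 z4 => P2 P1 H0 H1 H2 z1 z2 z3 z4.
rewrite !(coefB, coefD, coefCM, coefXM) /= z1 z2 z3 z4 H0.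
rewrite !(big_ord_recr n.+2) /= -H1; split; [ring|ring|].
rewrite -[X in _ = X + _ + _](addrK (2 * n.+1%:R)) -H2 -!natr1; ring.
Qed.

Definition qsec n i : R := jroot n i + i%:R * eps.

(** The trace of the squared section, once through its eigenvalues and once through its entries. *)
Lemma qsec_sq n :
  \sum_(i < n.+1) (qsec n.+1 i - i%:R * eps) ^+ 2 = \sum_(i < n.+1) (i%:R * eps) ^+ 2 + 2 * n%:R.
Proof.
under eq_bigr do rewrite /qsec addrK.
case: n => [|n].
  rewrite !big_ord1 /=; have := jrootE eps_gt0 1; rewrite /jacp /rprod /= big_ord1.
  move=> /(congr1 (fun p => p.[0])); rewrite !hornerE => /eqP; rewrite eq_sym oppr_eq0 => /eqP ->.
  by ring.
have [_ J1 J2] := jacp_coefs n; have [_ P1 P2] := rprod_coefs n (jroot n.+2).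
rewrite -J2 jrootE P1 -P2; ring.
Qed.

Lemma qsec_decr n i : (i.+1 < n)%N -> qsec n i.+1 < qsec n i.
Proof.
case: n => // n; rewrite ltnS => i_n.
rewrite /qsec -natr1.
have := jroot_ltS eps_gt0 i_n; have := jrootSS_lt eps_gt0 i_n; lra.
Qed.

Lemma qsec_le n i j : (i <= j < n)%N -> qsec n j <= qsec n i.
Proof.
move=> /andP[]; rewrite leq_eqVlt => /predU1P[->//|ij] jn.
by apply/ltW/(@decr_lt _ n); [move=> k; exact: qsec_decr|rewrite ij].
Qed.

Lemma qsec_leS n i : (i < n)%N -> qsec n i <= qsec n.+1 i.
Proof. by move=> i_n; rewrite lerD2r ltW // jroot_ltS. Qed.

Lemma qsecSS_le n i : (i < n)%N -> qsec n.+1 i.+1 <= qsec n i.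
Proof. by move=> i_n; have := jrootSS_lt eps_gt0 i_n; rewrite /qsec -natr1; lra. Qed.

Lemma qsec_reflect n i : (i <= n)%N -> qsec n.+1 (n - i)%N = - qsec n.+1 i.
Proof.
move=> i_n; rewrite /qsec (@jroot_reflect _ _ _ n.+1) //= natrB //; ring.
Qed.

Lemma qsec_ge0 n i : (i.*2 <= n)%N -> 0 <= qsec n.+1 i.
Proof.
move=> i_n; have := @qsec_le n.+1 i (n - i)%N; rewrite qsec_reflect; last by lia.
have -> : (i <= n - i < n.+1)%N by lia.
by move=> /(_ isT); lra.
Qed.

Lemma qsec_term_ge0 n i : (i <= n)%N -> 0 <= (n%:R - 2 * i%:R) * qsec n.+1 i.
Proof.
move=> i_n; have [i2|/ltnW i2] := leqP i.*2 n.
  apply: mulr_ge0; last exact: qsec_ge0.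
  by rewrite -natrM mul2n subr_ge0 ler_nat.
have : 0 <= qsec n.+1 (n - i)%N by apply: qsec_ge0; lia.
rewrite qsec_reflect // oppr_ge0 => q0; apply: mulr_le0 => //.
by rewrite -natrM mul2n subr_le0 ler_nat.
Qed.

(** Expanding the squares in [qsec_sq] cancels the sum of the [(i eps)^2]; the sum of the squared
    [qsec] is non-negative and is dropped. The reflection makes the [qsec] sum to 0, so the weight
    [- 2 i] may be replaced by [n - 2 i], which makes every term non-negative. *)
Lemma qsec_moment n : eps * \sum_(i < n.+1) (n%:R - 2 * i%:R) * qsec n.+1 i <= 2 * n%:R.
Proof.
have s0 : \sum_(i < n.+1) qsec n.+1 i = 0.
  have : \sum_(i < n.+1) qsec n.+1 i = - \sum_(i < n.+1) qsec n.+1 i.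
    rewrite -sumrN (reindex_inj rev_ord_inj) /=; apply: eq_bigr => i _.
    by rewrite subSS qsec_reflect // -ltnS.
  by lra.
under eq_bigr do rewrite mulrBl.
rewrite big_split /= -mulr_sumr s0 mulr0 add0r.
have E : \sum_(i < n.+1) (qsec n.+1 i - i%:R * eps) ^+ 2 = \sum_(i < n.+1) qsec n.+1 i ^+ 2 +
    (\sum_(i < n.+1) (i%:R * eps) ^+ 2 - eps * \sum_(i < n.+1) 2 * i%:R * qsec n.+1 i).
  by rewrite mulr_sumr -sumrB -big_split; apply: eq_bigr => i _ /=; ring.
have : 0 <= \sum_(i < n.+1) qsec n.+1 i ^+ 2 by apply: sumr_ge0 => i _; exact: sqr_ge0.
by have := qsec_sq n; rewrite {}E sumrN mulrN; lra.
Qed.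

(** On the first quarter of the indices the weight in [qsec_moment] is at least half the size. The
    remaining terms are non-negative, and dividing by the size makes the bound uniform. *)
Lemma qsec_sum_le n K : (4 * K <= n)%N -> \sum_(i < K) qsec n.+1 i <= 4 / eps.
Proof.
case: n => [|n] Kn.
  have -> : K = 0%N by lia.
  by rewrite big_ord0 divr_ge0 // ltW.
rewrite ler_pdivlMr // mulrC.
have H : eps * \sum_(i < K) n.+1%:R / 2 * qsec n.+2 i <= 2 * n.+1%:R.
  apply: le_trans (qsec_moment n.+1); rewrite ler_pM2l //.
  have Kn2 : (K <= n.+2)%N by lia.
  rewrite -(big_mkord predT (fun i => n.+1%:R / 2 * qsec n.+2 i)).
  rewrite -(big_mkord predT (fun i => (n.+1%:R - 2 * i%:R) * qsec n.+2 i)).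
  rewrite [leRHS](big_cat_nat (n := K)) //= -[leLHS]addr0 lerD //.
    rewrite big_nat [leRHS]big_nat; apply: ler_sum => i /andP[_ iK].
    apply: ler_wpM2r; first by apply: qsec_ge0; lia.
    have : (4 * i)%:R <= n.+1%:R :> R by rewrite ler_nat; lia.
    by rewrite natrM; lra.
  rewrite big_nat; apply: sumr_ge0 => i /andP[Ki i_n]; apply: qsec_term_ge0; lia.
move: H; rewrite -mulr_sumr.
have n0 : 0 < n.+1%:R :> R by rewrite ltr0n.
rewrite (_ : eps * (_ * _) = n.+1%:R * (eps * (\sum_(i < K) qsec n.+2 i) / 2)); last by ring.
rewrite [leRHS]mulrC ler_pM2l // ler_pdivrMr //; lra.
Qed.

Lemma qsec_ub n i : (i < n)%N -> qsec n i <= 4 / eps.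
Proof.
move=> i_n.
have [N [nN iN]] : exists N, (n <= N.+1)%N /\ (4 * i.+1 <= N)%N by exists (n + 4 * i.+1)%N; lia.
apply: (@le_trans _ _ (qsec N.+1 i)).
  elim: (N.+1) nN => [|m IH]; first by move: i_n; case: (n).
  rewrite leq_eqVlt => /predU1P[<-//|]; rewrite ltnS => nm; apply: (le_trans (IH nm)).
  by apply: qsec_leS; lia.
apply: le_trans (qsec_sum_le iN); rewrite big_ord_recr /= lerDr sumr_ge0 // => j _.
by apply: qsec_ge0; have := ltn_ord j; lia.
Qed.

(** Starting at size [i.+1] keeps to the indices below the size, where [jroot] is a root; elsewhere
    its value is arbitrary. *)
Definition qlim i : R := limn (fun n => qsec (n + i.+1) i).

Lemma qlim_facts i : (fun n => qsec (n + i.+1) i) @ \oo --> qlim i /\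
  forall n, qsec (n + i.+1) i <= qlim i.
Proof.
have nd : nondecreasing_seq (fun n => qsec (n + i.+1) i).
  by apply/nondecreasing_seqP => n; rewrite addSn; apply: qsec_leS; lia.
have cv : cvgn (fun n => qsec (n + i.+1) i).
  apply: nondecreasing_is_cvgn => //; exists (4 / eps) => _ [n _ <-].
  by apply: qsec_ub; lia.
by split=> // n; exact: (nondecreasing_cvgn_le nd cv).
Qed.

Lemma qsec_cvg i : (fun n => qsec n i) @ \oo --> qlim i.
Proof. by rewrite -(cvg_shiftn i.+1); have [] := qlim_facts i. Qed.

Lemma qsec_le_qlim n i : (i < n)%N -> qsec n i <= qlim i.
Proof. by move=> i_n; have [_ /(_ (n - i.+1)%N)] := qlim_facts i; rewrite subnK. Qed.

Lemma qlim_ge0 i : 0 <= qlim i.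
Proof. by apply: le_trans (@qsec_le_qlim i.*2.+1 i _); [apply: qsec_ge0|lia]. Qed.

Lemma qlim_decr i : qlim i.+1 <= qlim i.
Proof.
have H1 : (fun n => qsec n.+1 i.+1) @ \oo --> qlim i.+1.
  by have := @qsec_cvg i.+1; rewrite -(cvg_shiftS (fun n => qsec n i.+1)).
apply: (ler_cvg_to H1 (@qsec_cvg i)).
near=> n; apply: qsecSS_le; near: n; by exists i.+1.
Unshelve. all: by end_near. Qed.

Lemma qlim_sum_le K : \sum_(i < K) qlim i <= 4 / eps.
Proof.
have H : (fun n => \sum_(i < K) qsec n.+1 i) @ \oo --> \sum_(i < K) qlim i.
  apply: cvg_big => [|i _]; first exact: add_continuous.
  have := @qsec_cvg i; by rewrite -(cvg_shiftS (fun n => qsec n i)).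
by apply: (cvgr_to_le H); exists (4 * K)%N => // n Kn; exact: qsec_sum_le.
Qed.

(** The lower half of a section is the mirror image of its upper half, so no single summable
    sequence dominates all sections. Two copies of [qlim], one read backwards, do. *)
Lemma qsec_norm_le n i : (i <= n)%N -> `|qsec n.+1 i| <= qlim i + qlim (n - i)%N.
Proof.
move=> i_n; rewrite ler_norml.
have := @qsec_le_qlim n.+1 i; rewrite ltnS i_n => /(_ isT) H1.
have := @qsec_le_qlim n.+1 (n - i)%N; rewrite ltnS leq_subr qsec_reflect // => /(_ isT) H2.
have := qlim_ge0 i; have := qlim_ge0 (n - i)%N; lra.
Qed.

End JacobiShift.

(** * Complex limits and infinite products *)

Section ComplexLimits.
Context {R : realType}.
Implicit Types (x y z u : complex R) (a b : nat -> complex R).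
Local Notation "x %:C" := (real_complex R x).

Lemma normc_ge0 x : 0 <= normc x.
Proof. by case: x => r i; exact: sqrtr_ge0. Qed.
Hint Resolve normc_ge0 : core.

Lemma normcD_le x y : normc (x + y) <= normc x + normc y.
Proof. exact: (@le_normcD R x y). Qed.

Lemma normcNE x : normc (- x) = normc x.
Proof. exact: (@normcN R x). Qed.

Lemma normcBC x y : normc (x - y) = normc (y - x).
Proof. by rewrite -normcNE opprB. Qed.

Lemma normc_eq0 x : (normc x == 0) = (x == 0).
Proof. by apply/eqP/eqP => [/eq0_normc//|->]; exact: normc0. Qed.

Lemma normc_gt0 x : (0 < normc x) = (x != 0).
Proof. by rewrite lt_neqAle normc_ge0 andbT eq_sym normc_eq0. Qed.

Lemma normcR (r : R) : normc r%:C = `|r|.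
Proof. by rewrite /= expr0n /= addr0 sqrtr_sqr. Qed.

Lemma normc_div x y : normc (x / y) = normc x / normc y.
Proof. by rewrite normcM normcV. Qed.

Lemma normc_prod (I : Type) (r : seq I) (P : pred I) (F : I -> complex R) :
  normc (\prod_(i <- r | P i) F i) = \prod_(i <- r | P i) normc (F i).
Proof. by apply: (big_morph (@normc R) (@normcM R)); exact: normc1. Qed.

Lemma normc_sum (I : Type) (r : seq I) (P : pred I) (F : I -> complex R) :
  normc (\sum_(i <- r | P i) F i) <= \sum_(i <- r | P i) normc (F i).
Proof.
elim/big_rec2: _ => [|i y1 x1 _ xy]; first by rewrite normc0.
by apply: le_trans (normcD_le _ _) _; rewrite lerD2l.
Qed.

Lemma normcB_ge x y : normc x - normc y <= normc (x - y).
Proof. by rewrite lerBlDr -{1}(subrK y x); exact: normcD_le. Qed.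

Lemma normcD_ge x y : normc x - normc y <= normc (x + y).
Proof. by have := normcB_ge x (- y); rewrite normcNE opprK. Qed.

Lemma Re_le_normc x : `|complex.Re x| <= normc x.
Proof. by rewrite -lecR; exact: normc_ge_Re. Qed.

Lemma Im_le_normc x : `|complex.Im x| <= normc x.
Proof.
case: x => r i /=; rewrite -sqrtr_sqr ler_wsqrtr // lerDr; exact: sqr_ge0.
Qed.

Lemma normc_le_ReIm x : normc x <= `|complex.Re x| + `|complex.Im x|.
Proof.
case: x => r i /=; apply: (@le_trans _ _ (Num.sqrt ((`|r| + `|i|) ^+ 2))).
  rewrite ler_wsqrtr // sqrrD !real_normK ?num_real // lerD2r lerDl.
  by rewrite mulrn_wge0 // mulr_ge0.
by rewrite sqrtr_sqr ger0_norm // addr_ge0.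
Qed.

Lemma Re_sub x y : complex.Re (x - y) = complex.Re x - complex.Re y.
Proof. by case: x => ? ?; case: y. Qed.

Lemma Im_sub x y : complex.Im (x - y) = complex.Im x - complex.Im y.
Proof. by case: x => ? ?; case: y. Qed.

Lemma Re_add x y : complex.Re (x + y) = complex.Re x + complex.Re y.
Proof. by case: x => ? ?; case: y. Qed.

Lemma Im_add x y : complex.Im (x + y) = complex.Im x + complex.Im y.
Proof. by case: x => ? ?; case: y. Qed.

(** Convergence goes through the real sequence of moduli, so that limit theorems for real sequences
    apply. *)
Definition ccvg a x := normc (a n - x) @[n --> \oo] --> (0 : R).

Lemma ccvgP a x : ccvg a x <-> forall e : R, 0 < e -> \forall n \near \oo, normc (a n - x) < e.
Proof.
split=> [/cvgrPdist_lt ax e e0|ax].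
  by move: (ax e e0); apply: filterS => n; rewrite sub0r normrN ger0_norm.
by apply/cvgrPdist_lt => e /ax; apply: filterS => n; rewrite sub0r normrN ger0_norm.
Qed.

Lemma ccvg_unique a x y : ccvg a x -> ccvg a y -> x = y.
Proof.
move=> /ccvgP ax /ccvgP ay; apply/eqP; rewrite -subr_eq0 -normc_eq0; apply/eqP.
apply/eqP; rewrite eq_le normc_ge0 andbT; apply/ler_addgt0Pl => e e0; rewrite addr0.
near \oo => n.
have -> : x - y = (a n - y) - (a n - x) by ring.
apply: le_trans (normcD_le _ _) _; rewrite normcNE (splitr e) lerD // ltW //.
  by near: n; apply: ay; rewrite divr_gt0.
by near: n; apply: ax; rewrite divr_gt0.
Unshelve. all: by end_near. Qed.

Lemma ccvg_le a x (b : nat -> R) : b @ \oo --> (0 : R) ->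
  (\forall n \near \oo, normc (a n - x) <= b n) -> ccvg a x.
Proof.
move=> b0 ab; apply: (@squeeze_cvgr _ _ _ _ (fun=> 0) b); [|exact: cvg_cst|exact: b0].
by near=> n; rewrite normc_ge0 /=; near: n.
Unshelve. all: by end_near. Qed.

Lemma ccvg_cst x : ccvg (fun=> x) x.
Proof. by rewrite /ccvg subrr normc0; exact: cvg_cst. Qed.

Lemma ccvgD a b x y : ccvg a x -> ccvg b y -> ccvg (fun n => a n + b n) (x + y).
Proof.
move=> ax bY; apply: (@ccvg_le _ _ (fun n => normc (a n - x) + normc (b n - y))).
  have : (normc (a n - x) + normc (b n - y)) @[n --> \oo] --> (0 + 0 : R) by apply: cvgD.
  by rewrite addr0.
by near=> n; rewrite opprD addrACA normcD_le.
Unshelve. all: by end_near. Qed.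

Lemma ccvgN a x : ccvg a x -> ccvg (fun n => - a n) (- x).
Proof.
move=> ax; apply: (@ccvg_le _ _ (fun n => normc (a n - x))) => //.
by near=> n; rewrite -opprD normcNE.
Unshelve. all: by end_near. Qed.

Lemma ccvgB a b x y : ccvg a x -> ccvg b y -> ccvg (fun n => a n - b n) (x - y).
Proof. by move=> ax bY; apply: ccvgD => //; exact: ccvgN. Qed.

Lemma ccvgM a b x y : ccvg a x -> ccvg b y -> ccvg (fun n => a n * b n) (x * y).
Proof.
move=> ax bY; apply: (@ccvg_le _ _ (fun n => normc (a n - x) * normc (b n - y)
   + normc (a n - x) * normc y + normc x * normc (b n - y))).
  have : (normc (a n - x) * normc (b n - y) + normc (a n - x) * normc y
      + normc x * normc (b n - y)) @[n --> \oo] --> (0 * 0 + 0 * normc y + normc x * 0 : R).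
    apply: cvgD; first apply: cvgD; apply: cvgM => //; exact: cvg_cst.
  by rewrite !mul0r mulr0 !addr0.
near=> n; rewrite -!normcM.
have -> : a n * b n - x * y = (a n - x) * (b n - y) + (a n - x) * y + x * (b n - y) by ring.
by apply: le_trans (normcD_le _ _) _; rewrite lerD2r normcD_le.
Unshelve. all: by end_near. Qed.

Lemma ccvgV a x : x != 0 -> ccvg a x -> ccvg (fun n => (a n)^-1) x^-1.
Proof.
move=> x0 ax; have nx0 : 0 < normc x by rewrite normc_gt0.
apply: (@ccvg_le _ _ (fun n => (2 / normc x ^+ 2) * normc (a n - x))).
  have : (2 / normc x ^+ 2 * normc (a n - x)) @[n --> \oo] --> (2 / normc x ^+ 2 * 0 : R).
    by apply: cvgM => //; exact: cvg_cst.
  by rewrite mulr0.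
have /ccvgP/(_ (normc x / 2)) := ax; rewrite divr_gt0 // => /(_ isT).
apply: filterS => n an.
have an2 : normc x / 2 <= normc (a n).
  by have := normcB_ge x (x - a n); rewrite subKr normcBC; lra.
have an0 : a n != 0 by rewrite -normc_gt0 (lt_le_trans _ an2) ?divr_gt0.
have -> : (a n)^-1 - x^-1 = (x - a n) * ((a n)^-1 * x^-1) by field; rewrite x0 an0.
rewrite normcM normcBC mulrC ler_wpM2r // normcM !normcV.
rewrite expr2 invfM mulrA ler_wpM2r ?invr_ge0 // -[leRHS]invf_div lef_pV2 ?posrE ?divr_gt0 //.
by rewrite normc_gt0.
Qed.

Lemma ccvg_norm_le a x (M : R) : ccvg a x -> (\forall n \near \oo, normc (a n) <= M) -> normc x <= M.
Proof.
move=> /ccvgP ax aM; apply/ler_addgt0Pl => e e0.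
near \oo => n; have : normc (a n - x) < e by near: n; exact: ax.
have : normc (a n) <= M by near: n.
by have := normcB_ge x (x - a n); rewrite subKr normcBC; lra.
Unshelve. all: by end_near. Qed.

Lemma ccvg_shift a x k : ccvg a x -> ccvg (fun n => a (n + k)%N) x.
Proof. by rewrite /ccvg => ax; have := ax; rewrite -(cvg_shiftn k (fun n => normc (a n - x))). Qed.

Lemma bounded_variation_cvg (a : nat -> R) S :
  (forall n, \sum_(i < n) `|a i.+1 - a i| <= S) -> cvgn a.
Proof.
move=> aS.
have : cvgn (series (telescope a)).
  apply: normed_cvg; apply: nondecreasing_is_cvgn.
    by apply: (@nondecreasing_series _ (fun k => `|telescope a k|) predT 0).
  exists S => _ [n _ <-]; rewrite -[leLHS]/(\sum_(0 <= k < n) `|telescope a k|) big_mkord.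
  exact: aS.
rewrite telescopeK => cv.
have -> : a = (fun n => (a n - a 0%N) + a 0%N) by apply/funext => n; rewrite subrK.
by apply: is_cvgD => //; exact: is_cvg_cst.
Qed.

Lemma cbounded_variation_cvg a S :
  (forall n, \sum_(i < n) normc (a i.+1 - a i) <= S) -> exists x, ccvg a x.
Proof.
move=> aS.
have cR : cvgn (fun n => complex.Re (a n)).
  apply: (@bounded_variation_cvg _ S) => n; apply: le_trans (aS n).
  by apply: ler_sum => i _; rewrite -Re_sub; exact: Re_le_normc.
have cI : cvgn (fun n => complex.Im (a n)).
  apply: (@bounded_variation_cvg _ S) => n; apply: le_trans (aS n).
  by apply: ler_sum => i _; rewrite -Im_sub; exact: Im_le_normc.
exists (complex.Complex (limn (fun n => complex.Re (a n))) (limn (fun n => complex.Im (a n)))).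
apply: (@ccvg_le _ _ (fun n => `|complex.Re (a n) - limn (fun n => complex.Re (a n))| +
  `|complex.Im (a n) - limn (fun n => complex.Im (a n))|)).
  set l1 := limn _; set l2 := limn _.
  have : (`|complex.Re (a n) - l1| + `|complex.Im (a n) - l2|) @[n --> \oo] --> (`|l1 - l1| + `|l2 - l2| : R).
    by apply: cvgD; apply: cvg_norm; apply: cvgB => //; exact: cvg_cst.
  by rewrite !subrr normr0 addr0.
by near=> n; apply: le_trans (normc_le_ReIm _) _; rewrite Re_sub Im_sub.
Unshelve. all: by end_near. Qed.

(** Total: the value is 0 when there is no limit. *)
Definition clim a : complex R := xget 0 [set x | ccvg a x].

Lemma clim_ccvg a x : ccvg a x -> ccvg a (clim a).
Proof. by move=> ax; apply: (@xgetPex _ 0 [set x | ccvg a x]); exists x. Qed.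

Lemma climE a x : ccvg a x -> clim a = x.
Proof. by move=> ax; exact: ccvg_unique (clim_ccvg ax) ax. Qed.

End ComplexLimits.

#[export] Hint Extern 0 (is_true (_ <= normc _)) => solve [exact: normc_ge0] : core.

Section InfiniteProducts.
Context {R : realType}.
Implicit Types (x y : nat -> complex R) (S : R).

Lemma tail_sum_le (b : nat -> R) S : (forall i, 0 <= b i) ->
  (forall n, \sum_(i < n) b i <= S) ->
  forall e, 0 < e -> exists N, forall n, \sum_(i < n) b (N + i)%N <= e.
Proof.
move=> b0 bS e e0; pose s n := \sum_(i < n) b i.
have nd : nondecreasing_seq s.
  by apply/nondecreasing_seqP => n; rewrite /s big_ord_recr /= lerDl.
have cv : cvgn s by apply: nondecreasing_is_cvgn => //; exists S => _ [n _ <-]; exact: bS.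
have [N _ HN] : \forall n \near \oo, limn s - e < s n.
  have /cvgrPdist_lt/(_ e e0) := cv; apply: filterS => n.
  by rewrite ltr_norml => /andP[_]; lra.
exists N => n.
have : s (N + n)%N <= limn s by exact: (nondecreasing_cvgn_le nd cv).
have := HN N (leqnn N); rewrite /s big_split_ord /=; lra.
Qed.

Definition cprodn x n := \prod_(i < n) (1 + x i).

Lemma cprodnS x n : cprodn x n.+1 = cprodn x n * (1 + x n).
Proof. by rewrite /cprodn big_ord_recr. Qed.

Lemma cprodn_norm_le x n : normc (cprodn x n) <= expR (\sum_(i < n) normc (x i)).
Proof.
elim: n => [|n IH]; first by rewrite /cprodn !big_ord0 normc1 expR0.
rewrite cprodnS normcM big_ord_recr /= expRD ler_pM //.
apply: le_trans (normcD_le _ _) _; rewrite normc1; exact: expR_ge1Dx.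
Qed.

Lemma cprodn_diff_le x y n : normc (cprodn x n - cprodn y n) <=
  expR (\sum_(i < n) normc (x i) + \sum_(i < n) normc (y i)) * \sum_(i < n) normc (x i - y i).
Proof.
elim: n => [|n IH]; first by rewrite /cprodn !big_ord0 subrr normc0 mulr0.
rewrite !cprodnS !big_ord_recr /=.
have -> : cprodn x n * (1 + x n) - cprodn y n * (1 + y n) =
  (cprodn x n - cprodn y n) * (1 + x n) + cprodn y n * (x n - y n) by ring.
apply: le_trans (normcD_le _ _) _; rewrite !normcM mulrDr lerD //.
  apply: (@le_trans _ _ (normc (cprodn x n - cprodn y n) * expR (normc (x n)))).
    rewrite ler_wpM2l //; apply: le_trans (normcD_le _ _) _.
    by rewrite normc1; exact: expR_ge1Dx.
  apply: (@le_trans _ _ (expR (\sum_(i < n) normc (x i) + \sum_(i < n) normc (y i)) *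
    (\sum_(i < n) normc (x i - y i)) * expR (normc (x n)))).

    by rewrite ler_wpM2r // expR_ge0.
  rewrite mulrAC ler_wpM2r ?sumr_ge0 // -expRD ler_expR addrACA lerD2l.
  by rewrite lerDl.
rewrite ler_wpM2r //; apply: le_trans (cprodn_norm_le _ _) _.
rewrite ler_expR addrA -addrA addrCA addrA -addrA lerDl.
by rewrite !addr_ge0 ?sumr_ge0.
Qed.

Definition cprod x : complex R := clim (cprodn x).

Section Summable.
Variables (x : nat -> complex R) (S : R).
Hypothesis xS : forall n, \sum_(i < n) normc (x i) <= S.

Let S0 : 0 <= S.
Proof. by have := xS 0; rewrite big_ord0. Qed.

Lemma cprod_cvg : ccvg (cprodn x) (cprod x).
Proof.
have [|l /clim_ccvg//] := @cbounded_variation_cvg R (cprodn x) (expR S * S).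
move=> n; apply: (@le_trans _ _ (\sum_(i < n) expR S * normc (x i))).
  apply: ler_sum => i _; rewrite cprodnS mulrDr mulr1 addrC addKr normcM ler_wpM2r //.
  by apply: le_trans (cprodn_norm_le _ _) _; rewrite ler_expR.
by rewrite -mulr_sumr ler_wpM2l ?expR_ge0.
Qed.

Lemma cprod_norm_le : normc (cprod x) <= expR S.
Proof.
apply: (ccvg_norm_le cprod_cvg); near=> n.
by apply: le_trans (cprodn_norm_le _ _) _; rewrite ler_expR.
Unshelve. all: by end_near. Qed.

Lemma cprod_sub1_le : normc (cprod x - 1) <= expR S * S.
Proof.
apply: (ccvg_norm_le (ccvgB cprod_cvg (ccvg_cst 1))); near=> n.
have := @cprodn_diff_le x (fun=> 0) n.
have -> : cprodn (fun=> 0) n = 1 by rewrite /cprodn big1 // => i _; rewrite addr0.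
move=> /le_trans; apply; rewrite [X in _ + X]big1 => [|i _]; last by rewrite normc0.
rewrite addr0 [X in _ * X](eq_bigr (fun i : 'I_n => normc (x i))) => [|i _]; last by rewrite subr0.
by rewrite ler_pM ?expR_ge0 ?sumr_ge0 ?ler_expR ?xS //; exact: xS.
Unshelve. all: by end_near. Qed.

Lemma cprod_split N : cprod x = cprodn x N * cprod (fun i => x (N + i)%N).
Proof.
apply: climE; have /(ccvg_shift N) := cprod_cvg.
have [|l xl] := @cbounded_variation_cvg R (cprodn (fun i => x (N + i)%N)) (expR S * S).
  move=> n; apply: (@le_trans _ _ (\sum_(i < n) expR S * normc (x (N + i)%N))).
    apply: ler_sum => i _; rewrite cprodnS mulrDr mulr1 addrC addKr normcM ler_wpM2r //.
    apply: le_trans (cprodn_norm_le _ _) _; rewrite ler_expR.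
    by apply: le_trans (xS (N + i)); rewrite big_split_ord /= lerDr sumr_ge0.
  rewrite -mulr_sumr ler_wpM2l ?expR_ge0 //.
  by apply: le_trans (xS (N + n)); rewrite big_split_ord /= lerDr sumr_ge0.
have := ccvgM (ccvg_cst (cprodn x N)) (clim_ccvg xl).
have -> : (fun n => cprodn x N * cprodn (fun i => x (N + i)%N) n) = (fun n => cprodn x (n + N)%N).
  by apply/funext => n; rewrite /cprodn addnC big_split_ord.
move=> H1 H2; rewrite (ccvg_unique H1 H2); exact: cprod_cvg.
Qed.

End Summable.

Lemma cprod_near1 x : (forall n, \sum_(i < n) normc (x i) <= 1 / 4) -> normc (cprod x - 1) <= 1 / 2.
Proof.
move=> /cprod_sub1_le /le_trans; apply.
(* [expR (- (1 / 4))] is at least 3/4, so the product is within 1/3 of 1. *)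
have : expR (1 / 4) <= 4 / 3 :> R.
  rewrite -[leLHS]invrK -expRN -[leRHS]invrK lef_pV2 ?posrE ?expR_gt0 ?invr_gt0 //.
  by apply: le_trans (expR_ge1Dx _); lra.
by have := @expR_gt0 R (1 / 4); lra.
Qed.

Lemma near1_norm (z : complex R) : normc (z - 1) <= 1 / 2 -> 1 / 2 <= normc z <= 3 / 2.
Proof.
move=> z1; have := normcB_ge 1 (1 - z); rewrite subKr normcBC normc1.
have := normcD_le (z - 1) 1; rewrite subrK normc1; lra.
Qed.

Lemma cprod_neq0 x S : (forall n, \sum_(i < n) normc (x i) <= S) ->
  (forall i, 1 + x i != 0) -> cprod x != 0.
Proof.
move=> xS x0.
have [|||N HN] := @tail_sum_le (fun i => normc (x i)) S _ _ (1 / 4) _ => //.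
rewrite (cprod_split xS N) mulf_neq0 //.
  by rewrite /cprodn prodf_seq_neq0; apply/allP => i _ /=; exact: x0.
have /near1_norm/andP[+ _] := @cprod_near1 (fun i => x (N + i)%N) HN.
by rewrite -normc_gt0; apply: lt_le_trans; lra.
Qed.

(** Tannery's theorem for products whose factors vary with their number, with domination replaced by
    convergence in l^1. *)
Lemma cprod_dominated x (X : nat -> nat -> complex R) S :
  (forall n, \sum_(i < n) normc (x i) <= S) ->
  (forall n, \sum_(i < n) normc (X n i) <= S) ->
  (\sum_(i < n) normc (X n i - x i)) @[n --> \oo] --> (0 : R) ->
  ccvg (fun n => cprodn (X n) n) (cprod x).
Proof.
move=> xS XS X0.
have H : ccvg (fun n => cprodn (X n) n - cprodn x n) 0.
  apply: (@ccvg_le _ _ _ (fun n => expR (S + S) * \sum_(i < n) normc (X n i - x i))).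
    have : (expR (S + S) * \sum_(i < n) normc (X n i - x i)) @[n --> \oo] --> (expR (S + S) * 0 : R).
      by apply: cvgM => //; exact: cvg_cst.
    by rewrite mulr0.
  near=> n; rewrite subr0; apply: le_trans (cprodn_diff_le _ _ _) _.
  by rewrite ler_wpM2r ?sumr_ge0 // ler_expR lerD.
have := ccvgD H (cprod_cvg xS); rewrite add0r.
by have -> : (fun n => cprodn (X n) n - cprodn x n + cprodn x n) = (fun n => cprodn (X n) n)
  by apply/funext => n; rewrite subrK.
Unshelve. all: by end_near. Qed.

End InfiniteProducts.

(** * The solution of the difference equation *)

Section Transfer.
Context {R : realType} (eps : R) (eps_gt0 : 0 < eps).
Local Notation "x %:C" := (real_complex R x).
Local Notation q := (qlim eps_gt0).
Local Notation e := (eps%:C).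
Implicit Types u : complex R.

Definition pole i : R := q i - i%:R * eps.
Definition gap i : R := q i - q i.+1.

Lemma gap_ge0 i : 0 <= gap i.
Proof. by rewrite subr_ge0; exact: qlim_decr. Qed.

Lemma gap_sum n : \sum_(i < n) gap i = q 0%N - q n.
Proof. by elim: n => [|n IH]; rewrite ?big_ord0 ?subrr // big_ord_recr /= IH /gap addrA subrK. Qed.

Lemma qlim_le0 i : q i <= q 0%N.
Proof. by rewrite -subr_ge0 -gap_sum sumr_ge0 // => j _; exact: gap_ge0. Qed.

Lemma real_complex_nat n : n%:R * e = (n%:R * eps)%:C.
Proof. by rewrite rmorphM rmorph_nat. Qed.

Lemma dist_lower (c : nat -> complex R) (C : R) :
  (forall k, k%:R * eps - C <= normc (c k)) -> (forall k, c k != 0) ->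
  exists2 d, 0 < d & forall k, d <= normc (c k).
Proof.
move=> cC c0.
have fin K : exists2 d, 0 < d & forall k, (k < K)%N -> d <= normc (c k).
  elim: K => [|K [d d0 dK]]; first by exists 1.
  exists (Num.min d (normc (c K))); first by rewrite lt_min d0 normc_gt0 c0.
  move=> k; rewrite ltnS leq_eqVlt => /predU1P[->|/dK]; first by rewrite ge_min lexx orbT.
  by rewrite ge_min => ->.
(* From this index on, [k eps - C] is at least 1, so only finitely many moduli remain. *)
have [d d0 dK] := fin (Num.truncn ((C + 1) / eps)).+1.
exists (Num.min d 1); first by rewrite lt_min d0 ltr01.
move=> k; have [/dK|Kk] := ltnP k (Num.truncn ((C + 1) / eps)).+1; rewrite ge_min; first by move=> ->.
apply/orP; right; apply: le_trans (cC k).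
suff : (C + 1) / eps <= k%:R by rewrite ler_pdivrMr //; lra.
by apply: ltW; apply: lt_le_trans (truncnS_gt _) _; rewrite ler_nat.
Qed.

Lemma shift_growth u k : k%:R * eps - normc u <= normc (u + k%:R * e).
Proof.
have ke : 0 <= k%:R * eps by apply: mulr_ge0; [exact: ler0n|exact: ltW].
rewrite (addrC u) real_complex_nat; have := normcD_ge (k%:R * eps)%:C u.
by rewrite normcR ger0_norm.
Qed.

Lemma pole_growth u k : k%:R * eps - (q 0%N + normc u) <= normc (u - (pole k)%:C).
Proof.
rewrite normcBC; have := normcB_ge (pole k)%:C u; rewrite normcR.
have : k%:R * eps - q 0%N <= `|pole k|.
  by rewrite /pole distrC; apply: le_trans (ler_norm _); have := qlim_le0 k; lra.
lra.
Qed.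

(** The excluded points 0, - eps, - 2 eps, ... are where factors of [G] have their denominators.
    They are artefacts of the normalization and disappear from [T]. *)
Definition regular u := forall k, u + k%:R * e != 0.

Lemma regularS u : regular u -> regular (u + e).
Proof. by move=> ru k; have := ru k.+1; rewrite -natr1 mulrDl mul1r (addrC _ e) addrA. Qed.

Lemma regular0 u : regular u -> u != 0.
Proof. by move=> /(_ 0%N); rewrite mul0r addr0. Qed.

Definition gterm u i : complex R := - (q i)%:C / (u + i%:R * e).

(** This is 0F1(; u/eps; - 1/eps^2), that is J_{u/eps - 1}(2/eps) up to a Gamma factor and a power
    of eps. The product displays its zeroes as a function of the order. *)
Definition G u := cprod (gterm u).

Lemma gterm_sum u d : 0 < d -> (forall k, d <= normc (u + k%:R * e)) ->
  forall n, \sum_(i < n) normc (gterm u i) <= 4 / eps / d.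
Proof.
move=> d0 du n; rewrite mulrC ler_pdivlMl //.
apply: le_trans (qlim_sum_le eps_gt0 n); rewrite mulr_sumr; apply: ler_sum => i _.
rewrite /gterm normc_div normcNE normcR ger0_norm ?qlim_ge0 // mulrCA.
rewrite ler_piMr ?qlim_ge0 // ler_pdivrMr ?mul1r //; exact: lt_le_trans (du i).
Qed.

Lemma regular_dist u : regular u -> exists2 d, 0 < d & forall k, d <= normc (u + k%:R * e).
Proof. by move=> ru; apply: (@dist_lower _ (normc u)) => // k; exact: shift_growth. Qed.

Definition sterm n u i : complex R := - (qsec eps_gt0 n i)%:C / (u + i%:R * e).

Lemma sterm_sum u d : 0 < d -> (forall k, d <= normc (u + k%:R * e)) ->
  forall n, \sum_(i < n) normc (sterm n u i) <= 4 / eps / d + 4 / eps / d.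
Proof.
move=> d0 du [|n].
  by rewrite big_ord0 addr_ge0 // !divr_ge0 // ltW.
rewrite -mulrDl mulrC ler_pdivlMl // mulr_sumr.
apply: (@le_trans _ _ (\sum_(i < n.+1) (q i + q (n - i)%N))).
  apply: ler_sum => i _; rewrite /sterm normc_div normcNE normcR mulrCA.
  have i_n : (i <= n)%N by rewrite -ltnS.
  apply: le_trans (qsec_norm_le eps_gt0 i_n).
  rewrite ler_piMr // ler_pdivrMr ?mul1r //; exact: lt_le_trans (du i).
rewrite big_split /= lerD ?qlim_sum_le //.
rewrite (reindex_inj rev_ord_inj) /=; apply: le_trans (qlim_sum_le eps_gt0 n.+1).
by apply: ler_sum => i _; rewrite subSS subKn // -ltnS.
Qed.

(** Up to a fixed index [K] the terms converge one by one. Beyond it, [qsec_norm_le] bounds the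
    difference by [2 q_i] plus the mirrored value: the first sums to a small tail, while the second
    is not small but is divided by a modulus that is large for [i >= K]. *)
Lemma sterm_cvg u : regular u ->
  (\sum_(i < n) normc (sterm n u i - gterm u i)) @[n --> \oo] --> (0 : R).
Proof.
move=> ru; have [d d0 du] := regular_dist ru.
apply/cvgrPdist_lt => del del0.
have [K1 HK1] : exists K, forall n, \sum_(i < n) q (K + i)%N <= del * d / 8.
  apply: (@tail_sum_le _ _ (4 / eps)).
  - by move=> i; exact: qlim_ge0.
  - by move=> n; exact: qlim_sum_le.
  - by rewrite divr_gt0 // mulr_gt0.
(* The mirrored values sum to at most [4 / eps]; divided by [D] this is [del / 4]. *)
pose D := 16 / (eps * del).
have D0 : 0 < D by rewrite divr_gt0 // mulr_gt0.
pose K := (K1 + (Num.truncn ((D + normc u) / eps)).+1)%N.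
have HD i : (K <= i)%N -> D <= normc (u + i%:R * e).
  move=> Ki; apply: le_trans (shift_growth u i).
  suff : (D + normc u) / eps <= i%:R by rewrite ler_pdivrMr //; lra.
  by apply: ltW; apply: lt_le_trans (truncnS_gt _) _; rewrite ler_nat; apply: leq_trans Ki; rewrite leq_addl.
have HK n : \sum_(i < n) q (K + i)%N <= del * d / 8.
  apply: le_trans (HK1 (K - K1 + n)%N); rewrite big_split_ord /=.
  rewrite -[leLHS]add0r lerD //; first by apply: sumr_ge0 => i _; exact: qlim_ge0.
  by apply: ler_sum => i _; rewrite addnA subnKC // leq_addr.
have fin : (\sum_(i < K) `|qsec eps_gt0 n i - q i|) @[n --> \oo] --> (0 : R).
  have : (\sum_(i < K) `|qsec eps_gt0 n i - q i|) @[n --> \oo] --> \sum_(i < K) `|q i - q i|.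
    apply: cvg_big => [|i _]; first exact: add_continuous.
    by apply: cvg_norm; apply: cvgB; [exact: qsec_cvg|exact: cvg_cst].
  by rewrite [X in _ --> X]big1 // => i _; rewrite subrr normr0.
have /cvgrPdist_lt/(_ (del * d / 4)) := fin; rewrite divr_gt0 ?mulr_gt0 // => /(_ isT) fin4.
near=> n.
have Kn : (K < n)%N by near: n; exists K.+1.
have Hfin : \sum_(i < K) `|qsec eps_gt0 n i - q i| < del * d / 4.
  have : `|0 - \sum_(i < K) `|qsec eps_gt0 n i - q i| | < del * d / 4 by near: n.
  by rewrite sub0r normrN ger0_norm // sumr_ge0.
rewrite sub0r normrN ger0_norm ?sumr_ge0 //.
have term i : normc (sterm n u i - gterm u i) = `|qsec eps_gt0 n i - q i| / normc (u + i%:R * e).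
  by rewrite /sterm /gterm -mulrBl -opprD normc_div normcNE -rmorphB normcR.
have -> : n = (K + (n - K))%N by rewrite subnKC // ltnW.
rewrite big_split_ord /= subnKC ?(ltnW Kn) //.
have B1 : \sum_(i < K) normc (sterm n u i - gterm u i) <= (\sum_(i < K) `|qsec eps_gt0 n i - q i|) / d.
  rewrite mulr_suml; apply: ler_sum => i _; rewrite term ler_wpM2l //.
  by rewrite lef_pV2 ?posrE // (lt_le_trans d0).
have B2 : \sum_(i < n - K) normc (sterm n u (K + i)%N - gterm u (K + i)%N) <=
   2 * (\sum_(i < n - K) q (K + i)%N) / d + (\sum_(i < n - K) q (n.-1 - (K + i))%N) / D.
  rewrite mulr_sumr !mulr_suml -big_split /=; apply: ler_sum => i _; rewrite term.
  have Kin : (K + i <= n.-1)%N by have := ltn_ord i; lia.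
  have := qsec_norm_le eps_gt0 Kin; rewrite prednK ?(leq_ltn_trans _ Kn) // => Hq.
  apply: (@le_trans _ _ ((2 * q (K + i)%N + q (n.-1 - (K + i))%N) / normc (u + (K + i)%:R * e))).
    rewrite ler_wpM2r ?invr_ge0 //; apply: le_trans (ler_normB _ _) _.
    by rewrite (ger0_norm (qlim_ge0 _ _)); lra.
  rewrite mulrDl lerD // ler_wpM2l ?mulr_ge0 ?qlim_ge0 //.
    by rewrite lef_pV2 ?posrE // (lt_le_trans d0).
  by rewrite lef_pV2 ?posrE //; [exact: HD (leq_addr _ _)|exact: lt_le_trans d0 (du _)].
have B3 : \sum_(i < n - K) q (n.-1 - (K + i))%N <= 4 / eps.
  rewrite (reindex_inj rev_ord_inj) /=; apply: le_trans (qlim_sum_le eps_gt0 (n - K)).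
  apply: ler_sum => i _; rewrite le_eqVlt; apply/orP; left; apply/eqP; congr q.
  by have := ltn_ord i; lia.
have C1 : (\sum_(i < K) `|qsec eps_gt0 n i - q i|) / d < del / 4 by rewrite ltr_pdivrMr // mulrAC.
have C2 : 2 * (\sum_(i < n - K) q (K + i)%N) / d <= del / 4.
  by rewrite ler_pdivrMr //; have := HK (n - K)%N; lra.
have C3 : (\sum_(i < n - K) q (n.-1 - (K + i))%N) / D <= del / 4.
  rewrite ler_pdivrMr //; apply: le_trans B3 _; rewrite le_eqVlt; apply/orP; left; apply/eqP.
  by rewrite /D; field; rewrite !gt_eqF.
lra.
Unshelve. all: by end_near. Qed.

Lemma G_cvg u : regular u -> ccvg (cprodn (gterm u)) (G u).
Proof. by move=> /regular_dist[d d0 du]; exact: cprod_cvg (gterm_sum d0 du). Qed.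

Lemma section_prod n u : regular u ->
  cprodn (sterm n u) n = jac e u n / \prod_(k < n) (u + k%:R * e).
Proof.
move=> ru; rewrite (jac_prodC eps_gt0) -prodf_div; apply: eq_bigr => i _.
rewrite /sterm /qsec rmorphD /= -real_complex_nat; field; exact: ru.
Qed.

Lemma section_cvg u : regular u -> ccvg (fun n => cprodn (sterm n u) n) (G u).
Proof.
move=> ru; have [d d0 du] := regular_dist ru.
apply: (@cprod_dominated _ _ (fun n => sterm n u) (4 / eps / d + 4 / eps / d)).
- move=> n; apply: le_trans (gterm_sum d0 du n) _.
  by rewrite lerDl !divr_ge0 // ltW.
- exact: sterm_sum.
- exact: sterm_cvg.
Qed.

(** The limit of [jac_first_row], each determinant being divided by the product of its diagonal
    entries. The three terms have sizes n+2, n+1 and n, whence the shifted sequences. *)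
Lemma G_rec u : regular u -> G u = G (u + e) - G (u + e + e) / (u * (u + e)).
Proof.
move=> ru; have ru1 := regularS ru; have ru2 := regularS ru1.
have H := ccvgB (ccvg_shift 1 (section_cvg ru1))
  (ccvgM (section_cvg ru2) (ccvg_cst (u * (u + e))^-1)).
apply: ccvg_unique (ccvg_shift 2 (section_cvg ru)) _.
have -> // : (fun n => cprodn (sterm (n + 2) u) (n + 2)) =
  (fun n => cprodn (sterm (n + 1) (u + e)) (n + 1) -
     cprodn (sterm n (u + e + e)) n * (u * (u + e))^-1).
apply/funext => n; rewrite !section_prod // addn1 addn2 jac_first_row.
have Pr v m : \prod_(k < m.+1) (v + k%:R * e) = v * \prod_(k < m) (v + e + k%:R * e).
  rewrite big_ord_recl mul0r addr0; congr (_ * _); apply: eq_bigr => i _.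
  by rewrite /= -addrA; congr (_ + _); rewrite /bump /= add1n -natr1; ring.
rewrite !Pr.
have P0 : \prod_(k < n) (u + e + e + k%:R * e) != 0.
  by rewrite prodf_seq_neq0; apply/allP => i _ /=; exact: ru2.
by field; rewrite P0 (regular0 ru) (regular0 ru1).
Qed.

Definition not_pole u := forall i, u != (pole i)%:C.

Lemma G_neq0 u : regular u -> not_pole u -> G u != 0.
Proof.
move=> ru pu; have [d d0 du] := regular_dist ru.
apply: (cprod_neq0 (gterm_sum d0 du)) => i.
have -> : 1 + gterm u i = (u - (pole i)%:C) / (u + i%:R * e).
  by rewrite /gterm /pole rmorphB /= -real_complex_nat; field; exact: ru.
by rewrite mulf_neq0 ?invr_eq0 ?ru // subr_eq0.
Qed.

(** [1 + tterm u i] is the quotient (u - p_i + eps) / (u - p_{i+1}) of a zero factor by the next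
    pole factor. Pairing them this way makes the numerators [gap i], which telescope, and avoids the
    points excluded by [regular]. *)
Definition tterm u i : complex R := - (gap i)%:C / (u - (pole i.+1)%:C).
Definition T u := (u - (pole 0)%:C)^-1 * cprod (tterm u).

Lemma not_pole_dist u : not_pole u -> exists2 d, 0 < d & forall k, d <= normc (u - (pole k)%:C).
Proof.
move=> pu; apply: (@dist_lower _ (q 0%N + normc u)) => k; first exact: pole_growth.
by rewrite subr_eq0.
Qed.

Lemma tterm_sum u N d : 0 < d -> (forall k, (N < k)%N -> d <= normc (u - (pole k)%:C)) ->
  forall n, \sum_(i < n) normc (tterm u (N + i)%N) <= q N / d.
Proof.
move=> d0 du n; rewrite mulrC ler_pdivlMl //.
apply: (@le_trans _ _ (\sum_(i < n) gap (N + i)%N)).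
  rewrite mulr_sumr; apply: ler_sum => i _.
  rewrite /tterm normc_div normcNE normcR ger0_norm ?gap_ge0 // mulrCA.
  have Ni : (N < (N + i).+1)%N by rewrite ltnS leq_addr.
  rewrite ler_piMr ?gap_ge0 // ler_pdivrMr ?mul1r; [exact: du|exact: lt_le_trans (du _ Ni)].
have := gap_sum (N + n); rewrite big_split_ord /= gap_sum.
have := @qlim_ge0 _ _ eps_gt0 (N + n); lra.
Qed.

(** The zeroes of [T] come from [G (u + e)] and its poles from [G u]. The isolated factor of the
    pole 0 accounts for the one extra factor in the denominator. *)
Lemma T_finite u n : regular u -> not_pole u ->
  (u - (pole 0)%:C)^-1 * cprodn (tterm u) n =
  cprodn (gterm (u + e)) n / (u * cprodn (gterm u) n.+1).
Proof.
move=> ru pu.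
have E i : 1 + gterm u i = (u - (pole i)%:C) / (u + i%:R * e).
  by rewrite /gterm /pole rmorphB /= -real_complex_nat; field; exact: ru.
elim: n => [|n IH].
  rewrite /cprodn !big_ord0 big_ord1 E mul0r addr0 !mulr1 mul1r; congr (_^-1).
  by rewrite mulrC divfK // regular0.
rewrite cprodnS mulrA IH (cprodnS _ n.+1) (cprodnS (gterm (u + e)) n) E.
have -> : 1 + tterm u n = (u + e + n%:R * e - (q n)%:C) / (u - (pole n.+1)%:C).
  rewrite /tterm /gap /pole !rmorphB /= -real_complex_nat -natr1; field.
  have := pu n.+1; rewrite /pole rmorphB /= -real_complex_nat -natr1 -subr_eq0; apply: contra_neq.
  by move=> <-; ring.
have -> : 1 + gterm (u + e) n = (u + e + n%:R * e - (q n)%:C) / (u + n.+1%:R * e).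
  rewrite /gterm -natr1; field; have := regularS ru n; apply: contra_neq => <-; ring.
have P0 : cprodn (gterm u) n.+1 != 0.
  rewrite /cprodn prodf_seq_neq0; apply/allP => i _ /=; rewrite E.
  by rewrite mulf_neq0 ?invr_eq0 ?ru // subr_eq0.
have h1 : u - (pole n.+1)%:C != 0 by rewrite subr_eq0.
have h2 := ru n.+1; have h3 := regular0 ru; field.
by apply/and4P; split => //; rewrite nat1r.
Qed.

Lemma T_G u : regular u -> not_pole u -> T u = G (u + e) / (u * G u).
Proof.
move=> ru pu; have [d d0 du] := not_pole_dist pu.
have H1 : ccvg (cprodn (tterm u)) (cprod (tterm u)).
  by apply: (cprod_cvg (S := q 0%N / d)); apply: (@tterm_sum u 0) => // k _; exact: du.
have H2 := ccvgM (ccvg_cst (u - (pole 0)%:C)^-1) H1.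
apply: ccvg_unique H2 _.
have -> : (fun n => (u - (pole 0)%:C)^-1 * cprodn (tterm u) n) =
  (fun n => cprodn (gterm (u + e)) n / (u * cprodn (gterm u) (n + 1))).
  by apply/funext => n; rewrite T_finite // addn1.
apply: ccvgM; first exact: (G_cvg (regularS ru)).
apply: ccvgV; first by apply: mulf_neq0; [exact: regular0 ru|exact: G_neq0].
by apply: ccvgM; [exact: ccvg_cst|exact: ccvg_shift (G_cvg ru)].
Qed.

Lemma T_rec u : regular u -> not_pole u -> not_pole (u + e) ->
  T (u + e) + (T u)^-1 - u = 0.
Proof.
move=> ru pu pu1; have ru1 := regularS ru.
have g1 := G_neq0 ru1 pu1; have g0 := G_neq0 ru pu.
rewrite !T_G // invf_div (G_rec ru).
by field; rewrite g1 (regular0 ru) (regular0 ru1).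
Qed.

Lemma nonreal_regular u : complex.Im u != 0 -> regular u.
Proof.
move=> u0 k; apply: contra_neq u0; rewrite real_complex_nat => /(congr1 (@complex.Im R)).
by rewrite Im_add /= addr0.
Qed.

Lemma nonreal_not_pole u : complex.Im u != 0 -> not_pole u.
Proof. by move=> u0 k; apply: contra_neq u0 => ->. Qed.

(** [16 / 3] is the numerator 4 of the bound on the sum of the [q_i], times the bound 4/3 on
    exp(1/4). *)
Lemma G_sub1_le u : 4 / eps < complex.Im u / 4 -> normc (G u - 1) <= 16 / (3 * eps * complex.Im u).
Proof.
set y := complex.Im u => uy.
have y0 : 0 < y.
  by have : 0 < 4 / eps; [rewrite divr_gt0|lra].
have du k : y <= normc (u + k%:R * e).
  apply: le_trans (Im_le_normc _); rewrite real_complex_nat Im_add /= addr0.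
  exact: ler_norm.
apply: le_trans (cprod_sub1_le (gterm_sum y0 du)) _.
have S4 : 4 / eps / y <= 1 / 4 by rewrite ler_pdivrMr //; lra.
have : expR (4 / eps / y) <= 4 / 3.
  rewrite -[leLHS]invrK -expRN -[leRHS]invrK lef_pV2 ?posrE ?expR_gt0 ?invr_gt0 //.
  by apply: le_trans (expR_ge1Dx _); lra.
move=> /(ler_wpM2r (x := 4 / eps / y)); rewrite !divr_ge0 ?(ltW eps_gt0) ?(ltW y0) // => /(_ isT) /le_trans; apply.
by rewrite le_eqVlt; apply/orP; left; apply/eqP; field; rewrite !gt_eqF.
Qed.

Lemma T_asymp (del : R) : 0 < del -> exists M : R, forall u,
  M < complex.Im u -> normc (u * T u - 1) < del.
Proof.
(* As [u * T u] is [G (u + e) / G u], it suffices that both values are within [del / 4] of 1, by the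
   second entry of the maximum, and within 1/2 of 1, by the first. *)
move=> del0; exists (Num.max (32 / eps) (64 / (3 * eps * del))) => u; rewrite gt_max => /andP[M1 M2].
have y0 : 0 < complex.Im u by apply: lt_trans M1; rewrite divr_gt0.
have ui : complex.Im u != 0 by rewrite gt_eqF.
have ru := nonreal_regular ui; have pu := nonreal_not_pole ui.
have Im1 : complex.Im (u + e) = complex.Im u by rewrite Im_add /= addr0.
have M3 : 4 / eps < complex.Im u / 4.
  have : 32 / eps = 8 * (4 / eps) by rewrite mulrA; congr (_ / _); ring.
  have : 0 < 4 / eps by rewrite divr_gt0.
  lra.
have G0 := G_sub1_le M3.
have G1 : normc (G (u + e) - 1) <= 16 / (3 * eps * complex.Im u) by rewrite -Im1 G_sub1_le // Im1.
have G2 : 16 / (3 * eps * complex.Im u) < del / 4.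
  rewrite ltr_pdivrMr ?mulr_gt0 //; move: M2; rewrite ltr_pdivrMr ?mulr_gt0 //; lra.
have G3 : 16 / (3 * eps * complex.Im u) <= 1 / 2.
  rewrite ler_pdivrMr ?mulr_gt0 //; move: M1; rewrite ltr_pdivrMr //; lra.
have /near1_norm/andP[Gn _] := le_trans G0 G3.
have g0 := G_neq0 ru pu.
rewrite T_G //.
have -> : u * (G (u + e) / (u * G u)) - 1 = ((G (u + e) - 1) - (G u - 1)) / G u.
  by field; rewrite g0 (regular0 ru).
rewrite normc_div ltr_pdivrMr ?normc_gt0 //.
apply: le_lt_trans (normcD_le _ _) _; rewrite normcNE.
have : del * (1 / 2) <= del * normc (G u) by rewrite ler_pM2l.
lra.
Qed.

End Transfer.

(** * Orders of the poles and zeroes, and strict interlacing *)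

Section LocalBehaviour.
Context {R : realType} (eps : R) (eps_gt0 : 0 < eps).
Local Notation "x %:C" := (real_complex R x).
Local Notation q := (qlim eps_gt0).
Local Notation e := (eps%:C).
Local Notation pole := (pole eps_gt0).
Local Notation gap := (gap eps_gt0).
Local Notation T := (T eps_gt0).
Local Notation not_pole := (not_pole eps_gt0).
Implicit Types (u : complex R) (s : R).

Definition zero i : R := pole i - eps.

Lemma pole_zero i : pole i.+1 = zero i - gap i.
Proof. by rewrite /zero /pole /gap -natr1; ring. Qed.

Lemma pole_le_zero i : pole i.+1 <= zero i.
Proof. by rewrite pole_zero gerBl gap_ge0. Qed.

Lemma zero_lt_pole i : zero i < pole i.
Proof. by rewrite /zero gtrBl. Qed.

Lemma pole_lt i j : (i < j)%N -> pole j < pole i.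
Proof.
elim: j => // j IH; rewrite ltnS leq_eqVlt => /predU1P[->|/IH].
  exact: le_lt_trans (pole_le_zero _) (zero_lt_pole _).
apply: lt_trans; exact: le_lt_trans (pole_le_zero _) (zero_lt_pole _).
Qed.

Lemma pole_inj : injective pole.
Proof.
move=> i j ij; case: (ltngtP i j) => // /pole_lt; by rewrite ij ltxx.
Qed.

Lemma zero_inj : injective zero.
Proof. by move=> i j /addIr/pole_inj. Qed.

(** Injectivity of [c] makes every root simple, so the order at [s] is 0 or 1 and can be written as
    a boolean exponent. Two-sided bounds take the place of Laurent expansions. *)
Lemma prod_order (c : nat -> R) s M : injective c ->
  exists m B d : R, [/\ 0 < m, 0 < B, 0 < d & forall u, normc (u - s%:C) < d ->
    let r := normc (u - s%:C) ^+ `[< exists i, (i < M)%N /\ c i = s >] in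
    m * r <= normc (\prod_(i < M) (u - (c i)%:C)) <= B * r].
Proof.
move=> cinj; elim: M => [|M [m [B [d [m0 B0 d0 H]]]]].
  exists 1, 1, 1; split=> // u _ /=; rewrite big_ord0 normc1.
  rewrite (_ : `[< _ >] = false) ?expr0 ?mulr1 ?lexx //.
  by apply/asboolP => -[i []].
have [Mc|Mc] := eqVneq (c M) s.
  have aM : `[< exists i, (i < M)%N /\ c i = s >] = false.
    by apply/asboolP => -[i [iM]]; rewrite -Mc => /cinj iE; rewrite iE ltnn in iM.
  exists m, B, d; split=> // u /H /=; rewrite aM expr0 !mulr1 => /andP[H1 H2].
  rewrite (_ : `[< _ >] = true); last by apply/asboolP; exists M.
  by rewrite expr1 big_ord_recr /= normcM Mc !ler_wpM2r.
have aM : `[< exists i, (i < M.+1)%N /\ c i = s >] = `[< exists i, (i < M)%N /\ c i = s >].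
  apply/asboolP/asboolP => -[i [iM ci]]; exists i; last by rewrite ltnS ltnW.
  split=> //; move: iM; rewrite ltnS leq_eqVlt => /predU1P[iE|//].
  by move: Mc; rewrite -iE ci eqxx.
have D0 : 0 < `|s - c M| by rewrite normr_gt0 subr_eq0 eq_sym.
set D := `|s - c M| in D0.
exists (m * (D / 2)), (B * (2 * D)), (Num.min d (D / 2)); split.
- by rewrite mulr_gt0 // divr_gt0.
- by rewrite !mulr_gt0.
- by rewrite lt_min d0 divr_gt0.
move=> u; rewrite lt_min => /andP[/H /= /andP[H1 H2] uD]; rewrite aM.
rewrite big_ord_recr /= normcM.
have E : normc (s%:C - (c M)%:C) = D by rewrite -rmorphB normcR.
have U1 : D / 2 <= normc (u - (c M)%:C).
  have := normcB_ge (s%:C - (c M)%:C) (s%:C - u); rewrite E (normcBC s%:C u).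
  have -> : s%:C - (c M)%:C - (s%:C - u) = u - (c M)%:C by ring.
  lra.
have U2 : normc (u - (c M)%:C) <= 2 * D.
  have := normcD_le (u - s%:C) (s%:C - (c M)%:C); rewrite E.
  have -> : u - s%:C + (s%:C - (c M)%:C) = u - (c M)%:C by ring.
  lra.
set r := _ ^+ _ in H1 H2 *.
have r0 : 0 <= r by rewrite exprn_ge0.
rewrite mulrAC ler_pM ?mulr_ge0 ?divr_ge0 ?(ltW m0) ?(ltW D0) //=.
by rewrite mulrAC ler_pM.
Qed.

(** Near [s] only finitely many factors matter. [N] is such that the remaining poles lie below
    [s - 2], hence at distance at least 1 from [u], and such that [q N <= 1 / 4], which puts the
    remaining product within 1/2 of 1. *)
Lemma T_tail s : exists N : nat, (forall k, (N <= k)%N -> pole k <= s - 2) /\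
  forall u, normc (u - s%:C) < 1 -> not_pole u -> exists2 t, 1 / 2 <= normc t <= 3 / 2 &
    T u = (\prod_(i < N) (u - (zero i)%:C)) / (\prod_(i < N.+1) (u - (pole i)%:C)) * t.
Proof.
have [N1 HN1] : exists N, forall n, \sum_(i < n) q (N + i)%N <= 1 / 4.
  apply: (@tail_sum_le _ _ (4 / eps)).
  - by move=> i; exact: qlim_ge0.
  - by move=> n; exact: qlim_sum_le.
  - by rewrite divr_gt0.
pose N := (N1 + (Num.truncn ((q 0%N + 2 - s) / eps)).+1)%N.
have Np k : (N <= k)%N -> pole k <= s - 2.
  move=> Nk; rewrite /pole; have := qlim_le0 eps_gt0 k.
  suff : q 0%N + 2 - s <= k%:R * eps by lra.
  rewrite -ler_pdivrMr //; apply: ltW; apply: lt_le_trans (truncnS_gt _) _.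
  by rewrite ler_nat; apply: leq_trans Nk; rewrite leq_addl.
have qN : q N <= 1 / 4.
  apply: le_trans (HN1 (N - N1).+1); rewrite big_ord_recr /= subnKC ?leq_addr // lerDr.
  by apply: sumr_ge0 => i _; exact: qlim_ge0.
exists N; split=> // u us pu.
have far k : (N < k)%N -> 1 <= normc (u - (pole k)%:C).
  move=> /ltnW/Np pk; have := normcB_ge (s%:C - (pole k)%:C) (s%:C - u); rewrite (normcBC s%:C u).
  have -> : s%:C - (pole k)%:C - (s%:C - u) = u - (pole k)%:C by ring.
  rewrite -rmorphB normcR; have := ler_norm (s - pole k); lra.
have [d d0 du] := not_pole_dist pu.
have S1 n : \sum_(i < n) normc (tterm eps_gt0 u i) <= q 0%N / d.
  by apply: (@tterm_sum _ _ _ u 0) => // k _; exact: du.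
exists (cprod (fun i => tterm eps_gt0 u (N + i)%N)).
  apply: near1_norm; apply: cprod_near1 => n; apply: le_trans (tterm_sum ltr01 far n) _.
  by rewrite divr1.
rewrite /T (cprod_split S1 N) mulrA; congr (_ * _).
have E i : 1 + tterm eps_gt0 u i = (u - (zero i)%:C) / (u - (pole i.+1)%:C).
  have gE : (gap i)%:C = (zero i)%:C - (pole i.+1)%:C by rewrite pole_zero -rmorphB; congr _%:C; ring.
  have h : u - (pole i.+1)%:C != 0 by rewrite subr_eq0.
  by rewrite /tterm gE; field.
rewrite /cprodn (eq_bigr _ (fun (i : 'I_N) _ => E i)) prodf_div [in RHS]big_ord_recl /=.
by rewrite mulrCA -invfM.
Qed.

(** The exponent of the pole is kept on the side of [T], so that the bounds stay meaningful when a
    pole and a zero coincide, a case excluded only by [gap_gt0]. *)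
Lemma T_order s : exists m B d : R, [/\ 0 < m, 0 < B, 0 < d & forall u, u != s%:C -> normc (u - s%:C) < d ->
   not_pole u /\
   m * normc (u - s%:C) ^+ `[< exists i, zero i = s >] <=
     normc (T u) * normc (u - s%:C) ^+ `[< exists i, pole i = s >]
   <= B * normc (u - s%:C) ^+ `[< exists i, zero i = s >] ].
Proof.
have [N [Np HT]] := T_tail s.
have [m1 [B1 [d1 [m10 B10 d10 H1]]]] := @prod_order zero s N zero_inj.
have [m2 [B2 [d2 [m20 B20 d20 H2]]]] := @prod_order pole s N.+1 pole_inj.
have aE : `[< exists i, (i < N)%N /\ zero i = s >] = `[< exists i, zero i = s >].
  apply/asboolP/asboolP => -[i Hi]; first by exists i; case: Hi.
  exists i; split=> //; rewrite ltnNge; apply/negP => /Np.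
  by have := zero_lt_pole i; lra.
have bE : `[< exists i, (i < N.+1)%N /\ pole i = s >] = `[< exists i, pole i = s >].
  apply/asboolP/asboolP => -[i Hi]; first by exists i; case: Hi.
  exists i; split=> //; rewrite ltnNge; apply/negP => /ltnW/Np.
  by lra.
exists (m1 / B2 / 2), (B1 / m2 * (3 / 2)), (Num.min (Num.min d1 d2) 1); split.
- by rewrite !divr_gt0.
- by rewrite mulr_gt0 // divr_gt0.
- by rewrite !lt_min d10 d20 ltr01.
move=> u us; rewrite !lt_min => /andP[/andP[ud1 ud2] u1].
have := H1 u ud1; have := H2 u ud2; rewrite /= aE bE.
set b := normc _ ^+ _; set a := normc _ ^+ _ => /andP[Hb1 Hb2] /andP[Ha1 Ha2].
have r0 : 0 < normc (u - s%:C) by rewrite normc_gt0 subr_eq0.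
have a0 : 0 < b by rewrite exprn_gt0.
have b0 : 0 < a by rewrite exprn_gt0.
have pu : not_pole u.
  move=> k; have [kN|Nk] := ltnP k N.+1.
    have : normc (\prod_(i < N.+1) (u - (pole i)%:C)) != 0.
      by rewrite gt_eqF // (lt_le_trans _ Hb1) // mulr_gt0.
    by rewrite normc_eq0 prodf_seq_neq0 => /allP /(_ (Ordinal kN)); rewrite mem_index_enum subr_eq0 => /(_ isT).
  apply: contraTneq u1 => ->; rewrite -leNgt -rmorphB normcR distrC.
  by have := Np k (ltnW Nk); have := ler_norm (s - pole k); lra.
split=> //; have [t /andP[t1 t2] ->] := HT u u1 pu.
rewrite normcM normc_div.
set num := normc (\prod_(i < N) _) in Ha1 Ha2 *.
set den := normc (\prod_(i < N.+1) _) in Hb1 Hb2 *.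
have den0 : 0 < den by rewrite (lt_le_trans _ Hb1) // mulr_gt0.
have num0 : 0 <= num by exact: normc_ge0.
rewrite (_ : num / den * normc t * b = num * normc t * b / den); last by ring.
rewrite ler_pdivlMr // ler_pdivrMr //; apply/andP; split.
  apply: (@le_trans _ _ (m1 / B2 / 2 * a * (B2 * b))).
    by rewrite ler_wpM2l // !mulr_ge0 ?invr_ge0 ?ltW.
  rewrite (_ : _ * (B2 * b) = m1 * a * (1 / 2) * b); last by field; rewrite gt_eqF.
  rewrite ler_wpM2r ?(ltW a0) // ler_pM ?mulr_ge0 ?divr_ge0 ?(ltW m10) ?(ltW b0) //.
apply: (@le_trans _ _ (B1 * a * (3 / 2) * b)).
  by rewrite ler_wpM2r ?(ltW a0) // ler_pM.
rewrite (_ : B1 * a * (3 / 2) * b = B1 / m2 * (3 / 2) * a * (m2 * b)); last by field; rewrite gt_eqF.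
by rewrite ler_wpM2l // !mulr_ge0 ?invr_ge0 ?ltW.
Qed.

(** If [gap i] were the first to vanish, [zero i] and [pole i.+1] would cancel, and T(u) would stay
    away from 0 near [zero i]. Then T(u + eps) = u - 1/T(u) would stay bounded there, although
    [u + eps] is close to [pole i]. But [pole i] is a genuine pole: a zero cancelling it would have
    an index [j < i] with [gap j = 0]. *)
Lemma gap_gt0 i : 0 < gap i.
Proof.
elim/ltn_ind: i => i IH; rewrite lt_neqAle gap_ge0 andbT; apply/eqP => /esym g0.
have zp : zero i = pole i.+1 by rewrite pole_zero g0 subr0.
have za : `[< exists j, zero j = zero i >] = true by apply/asboolP; exists i.
have zb : `[< exists j, pole j = zero i >] = true by apply/asboolP; exists i.+1.
have pb : `[< exists j, pole j = pole i >] = true by apply/asboolP; exists i.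
have pa : `[< exists j, zero j = pole i >] = false.
  apply/asboolP => -[j zj]; have := zero_lt_pole j; rewrite zj => pij.
  have ji : (j < i)%N.
    rewrite ltnNge; apply/negP; rewrite leq_eqVlt => /predU1P[ij|/pole_lt].
      by rewrite ij ltxx in pij.
    by move=> /lt_trans/(_ pij); rewrite ltxx.
  have gj : 0 < gap j by apply: IH.
  have := pole_zero j; rewrite zj => pj.
  have : pole i <= pole j.+1.
    by move: ji; rewrite leq_eqVlt => /predU1P[->//|/pole_lt/ltW].
  by rewrite pj; lra.
have [m1 [B1 [d1 [m10 B10 d10 H1]]]] := T_order (zero i).
have [m2 [B2 [d2 [m20 B20 d20 H2]]]] := T_order (pole i).
(* [K] bounds |u| + 1/|T(u)| near [zero i]. The point [u] lies at height [t] above [zero i], with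
   [t] so small that [K t < m2], which contradicts the lower bound at [pole i]. *)
pose K := `|zero i| + 1 + m1^-1.
have K0 : 0 < K by rewrite ltr_wpDl ?invr_gt0 // addr_ge0.
pose t := Num.min (Num.min (d1 / 2) (d2 / 2)) (Num.min 1 (m2 / K / 2)).
have t0 : 0 < t by rewrite !lt_min !divr_gt0 // ltr01.
pose u := complex.Complex (zero i) t.
have uz : u - (zero i)%:C = complex.Complex 0 t by rewrite /u /real_complex_def; simpc.
have un : normc (u - (zero i)%:C) = t by rewrite uz /= expr0n /= add0r sqrtr_sqr ger0_norm // ltW.
have ui : complex.Im u != 0 by rewrite /= gt_eqF.
have ui1 : complex.Im (u + e) != 0 by rewrite Im_add /= addr0 gt_eqF.
have zC : (zero i)%:C = (pole i)%:C - e by exact: (rmorphB (real_complex R) (pole i) eps).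
have zpE : u + e - (pole i)%:C = u - (zero i)%:C by rewrite zC opprB addrA.
have td1 : t < d1 by apply: (@le_lt_trans _ _ (d1 / 2)); [rewrite !ge_min lexx|lra].
have td2 : t < d2 by apply: (@le_lt_trans _ _ (d2 / 2)); [rewrite !ge_min lexx orbT|lra].
have t1 : t <= 1 by rewrite !ge_min lexx !orbT.
have tK : t * K < m2.
  have : t <= m2 / K / 2 by rewrite !ge_min lexx !orbT.
  by have := divr_gt0 m20 K0; rewrite -ltr_pdivlMr //; lra.
have := H1 u; rewrite un za zb expr1 => /(_ _ td1) [|pu /andP[H1' _]].
  by apply: contraNneq ui => ->.
have := H2 (u + e); rewrite zpE un pa pb expr1 expr0 mulr1 => /(_ _ td2) [|pu1 /andP[H2' _]].
  by apply: contraNneq ui1 => ->.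
have := T_rec (nonreal_regular _ ui) pu pu1 => /(congr1 (fun x => x + u - (T u)^-1)).
rewrite subrK addrK add0r => TE.
have TB : normc (T (u + e)) <= K.
  rewrite TE; apply: le_trans (normcD_le _ _) _; rewrite normcNE normcV /K lerD //.
    rewrite -{1}(subrKC (zero i)%:C u); apply: le_trans (normcD_le _ _) _.
    by rewrite normcR un lerD2l.
  move: H1'; rewrite ler_pM2r // => H1'.
  by rewrite lef_pV2 ?posrE // (lt_le_trans m10).
by have : normc (T (u + e)) * t <= K * t; [rewrite ler_wpM2r // ltW|lra].
Qed.

End LocalBehaviour.

(** * Piecewise linear profiles *)

Section PiecewiseLinear.
Context {R : realType}.
Implicit Types (f : R -> R) (a b c m k : R).

Lemma ae_itv_ex (P : R -> Prop) a b : a < b ->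
  {ae lebesgue_measure, forall x : R, P x} -> exists2 x, a < x < b & P x.
Proof.
move=> ab [N [mN N0 PN]]; apply: contrapT => H.
have sub : `]a, b[%classic `<=` N.
  move=> x; rewrite /= in_itv /= => xab; apply: PN => /= Px.
  by apply: H; exists x.
have : (lebesgue_measure (`]a, b[%classic : set R) <= lebesgue_measure N)%E.
  by apply: le_measure => //; rewrite inE.
rewrite N0 lebesgue_measure_itv /= lte_fin ab -EFinB lee_fin; lra.
Qed.

Lemma affine_near f m k a b c : a < c < b -> (forall x, a <= x <= b -> f x = m * x + k) ->
  derivable f c 1 /\ derive1 f c = m.
Proof.
move=> /andP[ac cb] fE.
have nE : {near c, (fun x => m * x + k) =1 f}.
  near=> x; rewrite fE //; apply/andP; split; apply: ltW; near: x; [exact: lt_nbhsr|exact: lt_nbhsl].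
have D : is_derive c 1 (fun x => m * x + k) m.
  by apply: is_derive_eq; rewrite /GRing.scale /= addr0 mulr1.
split; first by apply: near_eq_derivable nE _; apply: ex_derive.
by rewrite derive1E -(near_eq_derive (1 : R^o) nE) derive_val.
Unshelve. all: by end_near. Qed.

(** The induction runs over a sequence containing the finitely many breakpoints inside the interval.
    Containment rather than equality lets the same tail serve both halves after a cut. *)
Lemma pieces_ind (B : set R) (Q : R -> R -> Prop) :
  (forall M : R, finite_set (B `&` `[- M, M])) ->
  (forall a b, a <= b -> B `&` `]a, b[ = set0 -> Q a b) ->
  (forall a c b, a < c < b -> Q a c -> Q c b -> Q a b) ->
  forall a b, a <= b -> Q a b.
Proof.
move=> Bfin Q0 Qt a b ab.
have fin : finite_set (B `&` `]a, b[%classic).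
  apply: sub_finite_set (Bfin (`|a| + `|b|)) => x [Bx]; rewrite /= !in_itv /= => /andP[ax xb].
  split=> //.
  have := ler_norm (- a); have := ler_norm b; rewrite normrN.
  have := normr_ge0 a; have := normr_ge0 b; lra.
have [s sE] := (finite_seqP _).1 fin.
have {fin sE} : B `&` `]a, b[%classic `<=` [set` s] by rewrite sE.
elim: s a b ab => [|x s IH] a b ab sub.
  by apply: Q0 => //; rewrite -subset0 => y /sub.
have [/andP[ax xb]|nx] := boolP (a < x < b); last first.
  apply: IH => // y By; have := sub y By; rewrite /= inE => /predU1P[yx|//].
  by move: By nx => [_]; rewrite /= in_itv /= yx => ->.
apply: (Qt a x b); first by rewrite ax xb.
  apply: IH; first exact: ltW.
  move=> y [By]; rewrite /= in_itv /= => /andP[ay yx].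
  have yab : (B `&` `]a, b[%classic) y by split=> //=; rewrite in_itv /= ay (lt_trans yx xb).
  have /= := sub y yab; rewrite inE => /predU1P[yE|//].
  by rewrite yE ltxx in yx.
apply: IH; first exact: ltW.
move=> y [By]; rewrite /= in_itv /= => /andP[xy yb].
have yab : (B `&` `]a, b[%classic) y by split=> //=; rewrite in_itv /= yb (lt_trans ax xy).
have /= := sub y yab; rewrite inE => /predU1P[yE|//].
by rewrite yE ltxx in xy.
Qed.

End PiecewiseLinear.

(** * The piecewise linear function with the given minima and maxima *)

Section Zigzag.
Context {R : realType} (eps : R) (eps_gt0 : 0 < eps).
Local Notation q := (qlim eps_gt0).
Local Notation pole := (pole eps_gt0).
Local Notation zero := (zero eps_gt0).
Local Notation gap := (gap eps_gt0).
Implicit Types (f : R -> R) (c : R).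

Lemma pole_lt_zero i : pole i.+1 < zero i.
Proof. by rewrite pole_zero gtrBl gap_gt0. Qed.

Lemma poles_below c : exists i, pole i < c.
Proof.
exists (Num.truncn ((q 0%N - c) / eps)).+1; rewrite /pole.
have : (q 0%N - c) / eps < (Num.truncn ((q 0%N - c) / eps)).+1%:R by apply: truncnS_gt.
rewrite ltr_pdivrMr //; have := qlim_le0 eps_gt0 (Num.truncn ((q 0%N - c) / eps)).+1; lra.
Qed.

Lemma locate c : [\/ pole 0 <= c, exists i, zero i <= c < pole i | exists i, pole i.+1 <= c < zero i].
Proof.
have [i0] := poles_below c; elim: i0 => [|i IH] ic; first by constructor 1; exact: ltW.
have [pc|cp] := ltP (pole i) c; first exact: IH.
have [->|Nc] := eqVneq c (pole i).
  case: i {ic IH cp} => [|i]; first by constructor 1.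
  by constructor 3; exists i; rewrite lexx pole_lt_zero.
have [zc|cz] := leP (zero i) c.
  by constructor 2; exists i; rewrite zc lt_neqAle Nc.
by constructor 3; exists i; rewrite (ltW ic).
Qed.

(** The constants are forced by continuity, going leftwards from the ray where [f c = c]: each
    segment of slope -1 has length [eps] and so raises the constant of the next segment of slope 1
    by [2 eps]. *)
Definition zigzag f := [/\ forall c, pole 0 <= c -> f c = c,
  forall i c, zero i <= c <= pole i -> f c = - c + 2 * q i &
  forall i c, pole i.+1 <= c <= zero i -> f c = c + 2 * i.+1%:R * eps].

(** Twice the [j]-th summand has slope -2 on [zero j, pole j], vanishes to the right and equals
    [2 eps] to the left. Only the summands whose pole lies above [c] count, hence any [N] with
    [pole N <= c] gives the same value. *)
Definition zigzag_sum N c :=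
  c + 2 * \sum_(j < N) (Num.max 0 (pole j - c) - Num.max 0 (zero j - c)).

Lemma zigzag_sum_stable N M c : (N <= M)%N -> pole N <= c -> zigzag_sum M c = zigzag_sum N c.
Proof.
move=> NM pNc; congr (_ + 2 * _); rewrite -(subnKC NM) big_split_ord /= [X in _ + X]big1 ?addr0 // => i _.
have pc : pole (N + i)%N <= c.
  apply: le_trans pNc; case: (nat_of_ord i) => [|k]; first by rewrite addn0.
  by apply/ltW/pole_lt; rewrite -addn1 leq_add2l.
have zc := zero_lt_pole eps_gt0 (N + i)%N.
by rewrite !max_l ?subrr ?subr_le0 // (le_trans (ltW zc)).
Qed.

Lemma zigzag_sum_active N c : (forall i, (i < N)%N -> c <= zero i) ->
  zigzag_sum N c = c + 2 * N%:R * eps.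
Proof.
move=> cz; rewrite /zigzag_sum; congr (_ + _); rewrite -mulrA; congr (_ * _).
rewrite (eq_bigr (fun=> eps)) ?sumr_const ?card_ord ?mulr_natl // => i _.
have zc := zero_lt_pole eps_gt0 i; have := cz i (ltn_ord i) => ci.
by rewrite !max_r ?subr_ge0 // ?(le_trans ci (ltW zc)) // /zero; ring.
Qed.

Lemma zero_decr i j : (i <= j)%N -> zero j <= zero i.
Proof.
rewrite leq_eqVlt => /predU1P[->//|ij]; rewrite lerD2r; exact/ltW/pole_lt.
Qed.

Lemma ex_zigzag : exists f, zigzag f.
Proof.
have [N HN] := choice poles_below.
exists (fun c => zigzag_sum (N c) c).
have stab k c : pole k <= c -> zigzag_sum (N c) c = zigzag_sum k c.
  move=> kc; have [Nk|kN] := leqP (N c) k.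
    by rewrite (zigzag_sum_stable Nk) // ltW.
  exact: zigzag_sum_stable (ltnW kN) kc.
split=> [c pc|i c /andP[zc cp]|i c /andP[pc cz]].
- by rewrite (stab 0%N) // /zigzag_sum big_ord0 mulr0 addr0.
- rewrite (stab i.+1); last exact: le_trans (pole_le_zero _ _) zc.
  rewrite /zigzag_sum big_ord_recr /= mulrDr addrA -/(zigzag_sum i c) zigzag_sum_active.
    rewrite max_r ?subr_ge0 // max_l ?subr_le0 // /pole; ring.
  move=> j ji; apply: le_trans cp _; apply: le_trans (pole_le_zero eps_gt0 j).
  by move: ji; rewrite leq_eqVlt => /predU1P[->//|/pole_lt/ltW].
- rewrite (stab i.+1) // zigzag_sum_active // => j; rewrite ltnS => /zero_decr; exact: le_trans.
Qed.

Section Properties.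
Variable f : R -> R.
Hypothesis zf : zigzag f.

Lemma zigzag_ray c : pole 0 <= c -> f c = c. Proof. by case: zf => + _ _; apply. Qed.

Lemma zigzag_down i c : zero i <= c <= pole i -> f c = - c + 2 * q i.
Proof. by case: zf => _ + _; apply. Qed.

Lemma zigzag_up i c : pole i.+1 <= c <= zero i -> f c = c + 2 * i.+1%:R * eps.
Proof. by case: zf => _ _; apply. Qed.

Definition breaks : set R := [set c | (exists i, pole i = c) \/ (exists i, zero i = c)].

Lemma piece_slope a b : a < b -> breaks `&` `]a, b[ = set0 ->
  exists m k : R, `|m| = 1 /\ forall c, a <= c <= b -> f c = m * c + k.
Proof.
move=> ab B0.
have nb c : breaks c -> a < c < b -> False.
  by move=> bc abc; have : (breaks `&` `]a, b[%classic) c; [split=> //=; rewrite in_itv|rewrite B0].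
case: (locate a) => [pa|[i /andP[za ap]]|[i /andP[pa az]]].
- exists 1, 0; rewrite normr1; split=> // c /andP[ac _].
  by rewrite zigzag_ray ?mul1r ?addr0 // (le_trans pa).
- exists (-1), (2 * q i); rewrite normrN normr1; split=> // c /andP[ac cb].
  rewrite (@zigzag_down i) ?mulN1r // (le_trans za ac) (le_trans cb) // leNgt; apply/negP => pb.
  by apply: (nb (pole i)); [left; exists i|rewrite ap pb].
- exists 1, (2 * i.+1%:R * eps); rewrite normr1; split=> // c /andP[ac cb].
  rewrite (@zigzag_up i) ?mul1r // (le_trans pa ac) (le_trans cb) // leNgt; apply/negP => pb.
  by apply: (nb (zero i)); [right; exists i|rewrite az pb].
Qed.

Lemma breaks_finite (M : R) : finite_set (breaks `&` `[- M, M]).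
Proof.
have [N HN] := poles_below (- M).
apply: (@sub_finite_set _ _ ((pole @` `I_N) `|` (zero @` `I_N))); last first.
  by rewrite finite_setU; split; apply: finite_image; exact: finite_II.
move=> c [bc /=]; rewrite in_itv /= => /andP[Mc _].
have lt i : - M <= pole i -> (i < N)%N.
  move=> Mi; rewrite ltnNge; apply/negP; rewrite leq_eqVlt => /predU1P[iN|/pole_lt/lt_trans/(_ HN)].
    by move: HN; rewrite iN ltNge Mi.
  by rewrite ltNge Mi.
case: bc => [[i ic]|[i ic]]; [left|right]; exists i => //=; apply: lt.
  by rewrite ic.
by apply: le_trans (ltW (zero_lt_pole eps_gt0 i)); rewrite ic.
Qed.

Lemma zigzag_piecewise : piecewise_linear f.
Proof.
exists breaks; split; first exact: breaks_finite.
move=> a b; rewrite le_eqVlt => /predU1P[->|ab] B0.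
  by exists 0, (f b) => c /le_anti ->; rewrite mul0r add0r.
by have [m [k [_ H]]] := piece_slope ab B0; exists m, k.
Qed.

Lemma zigzag_smooth c : ~ breaks c -> derivable f c 1 /\ `|derive1 f c| = 1.
Proof.
move=> nb.
have H a b m k : a < c < b -> `|m| = 1 -> (forall x, a <= x <= b -> f x = m * x + k) ->
    derivable f c 1 /\ `|derive1 f c| = 1.
  by move=> abc m1 fE; have [D ->] := affine_near abc fE.
have nz i : c != zero i by apply/eqP => ci; apply: nb; right; exists i.
have np i : c != pole i by apply/eqP => ci; apply: nb; left; exists i.
case: (locate c) => [pc|[i /andP[zc cp]]|[i /andP[pc cz]]].
- apply: (H (pole 0) (c + 1) 1 0); rewrite ?normr1 //.
    by rewrite lt_neqAle eq_sym np pc ltrDl /= ltr01.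
  by move=> x /andP[px _]; rewrite zigzag_ray ?mul1r ?addr0.
- apply: (H (zero i) (pole i) (-1) (2 * q i)); rewrite ?normrN ?normr1 //.
    by rewrite cp lt_neqAle eq_sym nz zc.
  by move=> x /zigzag_down ->; rewrite mulN1r.
- apply: (H (pole i.+1) (zero i) 1 (2 * i.+1%:R * eps)); rewrite ?normr1 //.
    by rewrite cz lt_neqAle eq_sym np pc.
  by move=> x /zigzag_up ->; rewrite mul1r.
Qed.

Lemma breaks_null : lebesgue_measure.-negligible breaks.
Proof.
have -> : breaks = range pole `|` range zero.
  rewrite eqEsubset; split=> c.
    by case=> -[i <-]; [left|right]; exists i.
  by case=> -[i _ <-]; [left|right]; exists i.
have cnt (g : nat -> R) : lebesgue_measure.-negligible (range g).
  have cg : countable (range g) by apply: card_le_trans (card_image_le _ _) _.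
  apply/negligibleP; last exact: countable_lebesgue_measure0.
  exact: countable_measurable.
exact: negligibleU.
Qed.

Lemma zigzag_ae : {ae lebesgue_measure, forall c : R, derivable f c 1 /\ `|derive1 f c| = 1}.
Proof.
apply: negligibleS breaks_null => c /= H; apply: contrapT => nb; apply: H.
exact: zigzag_smooth.
Qed.

End Properties.

Lemma near_left_ex (P : R -> Prop) l c : l < c -> (\forall x \near c, P x) ->
  exists2 x, l <= x < c & P x.
Proof.
move=> lc /nbhs_ballP[d /= d0 H]; exists (Num.max l (c - d / 2)).
  by rewrite le_max lexx /= gt_max lc ltrBlDr ltrDl divr_gt0.
apply: H; rewrite /ball /= ltr_norml.
have : Num.max l (c - d / 2) < c by rewrite gt_max lc ltrBlDr ltrDl divr_gt0.
have : c - d / 2 <= Num.max l (c - d / 2) by rewrite le_max lexx orbT.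
lra.
Qed.

Lemma near_right_ex (P : R -> Prop) r c : c < r -> (\forall x \near c, P x) ->
  exists2 x, c < x <= r & P x.
Proof.
move=> cr /nbhs_ballP[d /= d0 H]; exists (Num.min r (c + d / 2)).
  by rewrite ge_min lexx /= lt_min cr ltrDl divr_gt0.
apply: H; rewrite /ball /= ltr_norml.
have : c < Num.min r (c + d / 2) by rewrite lt_min cr ltrDl divr_gt0.
have : Num.min r (c + d / 2) <= c + d / 2 by rewrite ge_min lexx orbT.
lra.
Qed.

Lemma local_min_pole f c : zigzag f -> local_min f c <-> exists i, pole i = c.
Proof.
move=> zf; split=> [Hmin|[i <-]].
  case: (locate c) => [|[i /andP[zc cp]]|[i /andP[pc cz]]].
  - rewrite le_eqVlt => /predU1P[<-|pc]; first by exists 0%N.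
    have [x /andP[px xc]] := near_left_ex pc Hmin.
    by rewrite !(zigzag_ray zf) ?(ltW pc) // => /(lt_le_trans xc); rewrite ltxx.
  - have [x /andP[cx xp]] := near_right_ex cp Hmin.
    by rewrite !(@zigzag_down f zf i) ?zc ?xp ?(ltW cp) ?(le_trans zc (ltW cx)) //; lra.
  - move: pc; rewrite le_eqVlt => /predU1P[<-|pc]; first by exists i.+1.
    have [x /andP[px xc]] := near_left_ex pc Hmin.
    by rewrite !(@zigzag_up f zf i) ?px ?(ltW pc) ?(ltW cz) ?(le_trans (ltW xc) (ltW cz)) //; lra.
have zp := zero_lt_pole eps_gt0 i.
have [r pr [k fk]] : exists2 r, pole i < r & exists k, forall x, pole i <= x <= r -> f x = x + k.
  case: i {zp} => [|i]; [exists (pole 0 + 1)|exists (zero i)].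
  - by rewrite ltrDl.
  - by exists 0 => x /andP[px _]; rewrite (zigzag_ray zf) ?addr0.
  - exact: pole_lt_zero.
  - by exists (2 * i.+1%:R * eps) => x /(zigzag_up zf).
near=> x.
have zx : zero i <= x by apply: ltW; near: x; exact: lt_nbhsr.
have [xp|/ltW px] := leP x (pole i).
  by rewrite !(@zigzag_down f zf i) ?zx ?xp ?lexx ?(ltW zp) //; lra.
have xr : x <= r by apply: ltW; near: x; exact: lt_nbhsl.
by rewrite !fk ?px ?xr ?lexx ?(ltW pr) //; lra.
Unshelve. all: by end_near. Qed.

Lemma local_max_zero f c : zigzag f -> local_max f c <-> exists i, zero i = c.
Proof.
move=> zf; split=> [Hmax|[i <-]].
  case: (locate c) => [pc|[i /andP[zc cp]]|[i /andP[pc cz]]].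
  - have [|x /andP[cx _]] := @near_right_ex _ (c + 1) c _ Hmax; first by rewrite ltrDl.
    by rewrite !(zigzag_ray zf) ?(le_trans pc (ltW cx)) //; lra.
  - move: zc; rewrite le_eqVlt => /predU1P[<-|zc]; first by exists i.
    have [x /andP[zx xc]] := near_left_ex zc Hmax.
    by rewrite !(@zigzag_down f zf i) ?zx ?(ltW zc) ?(ltW cp) ?(le_trans (ltW xc) (ltW cp)) //; lra.
  - have [x /andP[cx xz]] := near_right_ex cz Hmax.
    by rewrite !(@zigzag_up f zf i) ?pc ?xz ?(ltW cz) ?(le_trans pc (ltW cx)) //; lra.
have zp := zero_lt_pole eps_gt0 i; have pz := pole_lt_zero i.
near=> x.
have px : pole i.+1 <= x by apply: ltW; near: x; exact: lt_nbhsr.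
have xp : x <= pole i by apply: ltW; near: x; exact: lt_nbhsl.
have [xz|/ltW zx] := leP x (zero i).
  by rewrite !(@zigzag_up f zf i) ?px ?xz ?lexx ?(ltW pz) //; lra.
by rewrite !(@zigzag_down f zf i) ?zx ?xp ?lexx ?(ltW zp) //; lra.
Unshelve. all: by end_near. Qed.

Lemma qlim_small (d : R) : 0 < d -> exists i, q i < d.
Proof.
move=> d0; have [|||N HN] := @tail_sum_le _ (fun i => q i) (4 / eps) _ _ (d / 2) _.
- by move=> i; exact: qlim_ge0.
- by move=> n; exact: qlim_sum_le.
- by rewrite divr_gt0.
exists N; have := HN 1%N; rewrite big_ord1 addn0; lra.
Qed.

(** [f c + c] equals [2 q_j] on the j-th descending segment and runs from [2 q_{j+1}] to [2 q_j] on
    the ascending one to its left, so it is monotone and tends to 0 at -oo along with the [q_j]. *)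
Lemma zigzag_left_bound f i c : zigzag f -> c <= pole i -> 0 <= f c + c <= 2 * q i.
Proof.
move=> zf cp.
have le j : c <= pole i -> pole j.+1 <= c -> (i <= j.+1)%N.
  move=> ci jc; rewrite leqNgt; apply/negP => /(pole_lt eps_gt0).
  by move: (le_trans jc ci) => /le_lt_trans/[apply]; rewrite ltxx.
have qd m n : (m <= n)%N -> q n <= q m.
  by move=> /subnKC <-; elim: (n - m)%N => [|k IH]; rewrite ?addn0 // addnS (le_trans (qlim_decr _ _)).
case: (locate c) => [p0|[j /andP[zc cj]]|[j /andP[pc cz]]].
- have : pole 0 <= pole i by exact: le_trans cp.
  case: i cp {le} => [|i] cp; last by rewrite leNgt pole_lt.
  have -> : c = pole 0 by apply/eqP; rewrite eq_le cp p0.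
  by rewrite (zigzag_ray zf) // /pole mul0r subr0; have := qlim_ge0 eps_gt0 0; lra.
- have ij : (i <= j)%N.
    rewrite leqNgt; apply/negP => ji.
    have : pole i <= pole j.+1.
      by move: ji; rewrite leq_eqVlt => /predU1P[->//|/pole_lt/ltW]; exact.
    by have := pole_lt_zero j; move: zc cp; lra.
  rewrite (@zigzag_down f zf j) ?zc ?(ltW cj) //.
  by have := qd _ _ ij; have := qlim_ge0 eps_gt0 j; lra.
- rewrite (@zigzag_up f zf j) ?pc ?(ltW cz) //.
  have H1 : q j.+1 <= c + j.+1%:R * eps by move: pc; rewrite /pole; lra.
  have := qlim_ge0 eps_gt0 j.+1.
  have [ij|ji] := leqP i j.
    move: cz; rewrite /zero /pole -natr1 => cz; have := qd _ _ ij.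
    by move: H1; rewrite -natr1; lra.
  have iE : i = j.+1 by move: (le j cp pc); lia.
  by move: cp; rewrite iE /pole; lra.
Qed.

Lemma zigzag_cvg f : zigzag f ->
  (f c - `|c - 0|) @[c --> +oo] --> (0 : R) /\ (f c - `|c - 0|) @[c --> -oo] --> (0 : R).
Proof.
move=> zf; split; apply/cvgrPdist_lt => d d0.
  near=> c; have c0 : 0 <= c by near: c; apply: nbhs_pinfty_ge; exact: num_real.
  have pc : pole 0 <= c by near: c; apply: nbhs_pinfty_ge; exact: num_real.
  by rewrite (zigzag_ray zf) // subr0 (ger0_norm c0) subrr subr0 normr0.
have [i qi] : exists i, q i < d / 2 by apply: qlim_small; rewrite divr_gt0.
near=> c; have c0 : c <= 0 by near: c; apply: nbhs_ninfty_le; exact: num_real.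
have pc : c <= pole i by near: c; apply: nbhs_ninfty_le; exact: num_real.
rewrite subr0 (ler0_norm c0) opprK sub0r normrN.
have /andP[H1 H2] := zigzag_left_bound zf pc.
by rewrite ger0_norm //; lra.
Unshelve. all: by end_near. Qed.

End Zigzag.

(** * Uniqueness of the function with these extrema *)

Section ZigzagUnique.
Context {R : realType} (eps : R) (eps_gt0 : 0 < eps).
Local Notation q := (qlim eps_gt0).
Local Notation pole := (pole eps_gt0).
Local Notation zero := (zero eps_gt0).
Variable f : R -> R.
Hypothesis pf : piecewise_linear f.
Hypothesis aef : {ae lebesgue_measure, forall c : R, derivable f c 1 /\ `|derive1 f c| = 1}.

Lemma norm1_cases (m : R) : `|m| = 1 -> m = 1 \/ m = -1.
Proof.
by move=> /eqP; rewrite -[1]normr1 eqr_norm2 normr1 => /orP[]/eqP ->; [left|right].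
Qed.

(** On a single piece the slope is 1 or -1, because it is a derivative at some point of an almost
    everywhere set. Two adjacent pieces with different slopes would meet in a local extremum. *)
Lemma affine_of_no_extremum a b : a < b ->
  (forall c, a < c < b -> ~ local_min f c /\ ~ local_max f c) ->
  exists2 m : R, `|m| = 1 & forall x, a <= x <= b -> f x = f a + m * (x - a).
Proof.
case: pf => B [Bfin lin] ab.
have main : forall a b, a <= b -> a < b -> (forall c, a < c < b -> ~ local_min f c /\ ~ local_max f c) ->
    exists2 m : R, `|m| = 1 & forall x, a <= x <= b -> f x = f a + m * (x - a).
  apply: (pieces_ind Bfin) => {a b ab} [a b _ B0 ab _|a c b /andP[ac cb] IH1 IH2 ab ext].
    have [m [k fE]] := lin a b (ltW ab) B0.
    exists m; last by move=> x axb; rewrite !fE ?lexx ?(ltW ab) //; ring.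
    have [c acb [_ <-]] := ae_itv_ex ab aef.
    by have [_ ->] := affine_near acb fE.
  have [||m1 m11 f1] := IH1.
  - by [].
  - by move=> x /andP[ax xc]; apply: ext; rewrite ax (lt_trans xc).
  have [||m2 m21 f2] := IH2.
  - by [].
  - by move=> x /andP[cx xb]; apply: ext; rewrite xb (lt_trans ac).
  have [nmin nmax] : ~ local_min f c /\ ~ local_max f c by apply: ext; rewrite ac cb.
  have fc : f c = f a + m1 * (c - a) by rewrite f1 // lexx ltW.
  have m12 : m1 = m2.
    have [m1E|m1E] := norm1_cases m11; have [m2E|m2E] := norm1_cases m21; rewrite m1E m2E //.
      exfalso; apply: nmax; near=> x.
      have ax : a <= x by apply: ltW; near: x; exact: lt_nbhsr.
      have xb : x <= b by apply: ltW; near: x; exact: lt_nbhsl.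
      have [xc|/ltW cx] := leP x c; first by rewrite fc (f1 x) ?ax // m1E; lra.
      by rewrite (f2 x) ?cx // m2E; lra.
    exfalso; apply: nmin; near=> x.
    have ax : a <= x by apply: ltW; near: x; exact: lt_nbhsr.
    have xb : x <= b by apply: ltW; near: x; exact: lt_nbhsl.
    have [xc|/ltW cx] := leP x c; first by rewrite fc (f1 x) ?ax // m1E; lra.
    by rewrite (f2 x) ?cx // m2E; lra.
  exists m1 => // x /andP[ax xb]; have [xc|/ltW cx] := leP x c; first by rewrite f1 // ax.
  by rewrite f2 ?cx // fc m12; ring.
exact: main (ltW ab) ab.
Unshelve. all: by end_near. Qed.

Hypothesis minf : forall c, local_min f c <-> exists i, pole i = c.
Hypothesis maxf : forall c, local_max f c <-> exists i, zero i = c.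
Hypothesis limf : (f c - `|c - 0|) @[c --> +oo] --> (0 : R).

Lemma no_extremum a b : (forall c, a < c < b -> (forall i, pole i != c) /\ (forall i, zero i != c)) ->
  forall c, a < c < b -> ~ local_min f c /\ ~ local_max f c.
Proof.
move=> H c /H[H1 H2]; split.
  by move=> /minf[i ic]; move: (H1 i); rewrite ic eqxx.
by move=> /maxf[i ic]; move: (H2 i); rewrite ic eqxx.
Qed.

Lemma pole_le i j : (i <= j)%N -> pole j <= pole i.
Proof. by rewrite leq_eqVlt => /predU1P[->//|/pole_lt/ltW]. Qed.

(** The normalization at +oo does everything here: it excludes slope -1 and fixes the additive
    constant. *)
Lemma ray_unique c : pole 0 <= c -> f c = c.
Proof.
pose p := pole 0.
have aff b : p < b -> exists2 m : R, `|m| = 1 & forall x, p <= x <= b -> f x = f p + m * (x - p).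
  move=> pb; apply: affine_of_no_extremum => //; apply: no_extremum => x /andP[px _]; split=> i.
    by rewrite lt_eqF // (le_lt_trans _ px) // pole_le.
  by rewrite lt_eqF // (lt_le_trans (zero_lt_pole _ _)) // (le_trans _ (ltW px)) // pole_le.
have [m m1 fm] : exists2 m : R, `|m| = 1 & forall x, p <= x -> f x = f p + m * (x - p).
  have [|m m1 fm] := aff (p + 1); first by rewrite ltrDl.
  exists m => // x px.
  (* This interval ends at [x + 2], past both [x] and [p + 1], so the two slopes can be compared at
     [p + 1]. *)
  have [|m' _ fm'] := aff (x + p + 1 - p + 1); first lra.
  have E : m = m'.
    have := fm (p + 1); rewrite lerDl ler01 lexx => /(_ isT).
    rewrite fm'; last lra.
    by lra.
  by rewrite E fm' //; lra.
move=> pc.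
have lim0 : (fun x => f p - m * p + (m - 1) * x) @ +oo --> (0 : R).
  apply: cvg_trans limf; apply: near_eq_cvg; near=> x.
  have x0 : 0 <= x by near: x; apply: nbhs_pinfty_ge; exact: num_real.
  have px : p <= x by near: x; apply: nbhs_pinfty_ge; exact: num_real.
  by rewrite fm // subr0 ger0_norm //; ring.
have mE : m = 1.
  have [//|mE] := norm1_cases m1; exfalso.
  have /cvgrPdist_lt/(_ 1 ltr01) H := lim0.
  near +oo_R => x.
  have : `|0 - (f p - m * p + (m - 1) * x)| < 1 by near: x.
  have : (f p + p + 2) / 2 <= x by near: x; apply: nbhs_pinfty_ge; exact: num_real.
  by rewrite mE sub0r normrN ltr_norml; lra.
have : f p - p = 0.
  have H : (fun x : R => f p - p) @ +oo --> (0 : R).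
    by move: lim0; rewrite mE; under eq_fun do rewrite subrr mul0r addr0 mul1r.
  apply/eqP; rewrite -normr_le0 leNgt; apply/negP => h.
  have /cvgrPdist_lt/(_ _ h) H2 := H.
  near +oo_R => x.
  have : `|0 - (f p - p)| < `|f p - p| by near: x.
  by rewrite sub0r normrN ltxx.
by rewrite (fm c pc) mE; lra.
Unshelve. all: by end_near. Qed.

Lemma down_unique i : (exists r k, pole i < r /\ forall x, pole i <= x <= r -> f x = x + k) ->
  forall c, zero i <= c <= pole i -> f c = f (pole i) + (pole i - c).
Proof.
move=> [r [k [pr fr]]] c /andP[zc cp].
have zp := zero_lt_pole eps_gt0 i.
have [|m m1 fm] := affine_of_no_extremum zp.
  apply: no_extremum => x /andP[zx xp]; split=> j.
    have [ji|ij] := leqP j i; first by rewrite gt_eqF // (lt_le_trans xp) // pole_le.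
    by rewrite lt_eqF // (le_lt_trans _ zx) // (le_trans (pole_le ij)) // pole_le_zero.
  have [ij|ji] := leqP i j; first by rewrite lt_eqF // (le_lt_trans _ zx) // zero_decr.
  by rewrite gt_eqF // (lt_le_trans xp) // (le_trans (pole_le ji)) // pole_le_zero.
have mE : m = -1.
  have [mE|//] := norm1_cases m1; exfalso.
  have Hmin : local_min f (pole i) by apply/minf; exists i.
  have [x /andP[zx xp]] := near_left_ex zp Hmin.
  by rewrite (fm x) ?(fm (pole i)) ?lexx ?zx ?(ltW zp) ?(ltW xp) // mE; lra.
by rewrite (fm c) ?(fm (pole i)) ?lexx ?zc ?(ltW zp) // mE; ring.
Qed.

Lemma up_unique i : (forall c, zero i <= c <= pole i -> f c = f (pole i) + (pole i - c)) ->
  forall c, pole i.+1 <= c <= zero i -> f c = f (zero i) - (zero i - c).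
Proof.
move=> dn c /andP[pc cz].
have pz := pole_lt_zero eps_gt0 i; have zp := zero_lt_pole eps_gt0 i.
have [|m m1 fm] := affine_of_no_extremum pz.
  apply: no_extremum => x /andP[px xz]; split=> j.
    have [ji|ij] := leqP j i; first by rewrite gt_eqF // (lt_le_trans xz) // (le_trans (ltW zp)) // pole_le.
    by rewrite lt_eqF // (le_lt_trans _ px) // pole_le.
  have [ji|ij] := leqP j i; first by rewrite gt_eqF // (lt_le_trans xz) // zero_decr.
  by rewrite lt_eqF // (le_lt_trans _ px) // (le_trans (ltW (zero_lt_pole _ _))) // pole_le.
have mE : m = 1.
  have [//|mE] := norm1_cases m1; exfalso.
  have Hmax : local_max f (zero i) by apply/maxf; exists i.
  have [x /andP[zx xp]] := near_left_ex pz Hmax.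
  by rewrite (fm x) ?(fm (zero i)) ?lexx ?zx ?(ltW pz) ?(ltW xp) // mE; lra.
by rewrite (fm c) ?(fm (zero i)) ?lexx ?pc ?(ltW pz) // mE; ring.
Qed.

(** Induction leftwards from the ray: a minimum at its right end forces slope -1 on the next
    segment, then a maximum forces slope 1. *)
Lemma zigzag_unique : zigzag eps_gt0 f.
Proof.
have main i : (forall c, zero i <= c <= pole i -> f c = - c + 2 * q i) /\
  (forall c, pole i.+1 <= c <= zero i -> f c = c + 2 * i.+1%:R * eps).
  have zp := zero_lt_pole eps_gt0.
  have pz := pole_lt_zero eps_gt0.
  elim: i => [|i [IH1 IH2]].
    have dn : forall c, zero 0 <= c <= pole 0 -> f c = f (pole 0) + (pole 0 - c).
      apply: down_unique; exists (pole 0 + 1), 0; rewrite ltrDl ltr01; split=> // x /andP[px _].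
      by rewrite ray_unique ?addr0.
    split=> c Hc.
      by rewrite (dn c Hc) ray_unique // /pole /=; ring.
    rewrite (up_unique dn Hc) dn ?lexx ?(ltW (zp _)) // ray_unique // /zero /pole.
    by ring.
  have dn : forall c, zero i.+1 <= c <= pole i.+1 -> f c = f (pole i.+1) + (pole i.+1 - c).
    by apply: down_unique; exists (zero i), (2 * i.+1%:R * eps); split.
  have fp : f (pole i.+1) = pole i.+1 + 2 * i.+1%:R * eps by rewrite IH2 // lexx ltW.
  split=> c Hc.
    by rewrite (dn c Hc) fp /pole; ring.
  by rewrite (up_unique dn Hc) dn ?lexx ?(ltW (zp _)) // fp /zero /pole -!natr1; ring.
split; first exact: ray_unique.
  by move=> i; case: (main i).
by move=> i; case: (main i).
Qed.

End ZigzagUnique.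

(** * The resolvent of the Lax operator *)

Section ComplexIntegral.
Context {R : realType}.
Local Notation mu := (@lebesgue_measure R).
Local Notation "x %:C" := (real_complex R x).
Implicit Types (D : set (measurableTypeR R)) (F H : R -> complex R) (f g : R -> R).

Lemma Re_mul (x y : complex R) : complex.Re (x * y) = complex.Re x * complex.Re y - complex.Im x * complex.Im y.
Proof. by case: x => ? ?; case: y. Qed.

Lemma Im_mul (x y : complex R) : complex.Im (x * y) = complex.Re x * complex.Im y + complex.Im x * complex.Re y.
Proof. by case: x => ? ?; case: y. Qed.

Lemma Re_conjc (x : complex R) : complex.Re (conjc x) = complex.Re x.
Proof. by case: x. Qed.

Lemma Im_conjc (x : complex R) : complex.Im (conjc x) = - complex.Im x.
Proof. by case: x. Qed.

Lemma complex_eq (x y : complex R) :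
  complex.Re x = complex.Re y -> complex.Im x = complex.Im y -> x = y.
Proof. by case: x => a b; case: y => c d /= -> ->. Qed.

Lemma normc_sqr (x : complex R) : normc x ^+ 2 = complex.Re x ^+ 2 + complex.Im x ^+ 2.
Proof. by case: x => a b /=; rewrite sqr_sqrtr // addr_ge0 ?sqr_ge0. Qed.

Definition rintegrable D (f : R -> R) := mu.-integrable D (EFin \o f).

Lemma rintegrableD D f g : measurable D -> rintegrable D f -> rintegrable D g ->
  rintegrable D (fun x => f x + g x).
Proof. by move=> mD fi gi; have := integrableD mD fi gi. Qed.

Lemma rintegrableB D f g : measurable D -> rintegrable D f -> rintegrable D g ->
  rintegrable D (fun x => f x - g x).
Proof. by move=> mD fi gi; have := integrableB mD fi gi. Qed.

Lemma rintegrableZ D (k : R) f : measurable D -> rintegrable D f ->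
  rintegrable D (fun x => k * f x).
Proof. by move=> mD fi; have := integrableZl mD k fi. Qed.

Lemma rintegrable_le D f g : measurable D -> measurable_fun D f ->
  (forall x, D x -> `|f x| <= g x) -> rintegrable D g -> rintegrable D f.
Proof.
move=> mD mf fg; apply: le_integrable => //.
  exact/measurable_EFinP.
move=> x Dx /=; rewrite lee_fin; apply: le_trans (fg x Dx) _; exact: ler_norm.
Qed.

Lemma rintegrable_meas D f : rintegrable D f -> measurable_fun D f.
Proof. by move=> /measurable_int/measurable_EFinP. Qed.

Definition cintegrable D F :=
  rintegrable D (fun x => complex.Re (F x)) /\ rintegrable D (fun x => complex.Im (F x)).

Lemma cintegrableD D F H : measurable D -> cintegrable D F -> cintegrable D H ->
  cintegrable D (fun x => F x + H x).
Proof.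
move=> mD [F1 F2] [H1 H2]; split.
  by under eq_fun do rewrite Re_add; exact: rintegrableD.
by under eq_fun do rewrite Im_add; exact: rintegrableD.
Qed.

Lemma cintegrableZ D c F : measurable D -> cintegrable D F -> cintegrable D (fun x => c * F x).
Proof.
move=> mD [F1 F2]; split.
  by under eq_fun do rewrite Re_mul; apply: rintegrableB => //; exact: rintegrableZ.
by under eq_fun do rewrite Im_mul; apply: rintegrableD => //; exact: rintegrableZ.
Qed.

Lemma cintD D F H : measurable D -> cintegrable D F -> cintegrable D H ->
  cint D (fun x => F x + H x) = cint D F + cint D H.
Proof.
move=> mD [F1 F2] [H1 H2]; rewrite /cint; apply: complex_eq => /=.
  by under eq_Rintegral do rewrite Re_add; exact: RintegralD.
by under eq_Rintegral do rewrite Im_add; exact: RintegralD.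
Qed.

Lemma cintZ D c F : measurable D -> cintegrable D F ->
  cint D (fun x => c * F x) = c * cint D F.
Proof.
move=> mD [F1 F2]; rewrite /cint; apply: complex_eq; rewrite ?Re_mul ?Im_mul /=.
  under eq_Rintegral do rewrite Re_mul.
  by rewrite RintegralB ?RintegralZl //; exact: rintegrableZ.
under eq_Rintegral do rewrite Im_mul.
by rewrite RintegralD ?RintegralZl //; exact: rintegrableZ.
Qed.

Lemma eq_cint D F H : (forall x, D x -> F x = H x) -> cint D F = cint D H.
Proof.
by move=> FH; rewrite /cint; congr (complex.Complex _ _); apply: eq_Rintegral => x /set_mem Dx;
  rewrite FH.
Qed.

Lemma cintB D F H : measurable D -> cintegrable D F -> cintegrable D H ->
  cint D (fun x => F x - H x) = cint D F - cint D H.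
Proof.
move=> mD iF iH; rewrite -mulN1r -cintZ // -cintD //; last exact: cintegrableZ.
by congr cint; apply/funext => x; rewrite mulN1r.
Qed.

Lemma cint0 D : cint D (fun=> 0) = 0.
Proof. by rewrite /cint /Rintegral integral0. Qed.

(** The factor 2 comes from bounding real and imaginary parts separately. *)
Lemma cint_normc_le D F (g : R -> R) : measurable D -> cintegrable D F -> rintegrable D g ->
  (forall x, D x -> normc (F x) <= g x) ->
  normc (cint D F) <= 2 * \int[mu]_(x in D) g x.
Proof.
move=> mD [F1 F2] gi Fg; apply: le_trans (normc_le_ReIm _) _ => /=.
rewrite mulr_natl mulr2n; apply: lerD.
  apply: le_trans (le_normr_Rintegral mD F1) _; apply: le_Rintegral => //.
    exact: integrable_norm.
  by move=> x Dx; apply: le_trans (Re_le_normc _) (Fg x Dx).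
apply: le_trans (le_normr_Rintegral mD F2) _; apply: le_Rintegral => //.
  exact: integrable_norm.
by move=> x Dx; apply: le_trans (Im_le_normc _) (Fg x Dx).
Qed.

Lemma cintegrable_le D F (g : R -> R) : measurable D ->
  measurable_fun D (fun x => complex.Re (F x)) -> measurable_fun D (fun x => complex.Im (F x)) ->
  (forall x, D x -> normc (F x) <= g x) -> rintegrable D g -> cintegrable D F.
Proof.
move=> mD m1 m2 Fg gi; split.
  by apply: (rintegrable_le mD m1 _ gi) => x Dx; apply: le_trans (Re_le_normc _) (Fg x Dx).
by apply: (rintegrable_le mD m2 _ gi) => x Dx; apply: le_trans (Im_le_normc _) (Fg x Dx).
Qed.

End ComplexIntegral.

(** * The inner product of L^2 of the circle *)

Section L2Circle.
Context {R : realType}.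
Local Notation mu := (@lebesgue_measure R).
Local Notation "x %:C" := (real_complex R x).
Local Notation circle := (@circle R).
Implicit Types (phi psi chi : R -> complex R).

Lemma measurable_circle : measurable (circle : set (measurableTypeR R)).
Proof. exact: measurable_itv. Qed.
Hint Resolve measurable_circle : core.

Lemma L2_sqr psi : L2 psi <->
  [/\ measurable_fun circle (fun x => complex.Re (psi x)), measurable_fun circle (fun x => complex.Im (psi x)),
    rintegrable circle (fun x => complex.Re (psi x) ^+ 2) & rintegrable circle (fun x => complex.Im (psi x) ^+ 2)].
Proof.
split=> [[m1 m2 i2]|[m1 m2 i1 i2]]; split=> //.
- apply: (@rintegrable_le _ _ _ (fun x => normc (psi x) ^+ 2)) => //.
    exact: measurable_funX.
  by move=> x _; rewrite ger0_norm ?sqr_ge0 // normc_sqr lerDl sqr_ge0.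
- apply: (@rintegrable_le _ _ _ (fun x => normc (psi x) ^+ 2)) => //.
    exact: measurable_funX.
  by move=> x _; rewrite ger0_norm ?sqr_ge0 // normc_sqr lerDr sqr_ge0.
- under eq_fun do rewrite normc_sqr.
  exact: rintegrableD.
Qed.

Lemma prod_le_sqr (a b t : R) : 0 < t -> `|a * b| <= 2^-1 * (t * a ^+ 2 + t^-1 * b ^+ 2).
Proof.
move=> t0; have ti : t * t^-1 = 1 by rewrite divff // gt_eqF.
have ti0 : 0 < t^-1 by rewrite invr_gt0.
have s1 : 0 <= t^-1 * (t * a - b) ^+ 2 by rewrite mulr_ge0 ?sqr_ge0 // ltW.
have s2 : 0 <= t^-1 * (t * a + b) ^+ 2 by rewrite mulr_ge0 ?sqr_ge0 // ltW.
have e1 : t^-1 * (t * a - b) ^+ 2 = t * a ^+ 2 + t^-1 * b ^+ 2 - 2 * (a * b).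
  by field; rewrite gt_eqF.
have e2 : t^-1 * (t * a + b) ^+ 2 = t * a ^+ 2 + t^-1 * b ^+ 2 + 2 * (a * b).
  by field; rewrite gt_eqF.
rewrite ler_norml; lra.
Qed.

Lemma prod_rintegrable (f g : R -> R) : measurable_fun circle f -> measurable_fun circle g ->
  rintegrable circle (fun x => f x ^+ 2) -> rintegrable circle (fun x => g x ^+ 2) ->
  rintegrable circle (fun x => f x * g x).
Proof.
move=> mf mg f2 g2.
apply: (@rintegrable_le _ _ _ (fun x => 2^-1 * (1 * f x ^+ 2 + 1^-1 * g x ^+ 2))) => //.
- exact: measurable_funM.
- by move=> x _; exact: prod_le_sqr.
- by apply: rintegrableZ => //; apply: rintegrableD => //; exact: rintegrableZ.
Qed.

Lemma inner_cintegrable phi psi : L2 phi -> L2 psi ->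
  cintegrable circle (fun x => conjc (phi x) * psi x).
Proof.
move=> /L2_sqr[m1 m2 i1 i2] /L2_sqr[n1 n2 j1 j2]; split.
  under eq_fun do rewrite Re_mul Re_conjc Im_conjc mulNr opprK.
  by apply: rintegrableD => //; exact: prod_rintegrable.
under eq_fun do rewrite Im_mul Re_conjc Im_conjc mulNr.
by apply: rintegrableB => //; exact: prod_rintegrable.
Qed.

Lemma L2D phi psi : L2 phi -> L2 psi -> L2 (fun x => phi x + psi x).
Proof.
move=> /L2_sqr[m1 m2 i1 i2] /L2_sqr[n1 n2 j1 j2]; apply/L2_sqr.
have key (f g : R -> R) : measurable_fun circle f -> measurable_fun circle g ->
    rintegrable circle (fun x => f x ^+ 2) -> rintegrable circle (fun x => g x ^+ 2) ->
    rintegrable circle (fun x => (f x + g x) ^+ 2).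
  move=> mf mg f2 g2.
  under eq_fun do rewrite sqrrD mulr2n.
  apply: rintegrableD => //; apply: rintegrableD => //; apply: rintegrableD => //; exact: prod_rintegrable.
split.
- by under eq_fun do rewrite Re_add; exact: measurable_funD.
- by under eq_fun do rewrite Im_add; exact: measurable_funD.
- by under eq_fun do rewrite Re_add; exact: key.
- by under eq_fun do rewrite Im_add; exact: key.
Qed.

Lemma L2_bounded (g : R -> complex R) (M : R) psi :
  measurable_fun circle (fun x => complex.Re (g x)) -> measurable_fun circle (fun x => complex.Im (g x)) ->
  (forall x, normc (g x) <= M) -> L2 psi -> L2 (fun x => g x * psi x).
Proof.
move=> mg1 mg2 gM [m1 m2 i2]; split.
- by under eq_fun do rewrite Re_mul; apply: measurable_funB; exact: measurable_funM.
- by under eq_fun do rewrite Im_mul; apply: measurable_funD; exact: measurable_funM.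
- apply: (@rintegrable_le _ _ _ (fun x => M ^+ 2 * normc (psi x) ^+ 2)) => //; last exact: rintegrableZ.
    under eq_fun do rewrite normcM exprMn !normc_sqr.
    by apply: measurable_funM; apply: measurable_funD; exact: measurable_funX.
  move=> x _; rewrite ger0_norm ?exprn_ge0 // normcM exprMn ler_wpM2r ?exprn_ge0 //.
  by rewrite lerXn2r ?nnegrE // (le_trans _ (gM x)).
Qed.

Lemma L2Z c psi : L2 psi -> L2 (fun x => c * psi x).
Proof. by move=> h; apply: (L2_bounded _ _ (fun=> lexx (normc c))) => //; exact: measurable_cst. Qed.

Lemma L2B phi psi : L2 phi -> L2 psi -> L2 (fun x => phi x - psi x).
Proof.
move=> h1 h2; have -> : (fun x => phi x - psi x) = (fun x => phi x + (-1) * psi x).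
  by apply/funext => x; rewrite mulN1r.
by apply: L2D => //; exact: L2Z.
Qed.

Lemma innerD phi psi chi : L2 phi -> L2 psi -> L2 chi ->
  inner phi (fun x => psi x + chi x) = inner phi psi + inner phi chi.
Proof.
move=> h1 h2 h3; rewrite /inner -mulrDr -cintD //; try exact: inner_cintegrable.
by congr (_ * _); apply: eq_cint => x _; rewrite mulrDr.
Qed.

Lemma innerZ phi psi c : L2 phi -> L2 psi -> inner phi (fun x => c * psi x) = c * inner phi psi.
Proof.
move=> h1 h2; rewrite /inner mulrCA -(cintZ c measurable_circle (inner_cintegrable h1 h2)).
by congr (_ * _); apply: eq_cint => x _; rewrite mulrCA.
Qed.

Lemma innerB phi psi chi : L2 phi -> L2 psi -> L2 chi ->
  inner phi (fun x => psi x - chi x) = inner phi psi - inner phi chi.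
Proof.
move=> h1 h2 h3; rewrite /inner -mulrBr -cintB //; try exact: inner_cintegrable.
by congr (_ * _); apply: eq_cint => x _; rewrite mulrBr.
Qed.

Lemma innerDl phi psi chi : L2 phi -> L2 psi -> L2 chi ->
  inner (fun x => phi x + psi x) chi = inner phi chi + inner psi chi.
Proof.
move=> h1 h2 h3; rewrite /inner -mulrDr -cintD //; try exact: inner_cintegrable.
by congr (_ * _); apply: eq_cint => x _; rewrite rmorphD mulrDl.
Qed.

Lemma innerBl phi psi chi : L2 phi -> L2 psi -> L2 chi ->
  inner (fun x => phi x - psi x) chi = inner phi chi - inner psi chi.
Proof.
move=> h1 h2 h3; rewrite /inner -mulrBr -cintB //; try exact: inner_cintegrable.
by congr (_ * _); apply: eq_cint => x _; rewrite rmorphB mulrBl.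
Qed.

Lemma innerZl phi psi c : L2 phi -> L2 psi -> inner (fun x => c * phi x) psi = conjc c * inner phi psi.
Proof.
move=> h1 h2; rewrite /inner mulrCA -(cintZ (conjc c) measurable_circle (inner_cintegrable h1 h2)).
by congr (_ * _); apply: eq_cint => x _; rewrite rmorphM mulrA.
Qed.

Definition norm2 psi : R := mean (fun x => normc (psi x) ^+ 2).

Lemma norm2_ge0 psi : 0 <= norm2 psi.
Proof.
rewrite /norm2 /mean mulr_ge0 ?invr_ge0 ?mulr_ge0 ?pi_ge0 //.
by apply: Rintegral_ge0 => x _; exact: exprn_ge0.
Qed.

Lemma norm2_Re psi : L2 psi -> norm2 psi = complex.Re (inner psi psi).
Proof.
move=> h; rewrite /norm2 /mean /inner Re_mul /= mul0r subr0; congr (_ * _).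
apply: eq_Rintegral => x _; rewrite normc_sqr Re_mul Re_conjc Im_conjc mulNr opprK !expr2 //.
Qed.

Let twopi_gt0 : 0 < (2 * pi : R)^-1.
Proof. by rewrite invr_gt0 mulr_gt0 // pi_gt0. Qed.

Lemma inner_half phi psi (t : R) : 0 < t -> L2 phi -> L2 psi ->
  `|complex.Re (inner phi psi)| <= 2^-1 * (t * norm2 phi + t^-1 * norm2 psi) /\
  `|complex.Im (inner phi psi)| <= 2^-1 * (t * norm2 phi + t^-1 * norm2 psi).
Proof.
move=> t0 h1 h2; have [c1 c2] := inner_cintegrable h1 h2.
have [m1 m2 i1] := h1; have [n1 n2 j1] := h2.
have bnd : rintegrable circle (fun x => 2^-1 * (t * normc (phi x) ^+ 2 + t^-1 * normc (psi x) ^+ 2)).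
  by apply: rintegrableZ => //; apply: rintegrableD => //; exact: rintegrableZ.
have E : 2^-1 * (t * norm2 phi + t^-1 * norm2 psi) =
  (2 * pi)^-1 * \int[mu]_(x in circle) (2^-1 * (t * normc (phi x) ^+ 2 + t^-1 * normc (psi x) ^+ 2)).
  rewrite RintegralZl //; last by apply: rintegrableD => //; exact: rintegrableZ.
  rewrite RintegralD //; try exact: rintegrableZ.
  rewrite !RintegralZl // /norm2 /mean; ring.
have pt x : normc (conjc (phi x) * psi x) <= 2^-1 * (t * normc (phi x) ^+ 2 + t^-1 * normc (psi x) ^+ 2).
  rewrite normcM; have -> : normc (conjc (phi x)) = normc (phi x).
    by case: (phi x) => a b /=; rewrite sqrrN.
  by apply: le_trans (ler_norm _) _; exact: prod_le_sqr.
rewrite E /inner Re_mul Im_mul /= !mul0r subr0 addr0 !normrM (gtr0_norm twopi_gt0).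
split; rewrite ler_pM2l //.
  apply: le_trans (le_normr_Rintegral measurable_circle c1) _; apply: le_Rintegral => //.
    exact: integrable_norm.
  by move=> x _; apply: le_trans (Re_le_normc _) _; exact: pt.
apply: le_trans (le_normr_Rintegral measurable_circle c2) _; apply: le_Rintegral => //.
  exact: integrable_norm.
by move=> x _; apply: le_trans (Im_le_normc _) _; exact: pt.
Qed.

(** Integrated Young inequality in place of Cauchy-Schwarz. With [t] free, a small norm of one
    argument makes the inner product small. *)
Lemma inner_le phi psi (t : R) : 0 < t -> L2 phi -> L2 psi ->
  normc (inner phi psi) <= t * norm2 phi + t^-1 * norm2 psi.
Proof.
move=> t0 h1 h2; apply: le_trans (normc_le_ReIm _) _.
have [H1 H2] := inner_half t0 h1 h2; lra.
Qed.

Lemma norm2_0 psi : L2 psi -> norm2 psi = 0 -> ae_eq_circle psi (fun=> 0).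
Proof.
move=> [m1 m2 i2] /eqP; rewrite /norm2 /mean mulf_eq0 gt_eqF //= => /eqP I0.
have I1 : (\int[mu]_(x in circle) `|(normc (psi x) ^+ 2)%:E|)%E = 0%E.
  under eq_integral do rewrite gee0_abs ?lee_fin ?exprn_ge0 //.
  have fin := integrable_fin_num measurable_circle i2.
  by rewrite -(fineK fin) -/(Rintegral _ _ _) I0.
have mi : measurable_fun (circle : set (measurableTypeR R)) (EFin \o (fun x => normc (psi x) ^+ 2)) by exact: measurable_int i2.
have [H _] := ae_eq_integral_abs mu measurable_circle mi.
have := H I1; apply: filterS => x /= Hx cx.
have := Hx cx => -[] /eqP; rewrite expf_eq0 /= => /eqP; exact: eq0_normc.
Qed.

Lemma inner_ae phi psi chi : L2 phi -> measurable_fun circle (fun x => complex.Re (psi x)) ->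
  measurable_fun circle (fun x => complex.Im (psi x)) -> L2 chi ->
  ae_eq_circle psi chi -> inner phi psi = inner phi chi.
Proof.
move=> [f1 f2 _] p1 p2 [c1 c2 _] H; rewrite /inner; congr (_ * _).
rewrite /cint; congr (complex.Complex (fine _) (fine _)); apply: ae_eq_integral => //.
1,2: apply/measurable_EFinP; under eq_fun do rewrite Re_mul Re_conjc Im_conjc;
  apply: measurable_funB; apply: measurable_funM => //; exact: measurableT_comp.
2,3: apply/measurable_EFinP; under eq_fun do rewrite Im_mul Re_conjc Im_conjc;
  apply: measurable_funD; apply: measurable_funM => //; exact: measurableT_comp.
all: by move: H; apply: (@filterS _ _ (ae_filter_ringOfSetsType mu)) => x Hx cx; rewrite Hx.
Qed.

End L2Circle.

#[export] Hint Resolve measurable_circle : core.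

Section SmoothFTC.
Context {R : realType}.
Local Notation mu := (@lebesgue_measure R).

Lemma is_derive_linear (k x : R) : is_derive x 1 (fun x : R => k * x) k.
Proof. by apply: is_derive_eq; rewrite /GRing.scale /= mulr1. Qed.

Lemma is_derive_sin_linear (k x : R) : k != 0 ->
  is_derive x 1 (fun x : R => k^-1 * sin (k * x)) (cos (k * x)).
Proof.
move=> k0; have d := is_derive1_comp (@is_derive_sin R (k * x)) (is_derive_linear k x).
have := is_deriveZ k^-1 d; rewrite /GRing.scale /= mulrA mulrAC mulVf // mul1r.
exact.
Qed.

Lemma is_derive_cos_linear (k x : R) : k != 0 ->
  is_derive x 1 (fun x : R => - k^-1 * cos (k * x)) (sin (k * x)).
Proof.
move=> k0; have d := is_derive1_comp (@is_derive_cos R (k * x)) (is_derive_linear k x).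
have := is_deriveZ (- k^-1) d; rewrite /GRing.scale /=.
by have -> : - k^-1 * (- sin (k * x) * k) = sin (k * x) by field.
Qed.

Lemma rintegrable_continuous (f : R -> R) (a b : R) : continuous f -> rintegrable `[a, b] f.
Proof.
move=> cf; apply: continuous_compact_integrable; first exact: segment_compact.
exact: continuous_subspaceT.
Qed.

Lemma Rintegral_FTC (f F : R -> R) (a b : R) : a <= b -> continuous f ->
  (forall x : R, is_derive x 1 F (f x)) ->
  \int[mu]_(x in `[a, b]) f x = F b - F a.
Proof.
move=> ab cf dF.
move: ab; rewrite le_eqVlt => /predU1P[->|ab].
  by rewrite set_itv1 Rintegral_set1 subrr.
have cF : continuous F.
  by move=> x; apply: differentiable_continuous; apply/derivable1_diffP; exact: ex_derive.
rewrite /Rintegral (@continuous_FTC2 _ f F a b) //.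
- exact: continuous_subspaceT.
- split.
  + by move=> x _; exact: ex_derive.
  + by apply: cvg_at_right_filter; exact: cF.
  + by apply: cvg_at_left_filter; exact: cF.
- by move=> x _; rewrite derive1E derive_val.
Qed.

End SmoothFTC.

(** * Fourier modes and the Hardy space *)

Section Waves.
Context {R : realType}.
Local Notation mu := (@lebesgue_measure R).
Local Notation "x %:C" := (real_complex R x).
Local Notation circle := (@circle R).
Implicit Types (phi psi chi : R -> complex R) (m : int) (n : nat).

(** Negative frequencies extend [ket]: multiplication by [v_star] leaves the Hardy space through the
    frequency -1. *)
Definition wave m (x : R) : complex R := complex.Complex (cos (m%:~R * x)) (sin (m%:~R * x)).

Lemma waveD m (n : int) x : wave (m + n) x = wave m x * wave n x.
Proof.
apply: complex_eq; rewrite ?Re_mul ?Im_mul /= intrD mulrDl ?cosD ?sinD //.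
by rewrite addrC.
Qed.

Lemma wave0 x : wave 0 x = 1.
Proof. by rewrite /wave mul0r cos0 sin0. Qed.

Lemma waveN m x : conjc (wave m x) = wave (- m) x.
Proof. by apply: complex_eq; rewrite ?Re_conjc ?Im_conjc /= mulrNz mulNr ?cosN ?sinN. Qed.

Lemma normc_wave m x : normc (wave m x) = 1.
Proof. by rewrite /wave /= cos2Dsin2 sqrtr1. Qed.

Lemma ketE h x : ket h x = wave h%:Z x.
Proof.
rewrite /ket; elim: h => [|h IH]; first by rewrite expr0 wave0.
by rewrite exprS IH -add1n PoszD waveD; congr (_ * _); rewrite /wave /expix mul1r.
Qed.

Lemma v_star_wave x : (v_star x)%:C = wave 1 x + wave (-1) x.
Proof.
apply: complex_eq; rewrite ?Re_add ?Im_add /= /v_star mul1r mulNr mul1r ?cosN ?sinN; first by ring.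
by rewrite subrr.
Qed.

Lemma continuous_Re_wave m : continuous (fun x => complex.Re (wave m x)).
Proof.
move=> x; apply: (@continuous_comp R R R (fun x => m%:~R * x) (@cos R)).
  exact: mulrl_continuous.
exact: continuous_cos.
Qed.

Lemma continuous_Im_wave m : continuous (fun x => complex.Im (wave m x)).
Proof.
move=> x; apply: (@continuous_comp R R R (fun x => m%:~R * x) (@sin R)).
  exact: mulrl_continuous.
exact: continuous_sin.
Qed.

Lemma wave_meas m : measurable_fun circle (fun x => complex.Re (wave m x)) /\
  measurable_fun circle (fun x => complex.Im (wave m x)).
Proof.
split; apply: measurable_funTS; apply: continuous_measurable_fun.
  exact: continuous_Re_wave.
exact: continuous_Im_wave.
Qed.

Lemma rintegrable_cst (c : R) : rintegrable circle (fun=> c).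
Proof. by apply: rintegrable_continuous; exact: cst_continuous. Qed.

Lemma L2_wave m : L2 (wave m).
Proof.
have [m1 m2] := wave_meas m; split=> //.
under eq_fun do rewrite normc_wave expr1n.
exact: rintegrable_cst.
Qed.
Hint Resolve L2_wave : core.

Lemma twopi_gt0 : 0 < 2 * pi :> R.
Proof. by rewrite mulr_gt0 // pi_gt0. Qed.

Lemma circle_measure : fine (mu circle) = 2 * pi.
Proof. by rewrite /Defs.circle lebesgue_measure_itv /= lte_fin twopi_gt0 -EFinB subr0. Qed.

Lemma wave_2pi m : wave m (2 * pi) = 1.
Proof.
have e1 : expix (2 * pi) = 1 :> complex R.
  by rewrite /expix mulr_natl cos2pi sin2pi.
have H h : wave h%:Z (2 * pi) = 1 by rewrite -ketE /ket e1 expr1n.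
by case: m => h; rewrite ?NegzE -?waveN H // conjc1.
Qed.

Lemma cint_wave m : cint circle (wave m) = if m == 0 then (2 * pi)%:C else 0.
Proof.
case: eqP => [->|/eqP m0].
  rewrite /cint; under eq_Rintegral do rewrite wave0 /=.
  under [X in complex.Complex _ X]eq_Rintegral do rewrite wave0 /=.
  by rewrite !Rintegral_cst // mul0r mul1r circle_measure.
have w2 := wave_2pi m; have w0 : wave m 0 = 1 by rewrite /wave mulr0 cos0 sin0.
have mR : m%:~R != 0 :> R by rewrite intr_eq0.
rewrite /cint; apply: complex_eq => /=.
  apply: etrans; first apply: (@Rintegral_FTC _ _ (fun x => m%:~R^-1 * sin (m%:~R * x))).
  - exact/ltW/twopi_gt0.
  - exact: continuous_Re_wave.
  - by move=> x; exact: is_derive_sin_linear.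
  - move: w2 w0 => /(congr1 (@complex.Im R)) /= -> /(congr1 (@complex.Im R)) /= ->.
    by rewrite mulr0 subrr.
apply: etrans; first apply: (@Rintegral_FTC _ _ (fun x => - m%:~R^-1 * cos (m%:~R * x))).
- exact/ltW/twopi_gt0.
- exact: continuous_Im_wave.
- by move=> x; exact: is_derive_cos_linear.
- move: w2 w0 => /(congr1 (@complex.Re R)) /= -> /(congr1 (@complex.Re R)) /= ->.
  by rewrite subrr.
Qed.

Lemma inner_wave m (n : int) : inner (wave m) (wave n) = (m == n)%:R.
Proof.
rewrite /inner (eq_cint (H := wave (n - m))); last first.
  by move=> x _; rewrite waveN addrC waveD.
rewrite cint_wave subr_eq0 eq_sym; case: eqP => _; last by rewrite mulr0.
by rewrite -rmorphM mulVf // gt_eqF // twopi_gt0.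
Qed.

Lemma norm2_wave m : norm2 (wave m) = 1.
Proof. by rewrite norm2_Re // inner_wave eqxx. Qed.

Lemma norm2_le psi (M : R) : L2 psi -> 0 <= M -> (forall x, normc (psi x) <= M) -> norm2 psi <= M ^+ 2.
Proof.
move=> [m1 m2 i2] M0 pM; rewrite /norm2 /mean mulrC ler_pdivrMr ?twopi_gt0 //.
apply: (@le_trans _ _ (\int[mu]_(x in circle) (M ^+ 2))).
  apply: le_Rintegral => //; first exact: rintegrable_cst.
  by move=> x _; rewrite lerXn2r ?nnegrE.
by rewrite Rintegral_cst // circle_measure.
Qed.

Definition fsum (c : nat -> complex R) n (x : R) := \sum_(i < n) c i * wave i%:Z x.

Lemma fsumS c n : fsum c n.+1 = (fun x => fsum c n x + c n * wave n%:Z x).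
Proof. by apply/funext => x; rewrite /fsum big_ord_recr. Qed.

Lemma fsum0 c : fsum c 0 = (fun x => 0 * wave 0 x).
Proof. by apply/funext => x; rewrite /fsum big_ord0 mul0r. Qed.

Lemma L2_fsum c n : L2 (fsum c n).
Proof.
elim: n => [|n IH]; first by rewrite fsum0; exact: L2Z.
by rewrite fsumS; apply: L2D => //; exact: L2Z.
Qed.
Hint Resolve L2_fsum : core.

Lemma inner_fsum phi c n : L2 phi -> inner phi (fsum c n) = \sum_(i < n) c i * inner phi (wave i%:Z).
Proof.
move=> hp; elim: n => [|n IH]; first by rewrite fsum0 innerZ // mul0r big_ord0.
by rewrite fsumS innerD //; [rewrite innerZ // IH big_ord_recr|exact: L2Z].
Qed.

Lemma inner_fsuml phi c n : L2 phi ->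
  inner (fsum c n) phi = \sum_(i < n) conjc (c i) * inner (wave i%:Z) phi.
Proof.
move=> hp; elim: n => [|n IH]; first by rewrite fsum0 innerZl // conjc0 mul0r big_ord0.
by rewrite fsumS innerDl //; [rewrite innerZl // IH big_ord_recr|exact: L2Z].
Qed.

Lemma inner_wave_fsum m c n : inner (wave m) (fsum c n) =
  if m is Posz k then (if (k < n)%N then c k else 0) else 0.
Proof.
rewrite inner_fsum //; case: m => k.
  have [kn|nk] := ltnP k n.
    rewrite (bigD1 (Ordinal kn)) //= inner_wave eqxx mulr1 big1 ?addr0 // => i ik.
    rewrite inner_wave; case: eqP => [|_]; last by rewrite mulr0.
    by case=> kE; move: ik; rewrite -val_eqE /= kE eqxx.
  rewrite big1 // => i _; rewrite inner_wave; case: eqP => [|_]; last by rewrite mulr0.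
  by case=> kE; have := ltn_ord i; rewrite -kE ltnNge nk.
by rewrite big1 // => i _; rewrite inner_wave mulr0.
Qed.

Lemma poly_fsum (p : {poly complex R}) : (fun x => p.[expix x]) = fsum (fun i => p`_i) (size p).
Proof.
apply/funext => x; rewrite horner_coef; apply: eq_bigr => i _.
by rewrite -ketE.
Qed.

Lemma fsum_poly c n : fsum c n = (fun x => (\poly_(i < n) c i).[expix x]).
Proof.
apply/funext => x; rewrite horner_poly; apply: eq_bigr => i _.
by rewrite -ketE.
Qed.

Lemma Hardy_approx psi (e : R) : Hardy psi -> 0 < e ->
  exists c n, norm2 (fun x => psi x - fsum c n x) < e ^+ 2.
Proof.
move=> [h H] e0; have [p Hp] := H e e0; exists (fun i => p`_i), (size p).
rewrite -poly_fsum; move: Hp; rewrite /dist2 -/(norm2 _) => Hp.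
rewrite -(sqr_sqrtr (norm2_ge0 _)) ltrXn2r ?nnegrE ?sqrtr_ge0 ?ltW //.
Qed.

(** Polynomials in w are orthogonal to the negative modes, and they approximate [psi]. *)
Lemma Hardy_wave_neg psi k : Hardy psi -> inner (wave (Negz k)) psi = 0.
Proof.
move=> H; have [h _] := H; apply/eqP; rewrite -normc_eq0 eq_le normc_ge0 andbT.
apply/ler_addgt0Pr => e e0; rewrite add0r.
have e2 : 0 < e / 2 by rewrite divr_gt0.
have [c [n Hn]] := Hardy_approx H e2.
have -> : inner (wave (Negz k)) psi = inner (wave (Negz k)) (fun x => psi x - fsum c n x).
  by rewrite innerB // inner_wave_fsum subr0.
apply: le_trans (inner_le e2 _ _) _ => //; first exact: L2B.
rewrite norm2_wave mulr1 [leRHS](splitr e) lerD2l ler_pdivrMl //.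
by rewrite -expr2 ltW.
Qed.

(** For an approximating polynomial p, [psi] is orthogonal to p, so its squared norm is the inner
    product of [psi - p] with [psi]; the inequality with [t = 1] absorbs half of it. *)
Lemma Hardy_coef_inj psi : Hardy psi -> (forall k : nat, inner (wave k%:Z) psi = 0) ->
  ae_eq_circle psi (fun=> 0).
Proof.
move=> H coef; have [h _] := H; apply: norm2_0 => //.
apply/eqP; rewrite eq_le norm2_ge0 andbT; apply/ler_addgt0Pr => e e0; rewrite add0r.
have s0 : 0 < Num.sqrt e by rewrite sqrtr_gt0.
have [c [n]] := Hardy_approx H s0; rewrite (sqr_sqrtr (ltW e0)) => Hn.
have h2 : L2 (fun x => psi x - fsum c n x) by exact: L2B.
have [E _] := inner_half ltr01 h2 h.
have : inner (fun x => psi x - fsum c n x) psi = inner psi psi.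
  by rewrite innerBl // inner_fsuml // big1 ?subr0 // => i _; rewrite coef mulr0.
move=> E2; move: E; rewrite E2 -norm2_Re // invr1 !mul1r ger0_norm ?norm2_ge0 //.
by move: Hn; lra.
Qed.

(** Boundedness of the coefficients is all that the Wronskian argument needs from square
    integrability. *)
Lemma coef_bounded psi m : L2 psi -> normc (inner (wave m) psi) <= 1 + norm2 psi.
Proof.
by move=> h; have := inner_le ltr01 (L2_wave m) h; rewrite norm2_wave invr1 !mul1r.
Qed.

Lemma Hardy_orth chi g : Hardy chi -> L2 g -> (forall k : nat, inner (wave k%:Z) g = 0) ->
  inner chi g = 0.
Proof.
move=> H hg coef; have [h _] := H; apply/eqP; rewrite -normc_eq0 eq_le normc_ge0 andbT.
apply/ler_addgt0Pr => e e0; rewrite add0r.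
(* This [t] makes the term with [norm2 g] at most [e / 2]; the polynomial is then chosen close
   enough for the other term. *)
pose t := 2 * (norm2 g + 1) / e.
have g0 := norm2_ge0 g.
have t0 : 0 < t by rewrite divr_gt0 // mulr_gt0 //; lra.
have et0 : 0 < e / 2 / t by apply: divr_gt0 => //; exact: divr_gt0.
have s0 : 0 < Num.sqrt (e / 2 / t) by rewrite sqrtr_gt0.
have [c [n]] := Hardy_approx H s0; rewrite (sqr_sqrtr (ltW et0)) => Hn.
have -> : inner chi g = inner (fun x => chi x - fsum c n x) g.
  by rewrite innerBl // inner_fsuml // big1 ?subr0 // => i _; rewrite coef mulr0.
apply: le_trans (inner_le t0 _ _) _ => //; first exact: L2B.
have H1 : t * norm2 (fun x => chi x - fsum c n x) <= e / 2 by rewrite -ler_pdivlMl // mulrC ltW.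
have H2 : t^-1 * norm2 g <= e / 2.
  rewrite ler_pdivrMl // /t; have -> : 2 * (norm2 g + 1) / e * (e / 2) = norm2 g + 1.
    by field; rewrite gt_eqF.
  lra.
lra.
Qed.

End Waves.

#[export] Hint Resolve L2_wave L2_fsum : core.

(** * Fourier series with geometrically decaying coefficients *)

Section FourierSeries.
Context {R : realType}.
Local Notation mu := (@lebesgue_measure R).
Local Notation "x %:C" := (real_complex R x).
Local Notation circle := (@circle R).

Definition fser (c : nat -> complex R) (x : R) : complex R := clim (fun n => fsum c n x).

(** Geometric decay gives uniform convergence, so membership in the Hardy space and the values of
    the coefficients follow from sup bounds. The coefficients needed below decay faster than any
    geometric sequence. *)
Definition fast (c : nat -> complex R) := exists C : R, forall h, normc (c h) <= C * 2^-1 ^+ h.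

Lemma geometric_tail (C : R) N n : \sum_(i < n) C * 2^-1 ^+ (N + i) <= 2 * `|C| * 2^-1 ^+ N.
Proof.
suff : \sum_(i < n) C * 2^-1 ^+ (N + i) <= 2 * `|C| * 2^-1 ^+ N * (1 - 2^-1 ^+ n).
  move=> /le_trans; apply; apply: ler_piMr.
    by rewrite !mulr_ge0 // exprn_ge0 // invr_ge0.
  by rewrite gerBl exprn_ge0 // invr_ge0.
elim: n => [|n IH]; first by rewrite big_ord0 expr0 subrr mulr0.
rewrite big_ord_recr /=; apply: le_trans (lerD IH (lexx _)) _.
have : C * 2^-1 ^+ (N + n) <= `|C| * 2^-1 ^+ (N + n).
  by rewrite ler_wpM2r ?ler_norm // exprn_ge0 ?invr_ge0.
rewrite exprD exprS => H.
by apply: le_trans (lerD (lexx _) H) _; rewrite le_eqVlt; apply/orP; left; apply/eqP; field.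
Qed.

Section Fast.
Variables (c : nat -> complex R) (C : R).
Hypothesis cC : forall h, normc (c h) <= C * 2^-1 ^+ h.

Lemma fser_ccvg x : ccvg (fun n => fsum c n x) (fser c x).
Proof.
have [|l /clim_ccvg//] := @cbounded_variation_cvg R (fun n => fsum c n x) (2 * `|C|).
move=> n; have G := geometric_tail C 0 n; rewrite expr0 mulr1 in G; apply: le_trans G; apply: ler_sum => i _.
by rewrite fsumS addrC addKr normcM normc_wave mulr1.
Qed.

Lemma fser_tail x n : normc (fser c x - fsum c n x) <= 2 * `|C| * 2^-1 ^+ n.
Proof.
have H := ccvgB (ccvg_shift n (fser_ccvg x)) (ccvg_cst (fsum c n x)).
apply: (ccvg_norm_le H); near=> k.
rewrite /fsum addnC big_split_ord /= [X in X - _]addrC addrK.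
apply: le_trans (normc_sum _ _ _) _; apply: le_trans (geometric_tail C n k).
by apply: ler_sum => i _; rewrite normcM normc_wave mulr1.
Unshelve. all: by end_near. Qed.

Lemma fser_L2 : L2 (fser c).
Proof.
have cvR : measurable_fun circle (fun x => complex.Re (fser c x)).
  apply: (@measurable_fun_cvg _ _ _ _ (fun n x => complex.Re (fsum c n x))) => [n|x _].
    by have [] := @L2_fsum R c n.
  apply/cvgrPdist_lt => e e0; have /ccvgP/(_ e e0) := fser_ccvg x.
  by apply: filterS => n; apply: le_lt_trans; rewrite -Re_sub normcBC; exact: Re_le_normc.
have cvI : measurable_fun circle (fun x => complex.Im (fser c x)).
  apply: (@measurable_fun_cvg _ _ _ _ (fun n x => complex.Im (fsum c n x))) => [n|x _].
    by have [] := @L2_fsum R c n.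
  apply/cvgrPdist_lt => e e0; have /ccvgP/(_ e e0) := fser_ccvg x.
  by apply: filterS => n; apply: le_lt_trans; rewrite -Im_sub normcBC; exact: Im_le_normc.
have -> : fser c = (fun x => fser c x * wave 0 x) by apply/funext => x; rewrite wave0 mulr1.
apply: (@L2_bounded _ _ (2 * `|C|)) => // x.
by have := fser_tail x 0; rewrite /fsum big_ord0 subr0 expr0 mulr1.
Qed.
Hint Resolve fser_L2 : core.

Lemma fser_norm2 n : norm2 (fun x => fser c x - fsum c n x) <= (2 * `|C| * 2^-1 ^+ n) ^+ 2.
Proof.
apply: norm2_le; first exact: L2B.
  by rewrite !mulr_ge0 // exprn_ge0 ?invr_ge0.
by move=> x; exact: fser_tail.
Qed.

Lemma fast_small (K e : R) : 0 < e -> \forall n \near \oo, K * 2^-1 ^+ n < e.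
Proof.
move=> e0; have H : (K * 2^-1 ^+ n) @[n --> \oo] --> (K * 0 : R).
  apply: cvgM; first exact: cvg_cst.
  by apply: cvg_expr; rewrite ger0_norm ?invr_ge0 // invf_lt1 // ltr1n.
have /cvgrPdist_lt/(_ e e0) := H; apply: filterS => n; rewrite mulr0 sub0r normrN.
exact/le_lt_trans/ler_norm.
Qed.

Lemma fser_Hardy : Hardy (fser c).
Proof.
split=> // e e0; near \oo => n; exists (\poly_(i < n) c i).
rewrite -fsum_poly /dist2 -/(norm2 _).
have K0 : 0 <= 2 * `|C| * 2^-1 ^+ n by rewrite !mulr_ge0 // exprn_ge0 ?invr_ge0.
have K1 : 2 * `|C| * 2^-1 ^+ n < e by near: n; exact: fast_small.
apply: le_lt_trans (ler_wsqrtr (fser_norm2 n)) _.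
by rewrite sqrtr_sqr ger0_norm.
Unshelve. all: by end_near. Qed.

Lemma inner_wave_fser (k : nat) : inner (wave k%:Z) (fser c) = c k.
Proof.
apply/eqP; rewrite -subr_eq0 -normc_eq0 eq_le normc_ge0 andbT.
apply/ler_addgt0Pr => e e0; rewrite add0r.
near \oo => n.
have kn : (k < n)%N by near: n; exists k.+1.
pose t := `|C| + 1.
pose K := 2 * (`|C| + 1) * 2^-1 ^+ n : R.
have K0 : 0 < K by rewrite !mulr_gt0 ?exprn_gt0 ?invr_gt0 // ltr_wpDl.
have K1 : 2 * (2 * (`|C| + 1)) * 2^-1 ^+ n < e by near: n; exact: fast_small.
have -> : inner (wave k%:Z) (fser c) - c k = inner (wave k%:Z) (fun x => fser c x - fsum c n x).
  by rewrite innerB // inner_wave_fsum kn.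
apply: le_trans (inner_le K0 _ _) _ => //; first exact: L2B.
have H : norm2 (fun x => fser c x - fsum c n x) <= K ^+ 2.
  have A0 : 0 <= 2 * `|C| * 2^-1 ^+ n by rewrite !mulr_ge0 // exprn_ge0 ?invr_ge0.
  apply: le_trans (fser_norm2 n) _; apply: lerXn2r; rewrite ?nnegrE ?(ltW K0) //.
  by rewrite ler_wpM2r ?exprn_ge0 ?invr_ge0 // ler_wpM2l // lerDl.
rewrite norm2_wave mulr1.
have : K^-1 * norm2 (fun x => fser c x - fsum c n x) <= K by rewrite ler_pdivrMl.
by move: K1; rewrite -mulrA -(mulrA 2) (mulrA 2 _ (2^-1 ^+ n)) -/K; lra.
Unshelve. all: by end_near. Qed.

End Fast.

Lemma fastD c d : fast c -> fast d -> fast (fun h => c h + d h).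
Proof.
move=> [C cC] [D dD]; exists (C + D) => h; apply: le_trans (normcD_le _ _) _.
by rewrite mulrDl lerD.
Qed.

Lemma fastZ k c : fast c -> fast (fun h => k * c h).
Proof. by move=> [C cC]; exists (normc k * C) => h; rewrite normcM -mulrA ler_wpM2l. Qed.

Lemma fserD c d x : fast c -> fast d -> fser (fun h => c h + d h) x = fser c x + fser d x.
Proof.
move=> [C cC] [D dD]; apply: climE.
have := ccvgD (fser_ccvg cC x) (fser_ccvg dD x).
have -> // : (fun n => fsum c n x + fsum d n x) = (fun n => fsum (fun h => c h + d h) n x).
by apply/funext => n; rewrite /fsum -big_split /=; apply: eq_bigr => i _; rewrite mulrDl.
Qed.

Lemma fserZ k c x : fast c -> fser (fun h => k * c h) x = k * fser c x.
Proof.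
move=> [C cC]; apply: climE.
have := ccvgM (ccvg_cst k) (fser_ccvg cC x).
have -> // : (fun n => k * fsum c n x) = (fun n => fsum (fun h => k * c h) n x).
by apply/funext => n; rewrite /fsum mulr_sumr; apply: eq_bigr => i _; rewrite mulrA.
Qed.

Lemma fser_delta0 x : fser (fun h => (h == 0)%N%:R) x = 1.
Proof.
apply: climE; apply: (@ccvg_le _ _ _ (fun=> 0)); first exact: cvg_cst.
exists 1%N => // n /= n0; rewrite -(prednK n0) /fsum big_ord_recl /= mul1r wave0 big1 ?addr0.
  by rewrite subrr normc0.
by move=> i _; rewrite mul0r.
Qed.

Lemma fast_delta0 : fast (fun h => (h == 0)%N%:R).
Proof.
exists 1 => h; rewrite mul1r; case: h => [|h]; first by rewrite eqxx expr0 normc1.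
by rewrite -[(_ == _)]/false normc0 exprn_ge0 ?invr_ge0.
Qed.

End FourierSeries.

(** * The matrix recurrence and the resolvent of the Lax operator *)

Section LaxOperator.
Context {R : realType} (eps : R) (eps_gt0 : 0 < eps).
Local Notation mu := (@lebesgue_measure R).
Local Notation "x %:C" := (real_complex R x).
Local Notation circle := (@circle R).
Local Notation e := (eps%:C).
Local Notation G := (G eps_gt0).
Local Notation T := (T eps_gt0).
Local Notation v_star := (@v_star R).
Implicit Types (psi : R -> complex R) (u k : complex R).

Lemma inner_ket h psi : inner (ket h) psi = inner (wave h%:Z) psi.
Proof. by rewrite (funext (ketE h)). Qed.

Lemma L2_v_star psi : L2 psi -> L2 (fun x => (v_star x)%:C * psi x).
Proof.
move=> h; apply: (@L2_bounded _ _ 2) => //.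
- apply: measurable_funTS; apply: (@continuous_measurable_fun R (fun x => 2 * cos x)) => x.
  by apply: cvgM; [exact: cvg_cst|exact: continuous_cos].
- move=> x; rewrite normcR /Defs.v_star normrM ger0_norm // ler_piMr //; exact: cos_max.
Qed.

Lemma inner_v_star (m : int) psi : L2 psi ->
  inner (wave m) (fun x => (v_star x)%:C * psi x) = inner (wave (m - 1)) psi + inner (wave (m + 1)) psi.
Proof.
move=> h; rewrite /inner -mulrDr -cintD //; try exact: inner_cintegrable.
congr (_ * _); apply: eq_cint => x _; rewrite v_star_wave -mulrDl mulrA; congr (_ * _).
by rewrite !waveN mulrDr -!waveD !opprD opprK.
Qed.

Lemma Hardy_wave (h : nat) : Hardy (wave (R := R) h%:Z).
Proof.
split=> // d d0; exists 'X^h; rewrite /dist2 -/(norm2 _).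
have -> : norm2 (fun x => wave h%:Z x - ('X^h).[expix x]) = 0 :> R.
  have z : (fun x : R => wave h%:Z x - ('X^h).[expix x]) = (fun x => 0 * wave 0 x).
    by apply/funext => x; rewrite hornerXn -/(ket h x) ketE subrr mul0r.
  rewrite z; apply/eqP; rewrite eq_le norm2_ge0 andbT -[leRHS](expr0n R 2).
  by apply: norm2_le => // [|x]; [exact: L2Z|rewrite mul0r normc0].
by rewrite sqrtr0.
Qed.

(** One statement for two uses: [k = 0] for the kernel of [u - L], [k = 1] for the preimage of |0>.
    At [h = 0] the coefficient of index -1 vanishes and [k] takes its place. *)
Lemma Lax_coef u k psi : Lax_graph v_star eps psi (fun x => u * psi x - k * ket 0 x) ->
  Hardy psi /\ forall h : nat, inner (wave h.+1%:Z) psi = (u + h%:R * e) * inner (wave h%:Z) psi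
    - (if h is j.+1 then inner (wave j%:Z) psi else k).
Proof.
move=> [dpsi [tpsi [[Hp Hd dE] [Ht tE] aeE]]]; split=> // h.
have [lp _] := Hp; have [ld _] := Hd; have [lt _] := Ht.
have lv := L2_v_star lp.
have lk : L2 (fun x => k * ket 0 x).
  have -> : (fun x : R => k * ket 0 x) = (fun x => k * wave 0 x) by apply/funext => x; rewrite ketE.
  exact: L2Z.
have lu : L2 (fun x => u * psi x) by exact: L2Z.
have ll : L2 (fun x => u * psi x - k * ket 0 x) by exact: L2B.
have lr : L2 (fun x => - e * dpsi x + tpsi x) by apply: L2D => //; exact: L2Z.
have := inner_ae (L2_wave h%:Z) _ _ lr aeE; case: (ll) => l1 l2 _ /(_ l1 l2).
rewrite innerB // innerZ // innerD //; last exact: L2Z.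
rewrite (innerZ (- e)) // -!inner_ket dE !inner_ket.
have -> : inner (wave h%:Z) tpsi = inner (wave (h%:Z - 1)) psi + inner (wave h.+1%:Z) psi.
  have := tE (wave h%:Z) (Hardy_wave h); rewrite innerB // => /eqP; rewrite subr_eq0 => /eqP <-.
  by rewrite inner_v_star // -(addn1 h) PoszD.
have -> : (fun x : R => k * ket 0 x) = (fun x => k * wave 0 x) by apply/funext => x; rewrite ketE.
rewrite innerZ // inner_wave => E.
have -> : inner (wave h.+1%:Z) psi = - e * (h%:R * inner (wave h%:Z) psi) +
  (inner (wave (h%:Z - 1)) psi + inner (wave h.+1%:Z) psi) +  e * (h%:R * inner (wave h%:Z) psi)
  - inner (wave (h%:Z - 1)) psi by ring.
rewrite -E; case: h {E} => [|h].
  rewrite sub0r (Hardy_wave_neg 0 Hp) mulr1; ring.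
by have -> : h.+1%:Z - 1 = h%:Z; [rewrite -(addn1 h) PoszD addrK|rewrite /= mulr0; ring].
Qed.

Section Solution.
Variable u : complex R.
Hypothesis ru : regular eps u.

(** The decaying solution of the recurrence: up to a factor independent of [h] it is J_{u/eps + h -
    1}(2/eps). Indices are shifted by one, [sol 0] standing at position -1. *)
Definition sol h : complex R := G (u + h%:R * e) / \prod_(j < h) (u + j%:R * e).

Lemma regular_shift h : regular eps (u + h%:R * e).
Proof. by move=> k; rewrite -addrA -mulrDl -natrD; exact: ru. Qed.

Lemma sol0 : sol 0 = G u.
Proof. by rewrite /sol big_ord0 divr1 mul0r addr0. Qed.

Lemma sol1 : sol 1 = G (u + e) / u.
Proof. by rewrite /sol big_ord1 mul0r addr0 mul1r. Qed.

Lemma sol_prod_neq0 h : \prod_(j < h) (u + j%:R * e) != 0.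
Proof. by rewrite prodf_seq_neq0; apply/allP => i _ /=; exact: ru. Qed.

Lemma sol_rec h : sol h.+2 = (u + h%:R * e) * sol h.+1 - sol h.
Proof.
rewrite /sol !big_ord_recr /= (G_rec eps_gt0 (regular_shift h)).
have -> : u + h.+1%:R * e = u + h%:R * e + e by rewrite -natr1; ring.
have -> : u + h.+2%:R * e = u + h%:R * e + e + e by rewrite -!natr1; ring.
have p0 := sol_prod_neq0 h; have h0 := ru h.
have h1 : u + h%:R * e + e != 0 by have := ru h.+1; rewrite -natr1 mulrDl mul1r addrA.
by field; rewrite p0 h0 h1.
Qed.

Lemma prod_growth (r : nat -> R) J : (forall j, 0 < r j) -> (forall j, (J <= j)%N -> 4 <= r j) ->
  exists2 C, 0 < C & forall h, 4 ^+ h <= C * \prod_(j < h) r j.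
Proof.
move=> r0 rJ; pose t h := 4 ^+ h / \prod_(j < h) r j.
have p0 h : 0 < \prod_(j < h) r j by apply: prodr_gt0.
have t0 h : 0 < t h by rewrite divr_gt0 // exprn_gt0.
have S0 : 0 < \sum_(h < J.+1) t h.
  by rewrite big_ord_recl ltr_pwDl // sumr_ge0 // => i _; exact: ltW.
have HS h : (h < J.+1)%N -> 4 ^+ h <= (\sum_(i < J.+1) t i) * \prod_(j < h) r j.
  move=> hJ; rewrite -ler_pdivrMr // -/(t h) (bigD1 (Ordinal hJ)) //= lerDl sumr_ge0 // => i _; exact: ltW.
move: S0 HS; move: (\sum_(h < J.+1) t h) => S S0 HS.
exists S => //; elim=> [|h IH]; first exact: HS.
have [hJ|Jh] := ltnP h.+1 J.+1; first exact: HS.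
rewrite exprS big_ord_recr /= mulrA mulrC ler_pM ?exprn_ge0 //; exact: rJ.
Qed.

Lemma sol_fast : exists C, forall h, normc (sol h) <= C * 4^-1 ^+ h.
Proof.
have [d d0 du] := regular_dist eps_gt0 ru.
pose J := (Num.truncn ((4 + normc u) / eps)).+1.
have rJ j : (J <= j)%N -> 4 <= normc (u + j%:R * e).
  move=> Jj; apply: le_trans (shift_growth eps_gt0 u j).
  suff : (4 + normc u) / eps <= j%:R by rewrite ler_pdivrMr //; lra.
  by apply: ltW; apply: lt_le_trans (truncnS_gt _) _; rewrite ler_nat.
have [C C0 HC] := prod_growth (fun j => lt_le_trans d0 (du j)) rJ.
exists (expR (4 / eps / d) * C) => h; rewrite /sol normc_div normc_prod -(mulrA (expR _)) ler_pM ?invr_ge0 ?prodr_ge0 //.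
  apply: (@cprod_norm_le _ _ (4 / eps / d)); apply: gterm_sum => // k.
  by rewrite -addrA -mulrDl -natrD.
have p0 : 0 < \prod_(j < h) normc (u + j%:R * e) by apply: prodr_gt0 => j _; exact: lt_le_trans (du j).
by rewrite exprVn ler_pdivlMr ?exprn_gt0 // mulrC ler_pdivrMr.
Qed.

(** Part of the decay [4^-1 ^+ h] absorbs the factor [h.+1], so that multiplication of the
    coefficients by [h], that is the operator D, stays within geometrically decaying sequences. *)
Lemma sol_small : exists C, forall h, normc (sol h) * h.+1%:R <= C * 2^-1 ^+ h.
Proof.
have [C HC] := sol_fast; exists (2 * C) => h.
have C0 : 0 <= C by have := HC 0%N; rewrite expr0 mulr1; apply: le_trans.
apply: (@le_trans _ _ (C * 4^-1 ^+ h * (2 * 2 ^+ h))).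
  rewrite ler_pM // -exprS -natrX ler_nat; exact: ltnW (ltn_expl _ _).
have -> : 4^-1 = 2^-1 * 2^-1 :> R by field.
rewrite exprMn le_eqVlt; apply/orP; left; apply/eqP.
have : 2^-1 ^+ h * 2 ^+ h = 1 :> R by rewrite -exprMn mulVf // expr1n.
by move=> E; rewrite (_ : C * _ * _ = 2 * C * 2^-1 ^+ h * (2^-1 ^+ h * 2 ^+ h)); [rewrite E mulr1|ring].
Qed.

(** [w] is the discrete Wronskian of [a] and of [sol] shifted by one. It is constant because both
    satisfy the same recurrence, and it tends to 0 because [a] is bounded and [sol] decays; its
    initial value is the claimed identity. *)
Lemma sol_wronskian k (a : nat -> complex R) (M : R) : (forall h, normc (a h) <= M) ->
  (forall h, a h.+1 = (u + h%:R * e) * a h - (if h is j.+1 then a j else k)) ->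
  a 0%N * sol 0 = k * sol 1.
Proof.
move=> aM arec.
pose w h := a h * sol h.+2 - a h.+1 * sol h.+1.
have wE h : w h = k * sol 1 - a 0%N * sol 0.
  elim: h => [|h IH].
    by rewrite /w arec sol_rec /= mul0r addr0; ring.
  by rewrite -IH /w (arec h.+1) (sol_rec h.+1) /=; ring.
apply/eqP; rewrite eq_sym -subr_eq0 -normc_eq0 eq_le normc_ge0 andbT.
apply/ler_addgt0Pr => d d0; rewrite add0r.
have [C HC] := sol_small.
have C0 : 0 <= C by have := HC 0%N; rewrite expr0 mulr1; apply: le_trans; rewrite mulr_ge0.
have M0 : 0 <= M by apply: le_trans (aM 0%N).
have sC h : normc (sol h) <= C * 2^-1 ^+ h.
  by apply: le_trans (HC h); rewrite ler_peMr // ler1n.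
near \oo => n.
have small : 2 * M * C * 2^-1 ^+ n < d by near: n; exact: fast_small.
rewrite -(wE n) /w; apply: le_trans (normcD_le _ _) _; rewrite normcNE (normcM (a n)) (normcM (a n.+1)).
apply: le_trans (ltW small).
have sC' h : (n <= h)%N -> normc (sol h) <= C * 2^-1 ^+ n.
  move=> nh; apply: le_trans (sC h) _; rewrite ler_wpM2l //.
  by apply: ler_wiXn2l => //; rewrite ?invr_ge0 // invf_le1 // ler1n.
have -> : 2 * M * C * 2^-1 ^+ n = M * (C * 2^-1 ^+ n) + M * (C * 2^-1 ^+ n) by ring.
by apply: lerD; apply: ler_pM => //; apply: sC'; lia.
Unshelve. all: by end_near. Qed.

Hypothesis s0 : sol 0 != 0.

Lemma Lax_injective psi : Lax_graph v_star eps psi (fun x => u * psi x) ->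
  ae_eq_circle psi (fun=> 0).
Proof.
have -> : (fun x => u * psi x) = (fun x => u * psi x - 0 * ket 0 x).
  by apply/funext => x; rewrite mul0r subr0.
move=> /Lax_coef[Hp arec]; apply: Hardy_coef_inj => //.
have [lp _] := Hp.
have := sol_wronskian (fun h => coef_bounded h%:Z lp) arec; rewrite mul0r => /eqP.
rewrite mulf_eq0 (negbTE s0) orbF => /eqP a0.
elim/nat_ind2 => [//||h IH1 IH2]; first by rewrite arec a0 mulr0 subr0.
by rewrite arec IH2 IH1 mulr0 subr0.
Qed.

Lemma Lax_resolvent psi : Lax_graph v_star eps psi (fun x => u * psi x - ket 0 x) ->
  inner (ket 0) psi = sol 1 / sol 0.
Proof.
have -> : (fun x => u * psi x - ket 0 x) = (fun x => u * psi x - 1 * ket 0 x).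
  by apply/funext => x; rewrite mul1r.
move=> /Lax_coef[Hp arec]; have [lp _] := Hp.
have := sol_wronskian (fun h => coef_bounded h%:Z lp) arec; rewrite mul1r inner_ket => <-.
by rewrite mulfK.
Qed.

Definition rcoef h : complex R := sol h.+1 / sol 0.

Lemma rcoef_rec h : rcoef h.+1 = (u + h%:R * e) * rcoef h - (if h is j.+1 then rcoef j else 1).
Proof. by rewrite /rcoef sol_rec mulrBl -mulrA; case: h => // ; rewrite divff. Qed.

Lemma rcoef_small : exists C, forall h, normc (rcoef h) * h.+1%:R <= C * 2^-1 ^+ h.
Proof.
have [C HC] := sol_small; exists (C * (normc (sol 0))^-1) => h.
have n0 : 0 <= (normc (sol 0))^-1 by rewrite invr_ge0.
have C0 : 0 <= C by have := HC 0%N; rewrite expr0 mulr1; apply: le_trans; rewrite mulr_ge0.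
rewrite /rcoef normc_div mulrAC [leRHS]mulrAC ler_wpM2r //.
apply: (@le_trans _ _ (normc (sol h.+1) * h.+2%:R)); first by rewrite ler_wpM2l // ler_nat.
apply: le_trans (HC h.+1) _; rewrite ler_wpM2l // exprS ler_piMl ?exprn_ge0 ?invr_ge0 //.
by rewrite invf_le1 // ler1n.
Qed.

Lemma fast_rcoef : fast rcoef.
Proof.
have [C HC] := rcoef_small; exists C => h; apply: le_trans (HC h).
by rewrite ler_peMr // ler1n.
Qed.

Lemma fast_nat_rcoef : fast (fun h => h%:R * rcoef h).
Proof.
have [C HC] := rcoef_small; exists C => h; apply: le_trans (HC h).
have -> : (h%:R : complex R) = (h%:R)%:C by rewrite rmorph_nat.
by rewrite normcM normcR ger0_norm // mulrC ler_wpM2l // ler_nat.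
Qed.

(** Coefficients of the projection of [v_star] times the resolvent vector; the term of index -1 is
    removed by the projection. *)
Definition tcoef h : complex R := rcoef h.+1 + (if h is j.+1 then rcoef j else 0).

Lemma tcoefE h : tcoef h = u * rcoef h + e * (h%:R * rcoef h) + (-1) * (h == 0)%N%:R.
Proof. rewrite /tcoef rcoef_rec; case: h => [|h] /=; ring. Qed.

Lemma fast_tcoef : fast tcoef.
Proof.
have -> : tcoef = (fun h => u * rcoef h + e * (h%:R * rcoef h) + (-1) * (h == 0)%N%:R).
  by apply/funext => h; rewrite tcoefE.
apply: fastD; last by apply: fastZ; exact: fast_delta0.
by apply: fastD; apply: fastZ; [exact: fast_rcoef|exact: fast_nat_rcoef].
Qed.

Lemma ex_Lax_resolvent : exists psi, Lax_graph v_star eps psi (fun x => u * psi x - ket 0 x).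
Proof.
have [C HC] := fast_rcoef; have [D HD] := fast_nat_rcoef; have [E HE] := fast_tcoef.
exists (fser rcoef), (fser (fun h => h%:R * rcoef h)), (fser tcoef).
have lr := fser_L2 HC; have lt := fser_L2 HE.
split.
- split; [exact: fser_Hardy HC|exact: fser_Hardy HD|move=> h].
  by rewrite !inner_ket (inner_wave_fser HD) (inner_wave_fser HC).
- split; first exact: fser_Hardy HE.
  move=> chi Hchi; apply: Hardy_orth => //.
    by apply: L2B => //; exact: L2_v_star.
  move=> k; rewrite innerB //; last exact: L2_v_star.
  rewrite inner_v_star // (inner_wave_fser HE) /tcoef.
  have -> : k%:Z + 1 = k.+1%:Z by rewrite -addn1 PoszD.
  rewrite (inner_wave_fser HC); case: k => [|k].
    by rewrite sub0r (Hardy_wave_neg 0 (fser_Hardy HC)) add0r addr0 subrr.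
  have -> : k.+1%:Z - 1 = k%:Z by rewrite -(addn1 k) PoszD addrK.
  by rewrite (inner_wave_fser HC) [X in X - _]addrC subrr.
- apply: (@aeW _ _ _ mu) => x _.
  have -> : tcoef = (fun h => u * rcoef h + e * (h%:R * rcoef h) + (-1) * (h == 0)%N%:R).
    by apply/funext => h; rewrite tcoefE.
  have f1 := fastZ u fast_rcoef; have f2 := fastZ e fast_nat_rcoef.
  have f3 := fastZ (-1) (@fast_delta0 R).
  rewrite (fserD x (fastD f1 f2) f3) (fserD x f1 f2) (fserZ _ x fast_rcoef).
  rewrite (fserZ _ x fast_nat_rcoef) (fserZ _ x (@fast_delta0 R)) fser_delta0 /ket expr0; ring.
Qed.

End Solution.

Lemma Phi0_iff u z : regular eps u -> not_pole eps_gt0 u ->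
  Phi0 v_star eps u z <-> z = T u.
Proof.
move=> ru pu.
have s0 : sol u 0 != 0 by rewrite sol0 G_neq0.
have TE : sol u 1 / sol u 0 = T u.
  by rewrite (T_G ru pu) sol1 sol0 invfM mulrA.
split=> [[_ [psi Lpsi ->]]|->]; first by rewrite (Lax_resolvent ru s0 Lpsi).
split; first by move=> psi; exact: Lax_injective.
have [psi Lpsi] := ex_Lax_resolvent ru s0.
by exists psi; rewrite // (Lax_resolvent ru s0 Lpsi).
Qed.

End LaxOperator.

(** * Identification of the action profile with the zigzag *)

Section ActionProfile.
Context {R : realType} (eps : R) (eps_gt0 : 0 < eps).
Local Notation mu := (@lebesgue_measure R).
Local Notation "x %:C" := (real_complex R x).
Local Notation e := (eps%:C).
Local Notation T := (T eps_gt0).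
Local Notation pole := (pole eps_gt0).
Local Notation zero := (zero eps_gt0).
Local Notation v_star := (@v_star R).
Implicit Types (u : complex R) (s : R).

(** The points where [regular] fails are isolated, hence invisible to punctured neighbourhoods. *)
Lemma regular_punctured s : exists2 d : R, 0 < d &
  forall u, u != s%:C -> normc (u - s%:C) < d -> regular eps u.
Proof.
(* The term that vanishes when [s] itself is one of the points [- k eps] is replaced by 1. *)
pose c (k : nat) : complex R := if s%:C + k%:R * e == 0 then 1 else s%:C + k%:R * e.
have [||d d0 dc] := @dist_lower _ _ eps_gt0 c `|s|.
- move=> k; rewrite /c; case: eqP => [|_].
    rewrite real_complex_nat -rmorphD => -[sk]; rewrite normc1.
    by have := ler_norm (- s); rewrite normrN; lra.
  by have := shift_growth eps_gt0 s%:C k; rewrite normcR.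
- by move=> k; rewrite /c; case: ifPn => // _; exact: oner_neq0.
exists d => // u us ud k; have uE : u + k%:R * e = (s%:C + k%:R * e) + (u - s%:C) by ring.
have := dc k; rewrite /c uE; case: eqP => [-> _|_ dk]; first by rewrite add0r subr_eq0.
by have := normcD_ge (s%:C + k%:R * e) (u - s%:C); rewrite -normc_gt0; lra.
Qed.

Lemma test_point s (d : R) : 0 < d -> exists u : complex R, u != s%:C /\ normc (u - s%:C) < d.
Proof.
move=> d0; exists (complex.Complex s (d / 2)).
have uE : complex.Complex s (d / 2) - s%:C = complex.Complex 0 (d / 2).
  by rewrite /real_complex_def; simpc.
have un : normc (complex.Complex s (d / 2) - s%:C) = d / 2.
  by rewrite uE /= expr0n /= add0r sqrtr_sqr ger0_norm // divr_ge0 // ltW.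
split; last by rewrite un; lra.
by rewrite -subr_eq0 -normc_eq0 un gt_eqF // divr_gt0.
Qed.

Lemma zero_neq_pole i j : zero i != pole j.
Proof.
have [ji|ij] := leqP j i.
  by rewrite lt_eqF // (lt_le_trans (zero_lt_pole _ _)) // pole_le.
by rewrite gt_eqF // (le_lt_trans _ (pole_lt_zero eps_gt0 i)) // pole_le.
Qed.

(** [T_order] decides everything once poles and zeroes are disjoint: |T| is at least m/|u - s| at a
    pole, and bounded near any other real point. *)
Lemma Phi0_pole_iff s : Phi0_pole v_star eps s%:C <-> exists i, pole i = s.
Proof.
have [d1 d10 reg] := regular_punctured s.
have [m [B [d [m0 B0 d0 H]]]] := T_order eps_gt0 s.
split=> [P|[i ip]].
  apply: contrapT => np.
  have b0 : `[< exists i, pole i = s >] = false by apply/asboolP.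
  have [d2 d20 H2] := P B.
  have [|u [us]] := @test_point s (Num.min (Num.min d d1) (Num.min d2 1)).
    by rewrite !lt_min d0 d10 d20 ltr01.
  rewrite !lt_min => /andP[/andP[ud ud1] /andP[ud2 u1]].
  have ru := reg u us ud1; have [pu /andP[_ TB]] := H u us ud.
  have [z /(Phi0_iff z ru pu) -> Bz] := H2 u us ud2.
  move: TB; rewrite b0 expr0 mulr1 leNgt => /negP; apply; apply: le_lt_trans Bz.
  by rewrite ler_piMr ?(ltW B0) // exprn_ile1 // ltW.
have b1 : `[< exists i, pole i = s >] = true by apply/asboolP; exists i.
have a0 : `[< exists i, zero i = s >] = false.
  by apply/asboolP => -[j zj]; have := zero_neq_pole j i; rewrite zj ip eqxx.
move=> M; exists (Num.min (Num.min d d1) (m / (`|M| + 1))).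
  by rewrite !lt_min d0 d10 divr_gt0 // ltr_wpDl.
move=> u us; rewrite !lt_min => /andP[/andP[ud ud1] uM].
have ru := reg u us ud1; have [pu /andP[TB _]] := H u us ud.
exists (T u); first exact/(Phi0_iff _ ru pu).
move: TB; rewrite a0 b1 expr0 expr1 mulr1 => TB.
have M1 : 0 < `|M| + 1 by rewrite ltr_wpDl.
have r0 : 0 < normc (u - s%:C) by rewrite normc_gt0 subr_eq0.
move: uM; rewrite ltr_pdivlMr // => uM.
have : normc (u - s%:C) * (`|M| + 1) < normc (u - s%:C) * normc (T u).
  by rewrite [ltRHS]mulrC; exact: lt_le_trans uM TB.
rewrite ltr_pM2l //; have := ler_norm M; lra.
Qed.

Lemma Phi0_zero_iff s : Phi0_zero v_star eps s%:C <-> exists i, zero i = s.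
Proof.
have [d1 d10 reg] := regular_punctured s.
have [m [B [d [m0 B0 d0 H]]]] := T_order eps_gt0 s.
split=> [P|[i iz]].
  apply: contrapT => np.
  have a0 : `[< exists i, zero i = s >] = false by apply/asboolP.
  have [d2 d20 H2] := P m m0.
  have [|u [us]] := @test_point s (Num.min (Num.min d d1) (Num.min d2 1)).
    by rewrite !lt_min d0 d10 d20 ltr01.
  rewrite !lt_min => /andP[/andP[ud ud1] /andP[ud2 u1]].
  have ru := reg u us ud1; have [pu /andP[TB _]] := H u us ud.
  have [z /(Phi0_iff z ru pu) -> zm] := H2 u us ud2.
  move: TB; rewrite a0 expr0 mulr1 leNgt => /negP; apply; apply: le_lt_trans zm.
  by rewrite ler_piMr // exprn_ile1 // ltW.
have a1 : `[< exists i, zero i = s >] = true by apply/asboolP; exists i.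
have b0 : `[< exists i, pole i = s >] = false.
  by apply/asboolP => -[j pj]; have := zero_neq_pole i j; rewrite iz pj eqxx.
move=> r r0; exists (Num.min (Num.min d d1) (r / B)).
  by rewrite !lt_min d0 d10 divr_gt0.
move=> u us; rewrite !lt_min => /andP[/andP[ud ud1] uM].
have ru := reg u us ud1; have [pu /andP[_ TB]] := H u us ud.
exists (T u); first exact/(Phi0_iff _ ru pu).
move: TB; rewrite a1 b0 expr0 expr1 mulr1 => /le_lt_trans; apply.
by rewrite mulrC -ltr_pdivlMr.
Qed.

Lemma mean_v_star : mean v_star = 0.
Proof.
have := @cint_wave R 1; rewrite /= => /(congr1 (@complex.Re R)) /= E.
rewrite /mean (_ : \int[mu]_(x in _) _ = 0) ?mulr0 //.
rewrite /Defs.v_star RintegralZl //; last by apply: rintegrable_continuous; exact: continuous_cos.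
apply/eqP; rewrite mulf_eq0 /=; apply/orP; right; apply/eqP; rewrite -[RHS]E.
by apply: eq_Rintegral => x _; rewrite mul1r.
Qed.

Lemma action_profile_zigzag f : dispersive_action_profile v_star eps f <-> zigzag eps_gt0 f.
Proof.
split=> [[pf aef minf maxf [lim1 _]]|zf].
  apply: zigzag_unique => //.
  - by move=> c; rewrite minf; exact: Phi0_pole_iff.
  - by move=> c; rewrite maxf; exact: Phi0_zero_iff.
  - by move: lim1; rewrite mean_v_star.
split.
- exact: zigzag_piecewise zf.
- exact: zigzag_ae zf.
- by move=> c; rewrite (local_min_pole _ zf) Phi0_pole_iff.
- by move=> c; rewrite (local_max_zero _ zf) Phi0_zero_iff.
- rewrite mean_v_star; exact: zigzag_cvg zf.
Qed.

End ActionProfile.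

(** * Lipschitz functions *)

Section AeIntegral.
Import HBNNSimple.
Context d (T : measurableType d) {R : realType} (mu : {measure set T -> \bar R}).
Local Open Scope ereal_scope.

(** A simple function below [f], restricted to the complement of the null set, lies below [g] and
    keeps its integral. The integral being a supremum over simple functions, no measurability
    enters. *)
Let le_ge0_integral_ae (f g : T -> \bar R) : (forall x, 0 <= f x) -> (forall x, 0 <= g x) ->
  {ae mu, forall x, f x = g x} -> \int[mu]_x f x <= \int[mu]_x g x.
Proof.
move=> f0 g0 [N [mN N0 fgN]].
rewrite !ge0_integralTE //; apply: ge_ereal_sup => _ [h /= hf <-].
have mNC := measurableC mN.
have pE x : proj_nnsfun h mNC x = (h \_ (~` N)) x by rewrite -mrestrict.
rewrite (_ : sintegral mu h = sintegral mu (proj_nnsfun h mNC)).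
  apply: ereal_sup_ubound; exists (proj_nnsfun h mNC) => [x|//]; rewrite pE patchE.
  case: ifPn => [|_]; last exact: g0.
  rewrite inE /= => xN; apply: le_trans (hf x) _; rewrite le_eqVlt (_ : f x = g x) ?eqxx //.
  by apply: contrapT => fg; apply: xN; apply: fgN.
rewrite -!integralT_nnsfun; apply: ae_eq_integral => //; try exact/measurable_EFinP.
exists N; split=> // x /= fg; apply: contrapT => xN; apply: fg => _.
by apply: (congr1 EFin); apply: esym; apply: etrans (pE x) _; rewrite patchE mem_set.
Qed.

(* No measurability is required, so this applies to [derive1 f], whose values
   are arbitrary at the points where [f] is not derivable. *)
Lemma integral_ae (D : set T) (f g : T -> \bar R) :
  {ae mu, forall x, D x -> f x = g x} -> \int[mu]_(x in D) f x = \int[mu]_(x in D) g x.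
Proof.
move=> [N [mN N0 fgN]]; rewrite integral_mkcond [RHS]integral_mkcond.
have E x : ~ N x -> (f \_ D) x = (g \_ D) x.
  move=> xN; rewrite !patchE; case: ifPn => //; rewrite inE => Dx.
  by apply: contrapT => fg; apply: xN; apply: fgN => /= /(_ Dx).
rewrite integralE [RHS]integralE; congr (_ - _); apply/eqP; rewrite eq_le; apply/andP;
  split; apply: le_ge0_integral_ae => //; exists N; split=> // x /= fg; apply: contrapT => xN;
  by apply: fg; rewrite ?funepos.unlock ?funeneg.unlock E.
Qed.

End AeIntegral.

Section Lipschitz.
Context {R : realType}.
Local Notation mu := (@lebesgue_measure R).

Lemma stieltjes_itv (F : cumulative R R) (a b : R) : a <= b ->
  lebesgue_stieltjes_measure F `]a, b]%classic = (F b - F a)%:E.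
Proof.
move=> ab; rewrite /lebesgue_stieltjes_measure /measure_extension /= measurable_mu_extE /=.
  exact: wlength_itv_bnd.
exact: is_ocitv.
Qed.

Lemma rintegrable_cst_oc (a b k : R) : rintegrable `]a, b]%classic (fun=> k).
Proof.
apply: (@integrableS _ _ _ mu `[a, b]%classic) => //.
- exact: subset_itv_oc_cc.
- by apply: (@rintegrable_continuous R (fun=> k)); exact: cst_continuous.
Qed.

Lemma lipschitz1P (g : R -> R) : 1.-lipschitz g -> forall x y, `|g x - g y| <= `|x - y|.
Proof. by move=> lg x y; have := lg (x, y) (conj I I); rewrite /= mul1r. Qed.

Lemma lipschitz1_continuous (g : R -> R) : (forall x y, `|g x - g y| <= `|x - y|) -> continuous g.
Proof.
move=> lg x; apply/cvgrPdist_lt => e e0; near=> y.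
apply: le_lt_trans (lg x y) _; near: y; exact: cvgr_dist_lt.
Unshelve. all: by end_near. Qed.

Variable g : R -> R.
Hypothesis lg : forall x y, `|g x - g y| <= `|x - y|.

(* [primitive_half] and its complement to the identity are both nondecreasing,
   so the Stieltjes measure of the former is dominated by Lebesgue measure. *)
Definition primitive_half (x : R) : R := 2^-1 * (x + g x).

Let lgB x y : x <= y -> - (y - x) <= g y - g x <= y - x.
Proof. by move=> xy; rewrite -ler_norml; apply: le_trans (lg y x) _; rewrite ger0_norm ?subr_ge0. Qed.

Let cont_half : continuous primitive_half.
Proof.
move=> x; apply: cvgM; first exact: cvg_cst.
by apply: cvgD; [exact: cvg_id|exact: lipschitz1_continuous].
Qed.

Let nd_half : nondecreasing primitive_half.
Proof. by move=> x y xy; rewrite ler_pM2l //; have := lgB xy; lra. Qed.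

Let nd_compl : nondecreasing (fun x => x - primitive_half x).
Proof. by move=> x y xy; rewrite /primitive_half; have := lgB xy; lra. Qed.

Let cont_compl : continuous (fun x => x - primitive_half x).
Proof. by move=> x; apply: cvgB; [exact: cvg_id|exact: cont_half]. Qed.

Let F : cumulative R R := HB.pack_for (cumulative R R) primitive_half
  (isCumulative.Build R _ R primitive_half nd_half (right_continuousW cont_half)).
Let Fc : cumulative R R := HB.pack_for (cumulative R R) (fun x => x - primitive_half x)
  (isCumulative.Build R _ R _ nd_compl (right_continuousW cont_compl)).

(** The Stieltjes measures of [primitive_half] and of its complement add up to Lebesgue measure,
    since their sum gives each half-open interval its length. *)
Let dominated (A : set (measurableTypeR R)) : measurable A ->
  (lebesgue_stieltjes_measure F A <= mu A)%E.
Proof.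
move=> mA.
pose m := measure_add (lebesgue_stieltjes_measure F) (lebesgue_stieltjes_measure Fc).
have mE X : m X = (lebesgue_stieltjes_measure F X + lebesgue_stieltjes_measure Fc X)%E.
  exact: measure_addE.
have -> : mu A = m A.
  apply: (@lebesgue_measure_unique R m) => // X /ocitvP[->|[[a b] /= ab ->]].
    by rewrite !measure0.
  apply: etrans (esym (mE _)); apply: etrans (esym (f_equal2 adde (stieltjes_itv F (ltW ab)) (stieltjes_itv Fc (ltW ab)))).
  rewrite lebesgue_measure_itv /= lte_fin ab.
  by rewrite -!EFinD; congr (_%:E); rewrite /primitive_half; ring.
by rewrite mE leeDl.
Qed.

(** Radon-Nikodym for the Stieltjes measure of [primitive_half], restricted to a bounded interval so
    as to be finite; Lebesgue differentiation identifies the density. [2 r - 1] undoes the passage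
    from [g] to [primitive_half]. *)
Lemma local_density (N : R) : 0 < N -> exists r : R -> R,
  [/\ rintegrable setT r,
      forall a b, - N <= a -> a <= b -> b <= N ->
        g b - g a = \int[mu]_(x in `]a, b]) (2 * r x - 1) &
      {ae mu, forall x, - N < x < N -> derivable g x 1 /\ derive1 g x = 2 * r x - 1}].
Proof.
move=> N0.
pose D : set (measurableTypeR R) := `]- N, N]%classic.
have mD : measurable D by exact: measurable_itv.
have NN : - N <= N by lra.
have fD : (lebesgue_stieltjes_measure F D < +oo)%E by rewrite stieltjes_itv // ltry.
pose nu := mfrestr mD fD.
have dom : nu `<< mu.
  apply/null_content_dominatesP => A mA A0; apply/eqP; rewrite eq_le measure_ge0 andbT -A0.
  rewrite /nu /mfrestr /mrestr; apply: le_trans (dominated mA); apply: le_measure; rewrite ?inE //.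
  exact: measurableI.
have [h [h0 hfin hint hE]] := radon_nikodym_sigma_finite dom.
pose r x := fine (h x).
have rE : EFin \o r = h by apply/funext => x; rewrite /= fineK.
have ir : rintegrable setT r by rewrite /rintegrable rE.
have rS (A : set (measurableTypeR R)) : measurable A -> rintegrable A r.
  by move=> mA; apply: integrableS ir.
have incr a b : - N <= a -> a <= b -> b <= N -> \int[mu]_(x in `]a, b]) r x = F b - F a.
  move=> Na ab bN; rewrite /Rintegral.
  have : nu `]a, b]%classic = (F b - F a)%:E.
    rewrite /nu /mfrestr /mrestr (setIidl _) ?stieltjes_itv //.
    by move=> x; rewrite /D /= !in_itv /= => /andP[ax xb]; rewrite (le_lt_trans Na ax) (le_trans xb).
  move=> nE; have := etrans (esym (hE `]a, b]%classic (measurable_itv _))) nE.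
  by rewrite -rE /= => ->.
exists r; split=> //.
- move=> a b Na ab bN.
  have mI : measurable (`]a, b]%classic : set (measurableTypeR R)) by exact: measurable_itv.
  have i1 := @rintegrable_cst_oc a b 1.
  rewrite RintegralB //; last by apply: rintegrableZ => //; exact: rS.
  rewrite RintegralZl //; last exact: rS.
  have -> : \int[mu]_(x in `]a, b]) (1 : R) = b - a.
    rewrite Rintegral_cst // mul1r (_ : fine _ = fine (lebesgue_measure `]a, b]%classic)) //.
    rewrite lebesgue_measure_itv /= lte_fin; case: ltP => //= ba.
    by apply/esym/eqP; rewrite subr_eq0 eq_le ab ba.
  by rewrite incr //= /primitive_half; field.
- have loc : locally_integrable [set: R] r by apply: open_integrable_locally => //; exact: openT.
  have := @FTC1 R r (BRight (- N)) (fun y => rS _ (measurable_itv _)) loc.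
  move=> /= ae1; apply: (@filterS _ _ (ae_filter_ringOfSetsType mu) _ _ _ ae1) => x H /andP[Nx xN].
  have [|dx dE] := H; first by rewrite lte_fin.
  pose J (y : R) := \int[mu]_(t in `]- N, y]) r t.
  have dJ : is_derive x 1 J (r x) := DeriveDef dx (etrans (esym (derive1E _ _)) dE).
  have gJ : {near x, (fun y => 2 * (J y + F (- N)) - y) =1 g}.
    near=> y.
    have Ny : - N <= y by apply: ltW; near: y; exact: lt_nbhsr.
    have yN : y <= N by apply: ltW; near: y; exact: lt_nbhsl.
    by rewrite /J incr // /= /primitive_half; field.
  have dg : is_derive x 1 (fun y => 2 * (J y + F (- N)) - y) (2 * r x - 1).
    by apply: is_derive_eq; rewrite addr0.
  split; first by apply: near_eq_derivable gJ _; apply: ex_derive.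
  by rewrite derive1E -(near_eq_derive (1 : R^o) gJ) derive_val.
Unshelve. all: by end_near. Qed.

Let ratio (n : nat) (x : R) : R := n.+1%:R * (g (n.+1%:R^-1 + x) - g x).

Let ratio_le n x : `|ratio n x| <= 1.
Proof.
rewrite normrM ger0_norm // -ler_pdivlMl // mulr1; apply: le_trans (lg _ _) _.
by rewrite addrK ger0_norm.
Qed.

Let ratio_cvg x : derivable g x 1 -> ratio n x @[n --> \oo] --> derive1 g x.
Proof.
move=> dg; pose h (n : nat) : R := n.+1%:R^-1.
have h0 : h @ \oo --> (0 : R)^'.
  move=> A /(@cvg_harmonic R) H.
  have {}H : \forall n \near \oo, (h n != 0 -> A (h n)) by exact: H.
  by apply: filterS H => n; apply; rewrite invr_eq0 pnatr_eq0.
have D : (fun t => t^-1 *: (g (t + x) - g x)) @ 0^' --> derive1 g x.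
  move: dg; rewrite /derivable /derive1.
  rewrite (_ : (fun h => h^-1 *: ((g \o shift x) (h *: 1) - g x)) = (fun t => t^-1 *: (g (t + x) - g x))) //.
  by apply/funext => t; rewrite /= /GRing.scale /= mulr1.
have := @cvg_comp _ _ _ h (fun t => t^-1 *: (g (t + x) - g x)) \oo _ _ h0 D; apply: cvg_trans; apply: near_eq_cvg; apply: nearW => n.
by rewrite /= /ratio /h invrK.
Qed.

(** The local densities depend on the interval. A global one is obtained as the upper limit of the
    difference quotients with steps 1/(n+1), clipped to [-1, 1]: it is measurable, bounded at every
    point, and equals the derivative wherever there is one. The local densities then serve only to
    show that this happens almost everywhere and to integrate it. *)
Lemma lipschitz_density : exists r : R -> R,
  [/\ measurable_fun setT r, (forall x, `|r x| <= 1),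
      {ae mu, forall x, derivable g x 1 /\ derive1 g x = r x} &
      forall a b, a <= b -> \int[mu]_(x in `[a, b]) r x = g b - g a].
Proof.
pose s x := limn_sup (ratio ^~ x).
have ms : measurable_fun setT s.
  apply: measurable_fun_limn_sup => [x _|x _|n].
  - by exists 1 => _ [n _ <-]; have := ratio_le n x; rewrite ler_norml => /andP[].
  - by exists (- 1) => _ [n _ <-]; have := ratio_le n x; rewrite ler_norml => /andP[].
  - apply: continuous_measurable_fun => x; apply: cvgM; first exact: cvg_cst.
    apply: cvgB; last exact: lipschitz1_continuous.
    apply: (@continuous_comp R R R (fun x => n.+1%:R^-1 + x) g); last exact: lipschitz1_continuous.
    by apply: cvgD; [exact: cvg_cst|exact: cvg_id].
pose r x := Num.max (- 1) (Num.min 1 (s x)).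
have mr : measurable_fun setT r.
  by apply: measurable_maxr => //; apply: measurable_minr.
have r1 x : `|r x| <= 1.
  by rewrite ler_norml /r le_max lexx /= ge_max ge_min lexx andbT; lra.
have rE x : derivable g x 1 -> derive1 g x = r x.
  move=> dx; have cx := ratio_cvg dx.
  have sE : s x = derive1 g x.
    by rewrite /s cvg_limn_supE; [exact: cvg_lim|apply: cvgP; exact: cx].
  have : `|derive1 g x| <= 1.
    have cn : `|ratio n x| @[n --> \oo] --> `|derive1 g x| by exact: cvg_norm.
    rewrite -(cvg_lim _ cn) //; apply: limr_le; first exact: cvgP cn.
    by apply: nearW => n; exact: ratio_le.
  rewrite /r sE ler_norml => /andP[d1 d2].
  by rewrite min_r // max_r.
have rae : {ae mu, forall x, derivable g x 1 /\ derive1 g x = r x}.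
  have : {ae mu, forall x, forall n : nat, - n.+1%:R < x < n.+1%:R -> derivable g x 1}.
    apply: ae_foralln => n; have [|q [_ _ qae]] := @local_density n.+1%:R; first by [].
    by apply: (@filterS _ _ (ae_filter_ringOfSetsType mu) _ _ _ qae) => x H /H[].
  apply: (@filterS _ _ (ae_filter_ringOfSetsType mu)) => x H.
  have dx : derivable g x 1.
    apply: (H (Num.truncn `|x|)); rewrite -ltr_norml.
    exact: truncnS_gt.
  by split=> //; exact: rE.
exists r; split=> // a b ab.
pose N := `|a| + `|b| + 1.
have [aN bN] : - N < a /\ b < N.
  by have := ler_norm b; have := ler_norm (- a); rewrite normrN /N; have := normr_ge0 a; have := normr_ge0 b; lra.
have N0 : 0 < N by lra.
have [q [qi qE qae]] := local_density N0.
rewrite qE ?(ltW aN) ?(ltW bN) // -Rintegral_itv_obnd_cbnd.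
  congr fine; apply: integral_ae.
  apply: (@filterS2 _ _ (ae_filter_ringOfSetsType mu) _ _ _ _ rae qae) => x [_ <-] H /=.
  rewrite in_itv /= => /andP[ax xb]; congr EFin; apply: (H _).2.
  by rewrite (lt_trans aN ax) (le_lt_trans xb bN).
apply: (@rintegrable_le R _ _ (fun=> 1)) => //; last exact: rintegrable_cst_oc.
exact: measurable_funTS.
Qed.

End Lipschitz.

(** * The observable of the action profile *)

Section CexpKernel.
Context {R : realType}.
Local Notation mu := (@lebesgue_measure R).
Local Notation "x %:C" := (real_complex R x).
Implicit Types (u z w : complex R) (D : set (measurableTypeR R)).

Lemma cexpD z w : cexp (z + w) = cexp z * cexp w.
Proof.
apply: complex_eq; rewrite /cexp !(Re_mul, Im_mul, Re_add, Im_add) /= expRD cosD sinD; ring.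
Qed.

Lemma cexp0 : cexp (0 : complex R) = 1.
Proof. by apply: complex_eq; rewrite /cexp !(Re_mul, Im_mul) /= expR0 cos0 sin0; ring. Qed.

Lemma cexpN z : cexp (- z) = (cexp z)^-1.
Proof.
have /(congr1 (fun x => x * (cexp z)^-1)) := cexpD (- z) z; rewrite addNr cexp0 mul1r => ->.
rewrite mulfK //; apply/eqP => z0.
by have := cexpD z (- z); rewrite subrr cexp0 z0 mul0r => /eqP; rewrite oner_eq0.
Qed.

Lemma ccvg_ReIm (a : nat -> complex R) z : (complex.Re (a n)) @[n --> \oo] --> complex.Re z ->
  (complex.Im (a n)) @[n --> \oo] --> complex.Im z -> ccvg a z.
Proof.
move=> /cvgrPdist_lt hr /cvgrPdist_lt hi; apply/ccvgP => e e0.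
have e2 : 0 < e / 2 by rewrite divr_gt0.
near=> n; apply: le_lt_trans (normc_le_ReIm _) _; rewrite Re_sub Im_sub.
have : `|complex.Re z - complex.Re (a n)| < e / 2 by near: n; exact: hr.
have : `|complex.Im z - complex.Im (a n)| < e / 2 by near: n; exact: hi.
rewrite distrC (distrC (complex.Re z)); lra.
Unshelve. all: by end_near. Qed.

Lemma ccvg_Re (a : nat -> complex R) z : ccvg a z -> (complex.Re (a n)) @[n --> \oo] --> complex.Re z.
Proof.
move=> /ccvgP az; apply/cvgrPdist_lt => e /az; apply: filterS => n; apply: le_lt_trans.
by rewrite distrC -Re_sub; exact: Re_le_normc.
Qed.

Lemma ccvg_Im (a : nat -> complex R) z : ccvg a z -> (complex.Im (a n)) @[n --> \oo] --> complex.Im z.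
Proof.
move=> /ccvgP az; apply/cvgrPdist_lt => e /az; apply: filterS => n; apply: le_lt_trans.
by rewrite distrC -Im_sub; exact: Im_le_normc.
Qed.

Lemma ccvg_cexp (a : nat -> complex R) z : ccvg a z -> ccvg (fun n => cexp (a n)) (cexp z).
Proof.
move=> az; have hr := ccvg_Re az; have hi := ccvg_Im az.
have er : expR (complex.Re (a n)) @[n --> \oo] --> expR (complex.Re z).
  by apply: continuous_cvg; [exact: continuous_expR|exact: hr].
have ec : cos (complex.Im (a n)) @[n --> \oo] --> cos (complex.Im z).
  by apply: continuous_cvg; [exact: continuous_cos|exact: hi].
have es : sin (complex.Im (a n)) @[n --> \oo] --> sin (complex.Im z).
  by apply: continuous_cvg; [exact: continuous_sin|exact: hi].
have ReE w : complex.Re (cexp w) = expR (complex.Re w) * cos (complex.Im w).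
  by rewrite /cexp Re_mul /= mul0r subr0.
have ImE w : complex.Im (cexp w) = expR (complex.Re w) * sin (complex.Im w).
  by rewrite /cexp Im_mul /= mul0r addr0.
apply: ccvg_ReIm; rewrite (ReE, ImE); under eq_fun do rewrite (ReE, ImE); exact: cvgM.
Qed.

Lemma cint_ae D (F H : R -> complex R) :
  {ae mu, forall x, D x -> F x = H x} -> cint D F = cint D H.
Proof.
move=> FH; rewrite /cint; congr complex.Complex; congr fine; apply: integral_ae;
  by apply: (@filterS _ _ (ae_filter_ringOfSetsType mu) _ _ _ FH) => x E Dx; rewrite E.
Qed.

Lemma Rintegral_dominated D (F_ : nat -> R -> R) (F g : R -> R) : measurable D ->
  (forall n, measurable_fun D (F_ n)) -> measurable_fun D F ->
  (forall x, D x -> F_ n x @[n --> \oo] --> F x) ->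
  rintegrable D g -> (forall n x, D x -> `|F_ n x| <= g x) ->
  (\int[mu]_(x in D) F_ n x) @[n --> \oo] --> \int[mu]_(x in D) F x.
Proof.
move=> mD mF_ mF cF gi Fg.
have [|||||iF _ cv] := @dominated_convergence _ _ _ mu D mD (fun n => EFin \o F_ n) (EFin \o F) (EFin \o g).
- by move=> n; exact/measurable_EFinP.
- exact/measurable_EFinP.
- by apply: aeW => x Dx; apply/fine_cvgP; split; [near=> n|exact: cF].
- exact: gi.
- by apply: aeW => x n Dx; rewrite lee_fin; exact: Fg.
apply: fine_cvg; rewrite fineK; first exact: cv.
exact: integrable_fin_num.
Unshelve. all: by end_near. Qed.

Lemma cint_dominated D (F_ : nat -> R -> complex R) (F : R -> complex R) (g : R -> R) : measurable D ->
  (forall n, cintegrable D (F_ n)) -> cintegrable D F ->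
  (forall x, D x -> ccvg (F_ ^~ x) (F x)) ->
  rintegrable D g -> (forall n x, D x -> normc (F_ n x) <= g x) ->
  ccvg (fun n => cint D (F_ n)) (cint D F).
Proof.
move=> mD iF_ iF cF gi Fg; apply: ccvg_ReIm => /=.
  apply: (Rintegral_dominated mD _ _ _ gi).
  - by move=> n; exact: rintegrable_meas (iF_ n).1.
  - exact: rintegrable_meas iF.1.
  - by move=> x Dx; exact: ccvg_Re (cF x Dx).
  - by move=> n x Dx; apply: le_trans (Re_le_normc _) (Fg _ _ Dx).
apply: (Rintegral_dominated mD _ _ _ gi).
- by move=> n; exact: rintegrable_meas (iF_ n).2.
- exact: rintegrable_meas iF.2.
- by move=> x Dx; exact: ccvg_Im (cF x Dx).
- by move=> n x Dx; apply: le_trans (Im_le_normc _) (Fg _ _ Dx).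
Qed.

Lemma cint_split (a b c : R) (F : R -> complex R) : a <= b -> b <= c -> cintegrable `[a, c]%classic F ->
  cint `[a, c] F = cint `[a, b] F + cint `[b, c] F.
Proof.
move=> ab bc [iR iI].
have S (f : R -> R) : rintegrable `[a, c]%classic f ->
    \int[mu]_(x in `[a, c]) f x = \int[mu]_(x in `[a, b]) f x + \int[mu]_(x in `[b, c]) f x.
  move=> fi; have E := @Rintegral_itvB R f (BLeft a) (BRight c) b fi.
  apply/eqP; rewrite addrC -subr_eq; apply/eqP; apply: etrans (E _ _) _; rewrite ?bnd_simp //.
  apply: Rintegral_itv_obnd_cbnd; apply: integrableS fi => //.
  by move=> x; rewrite /= !in_itv /= => /andP[bx ->]; rewrite (le_trans ab (ltW bx)).
by rewrite /cint !S //.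
Qed.

Lemma Re_inv z : complex.Re z^-1 = complex.Re z / (complex.Re z ^+ 2 + complex.Im z ^+ 2).
Proof. by case: z. Qed.

Lemma Im_inv z : complex.Im z^-1 = - (complex.Im z / (complex.Re z ^+ 2 + complex.Im z ^+ 2)).
Proof. by case: z. Qed.

Section Kernel.
Variable u : complex R.
Hypothesis u0 : complex.Im u != 0.

Let den (c : R) : R := (complex.Re u - c) ^+ 2 + complex.Im u ^+ 2.

Let den_gt0 c : 0 < den c.
Proof. by rewrite ltr_wpDl ?sqr_ge0 // exprn_even_gt0. Qed.

Lemma ReK (c : R) : complex.Re (u - c%:C)^-1 = (complex.Re u - c) / den c.
Proof. by rewrite Re_inv Re_sub Im_sub /= subr0. Qed.

Lemma ImK (c : R) : complex.Im (u - c%:C)^-1 = - (complex.Im u / den c).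
Proof. by rewrite Im_inv Re_sub Im_sub /= subr0. Qed.

Let den_derive (c : R) : is_derive c 1 den (- (2 * (complex.Re u - c))).
Proof. rewrite /den; apply: is_derive_eq. rewrite /GRing.scale /=; ring. Qed.

Let den_continuous : continuous den.
Proof. by move=> c; apply: differentiable_continuous; apply/derivable1_diffP; exact: ex_derive. Qed.

Lemma continuous_ReK : continuous (fun c : R => complex.Re (u - c%:C)^-1).
Proof.
under eq_fun do rewrite ReK.
move=> c; apply: cvgM.
  by apply: cvgB; [exact: cvg_cst|exact: cvg_id].
by apply: cvgV; [exact: lt0r_neq0|exact: den_continuous].
Qed.

Lemma continuous_ImK : continuous (fun c : R => complex.Im (u - c%:C)^-1).
Proof.
under eq_fun do rewrite ImK.
move=> c; apply: cvgN; apply: cvgM; first exact: cvg_cst.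
by apply: cvgV; [exact: lt0r_neq0|exact: den_continuous].
Qed.

(** A branch of [- log (u - c)] up to a constant. The arctangent of [(Re u - c) / Im u] is smooth
    along the whole real line, so no cut is met; the price is the constant factor i sgn(Im u) in
    [cexp_primitive], which cancels in [cexp_kernel]. *)
Let primitive (c : R) : complex R :=
  complex.Complex (- (2^-1 * ln (den c))) (atan ((complex.Re u - c) / complex.Im u)).

Let cexp_primitive c : cexp (primitive c) =
  complex.Complex 0 (`|complex.Im u| / complex.Im u) / (u - c%:C).
Proof.
set y := complex.Im u; set t := (complex.Re u - c) / y.
have t2 : 0 < 1 + t ^+ 2 by rewrite ltr_pwDl // sqr_ge0.
have C0 : 0 < cos (atan t) by rewrite cos_atan invr_gt0 sqrtr_gt0.
have C2 : cos (atan t) ^+ 2 = (1 + t ^+ 2)^-1 by rewrite cos_atan exprVn sqr_sqrtr // ltW.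
have St : sin (atan t) = t * cos (atan t).
  by have := atanK t; rewrite /tan => {2}<-; rewrite divfK // gt_eqF.
set E := expR (- (2^-1 * ln (den c))).
have E2 : E ^+ 2 = (den c)^-1.
  rewrite -expRM_natl (_ : 2%:R * - _ = - ln (den c)); last by field.
  by rewrite expRN lnK ?posrE.
have EC : E * cos (atan t) = `|y| / den c.
  have EC0 : 0 <= E * cos (atan t) by rewrite mulr_ge0 ?expR_ge0 // ltW.
  have yd0 : 0 <= `|y| / den c by rewrite divr_ge0 // ltW.
  apply/eqP; rewrite -(eqrXn2 (n := 2) _ EC0 yd0) //.
  rewrite exprMn E2 C2 (expr_div_n `|y|) real_normK ?num_real //.
  have d0 := den_gt0 c; have yy : y != 0 by [].
  rewrite /t; move: (d0); rewrite /den -/y => d1; apply/eqP; field.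
  by rewrite yy !gt_eqF //; move: d1; rewrite addrC.
have yy : y != 0 by [].
apply: complex_eq.
  rewrite [RHS]Re_mul ReK ImK /cexp Re_mul /= -/y -/t -/E !mul0r.
  by rewrite subr0 EC; field; rewrite yy gt_eqF.
rewrite [RHS]Im_mul ReK ImK /cexp Im_mul /= -/y -/t -/E !mul0r.
by rewrite addr0 add0r St mulrCA EC /t; field; rewrite yy gt_eqF.
Qed.

Let Re_primitive (c : R) : is_derive c 1 (fun c => complex.Re (primitive c)) (complex.Re (u - c%:C)^-1).
Proof.
rewrite ReK /=.
have dl := is_derive1_comp (is_derive1_ln (den_gt0 c)) (den_derive c).
have := is_deriveN (is_deriveZ (2^-1 : R) dl); rewrite /GRing.scale /=.
have -> // : - (2^-1 * ((den c)^-1 * - (2 * (complex.Re u - c)))) = (complex.Re u - c) / den c by field; rewrite gt_eqF.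
Qed.

Let Im_primitive (c : R) : is_derive c 1 (fun c => complex.Im (primitive c)) (complex.Im (u - c%:C)^-1).
Proof.
rewrite ImK /=.
have dl : is_derive c 1 (fun c : R => (complex.Re u - c) / complex.Im u) (- (complex.Im u)^-1).
  by apply: is_derive_eq; rewrite /GRing.scale /=; ring.
have := @is_derive1_comp R (@atan R) (fun c => (complex.Re u - c) / complex.Im u) c _ _
  (@is_derive1_atan R ((complex.Re u - c) / complex.Im u)) dl.
have -> // : (1 + ((complex.Re u - c) / complex.Im u) ^+ 2)^-1 * - (complex.Im u)^-1 = - (complex.Im u / den c).
by have := den_gt0 c; rewrite /den => d0; field; rewrite u0 /= gt_eqF.
Qed.

Lemma cexp_kernel a b : a <= b ->
  cexp (- cint `[a, b] (fun c => (u - c%:C)^-1)) = (u - b%:C) / (u - a%:C).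
Proof.
move=> ab.
have -> : cint `[a, b] (fun c => (u - c%:C)^-1) = primitive b - primitive a.
  apply: complex_eq; rewrite ?Re_sub ?Im_sub /=.
    exact: Rintegral_FTC ab continuous_ReK Re_primitive.
  exact: Rintegral_FTC ab continuous_ImK Im_primitive.
have K0 c : u - c%:C != 0.
  by apply: contra_neq u0 => /(congr1 (@complex.Im R)); rewrite Im_sub /= subr0.
have s0 : complex.Complex 0 (`|complex.Im u| / complex.Im u) != 0.
  apply/eqP => /(congr1 (@complex.Im R)) /= /eqP; rewrite mulf_eq0 normr_eq0 invr_eq0.
  by rewrite (negbTE u0).
have Ka := K0 a; have Kb := K0 b.
by rewrite cexpN cexpD cexpN !cexp_primitive; field; rewrite Ka Kb s0.
Qed.

(** The constant is explicit because later dominations must be uniform over families of [u]: the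
    nodes on the imaginary axis, and horizontal segments. *)
Lemma kernel_le c : normc (u - c%:C)^-1 <=
  ((1 + `|complex.Re u|) / `|complex.Im u| + 1) / (1 + `|c|).
Proof.
set y := complex.Im u; have y0 : 0 < `|y| by rewrite normr_gt0.
have Ky : `|y| <= normc (u - c%:C) by have := Im_le_normc (u - c%:C); rewrite Im_sub /= subr0.
have Kx : `|complex.Re u - c| <= normc (u - c%:C) by have := Re_le_normc (u - c%:C); rewrite Re_sub.
have K0 : 0 < normc (u - c%:C) by apply: lt_le_trans Ky.
have c1 : 0 < 1 + `|c| by rewrite ltr_pwDl.
rewrite normcV ler_pdivlMr // -ler_pdivlMl ?invr_gt0 // invrK mulrDr mulr1.
have : 1 + `|complex.Re u| <= normc (u - c%:C) * ((1 + `|complex.Re u|) / `|y|).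
  by rewrite mulrCA ler_peMr ?addr_ge0 // ler_pdivlMr // mul1r.
have : `|c| <= `|complex.Re u| + `|complex.Re u - c|.
  by have := ler_normB (complex.Re u) (complex.Re u - c); rewrite subKr.
by move: Kx; lra.
Qed.

Lemma kernel_bound : exists2 C : R, 0 < C & forall c : R, normc (u - c%:C)^-1 <= C / (1 + `|c|).
Proof.
eexists; last exact: kernel_le.
by rewrite ltr_pwDr // divr_ge0 // addr_ge0.
Qed.

End Kernel.
End CexpKernel.

(** * Measurable densities of profiles *)

Section ProfileDensity.
Context {R : realType}.
Local Notation mu := (@lebesgue_measure R).
Local Notation "x %:C" := (real_complex R x).
Implicit Types (D : set (measurableTypeR R)) (h f g r : R -> R) (u : complex R).

Lemma rintegrable_patch D h : measurable D -> rintegrable D h ->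
  rintegrable setT (fun x => if x \in D then h x else 0).
Proof.
move=> mD hi; rewrite /rintegrable.
rewrite (_ : EFin \o _ = (EFin \o h) \_ D); first exact/(integrable_mkcond _ mD).
by apply/funext => x; rewrite /= patchE; case: ifP.
Qed.

(** With [kernel_bound], the condition under which [h c / (u - c)] is integrable for every non-real
    [u]. *)
Definition weighted h := rintegrable setT (fun c => h c / (1 + `|c|)).

Lemma weight_gt0 (c : R) : 0 < 1 + `|c|.
Proof. by rewrite ltr_pwDl. Qed.
Hint Resolve weight_gt0 : core.

Lemma continuous_weight : continuous (fun c : R => (1 + `|c|)^-1).
Proof.
move=> c; apply: cvgV; first exact: lt0r_neq0.
by apply: cvgD; [exact: cvg_cst|apply: cvg_norm; exact: cvg_id].
Qed.

Lemma measurable_weighted D h : measurable_fun D h -> measurable_fun D (fun c => h c / (1 + `|c|)).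
Proof.
move=> mh; apply: measurable_funM => //; apply: measurable_funTS.
exact: continuous_measurable_fun continuous_weight.
Qed.

Lemma kernel_cintegrable u h : complex.Im u != 0 -> measurable_fun setT h -> weighted h ->
  cintegrable setT (fun c => (h c)%:C / (u - c%:C)).
Proof.
move=> u0 mh wh; have [C C0 uC] := kernel_bound u0.
apply: (@cintegrable_le _ _ _ (fun c => C * `|h c / (1 + `|c|)|)) => //.
- rewrite (_ : (fun c => _) = (fun c => h c * complex.Re (u - c%:C)^-1)).
    apply: measurable_funM => //; apply: continuous_measurable_fun; exact: continuous_ReK.
  by apply/funext => c; rewrite Re_mul /= mul0r subr0.
- rewrite (_ : (fun c => _) = (fun c => h c * complex.Im (u - c%:C)^-1)).
    apply: measurable_funM => //; apply: continuous_measurable_fun; exact: continuous_ImK.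
  by apply/funext => c; rewrite Im_mul /= mul0r addr0.
- move=> c _; rewrite normcM normcR normrM mulrCA ler_wpM2l // normfV (ger0_norm (ltW (weight_gt0 c))); exact: uC.
- have iw : rintegrable setT (fun c => `|h c / (1 + `|c|)|) by have := integrable_norm wh.
  exact: rintegrableZ.
Qed.

(** [shifted_Rayleigh] with a measurable representative [r] of the derivative. *)
Definition Rayleigh_density r (c : R) : R := 2^-1 * (1 + r c) - \1_(`[0%R, +oo[) c.

Lemma Rayleigh_ae g r : {ae mu, forall x, derivable g x 1 /\ derive1 g x = r x} ->
  {ae mu, forall x, shifted_Rayleigh g x = Rayleigh_density r x}.
Proof.
move=> H; apply: (@filterS _ _ (ae_filter_ringOfSetsType mu) _ _ _ H) => x [_ E].
by rewrite /shifted_Rayleigh E.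
Qed.

Lemma T_up_density g r u : {ae mu, forall x, derivable g x 1 /\ derive1 g x = r x} ->
  T_up g u = u^-1 * cexp (- cint setT (fun c => (Rayleigh_density r c)%:C / (u - c%:C))).
Proof.
move=> H; congr (_ * cexp (- _)); apply: cint_ae.
apply: (@filterS _ _ (ae_filter_ringOfSetsType mu) _ _ _ (Rayleigh_ae H)) => x E _.
by rewrite E.
Qed.

Lemma measurable_Rayleigh r : measurable_fun setT r -> measurable_fun setT (Rayleigh_density r).
Proof.
move=> mr; apply: measurable_funB.
  by apply: measurable_funM => //; apply: measurable_funD.
by apply: measurable_indic; exact: measurable_itv.
Qed.

Lemma profile_weighted g r : profile g -> measurable_fun setT r -> (forall x, `|r x| <= 1) ->
  {ae mu, forall x, derivable g x 1 /\ derive1 g x = r x} -> weighted (Rayleigh_density r).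
Proof.
move=> [_ gm gp] mr r1 rae.
have r1' c : - 1 <= r c <= 1 by rewrite -ler_norml.
have aeD D (s : R) : {ae mu, forall x, D x ->
    ((1 + s * derive1 g x) / (1 + `|x|))%:E = ((1 + s * r x) / (1 + `|x|))%:E}.
  by apply: (@filterS _ _ (ae_filter_ringOfSetsType mu) _ _ _ rae) => x [_ ->].
have I D (s : R) : measurable D -> `|s| <= 1 ->
    (\int[mu]_(c in D) ((1 + s * derive1 g c) / (1 + `|c|))%:E < +oo)%E ->
    rintegrable D (fun c => (1 + s * r c) / (1 + `|c|)).
  move=> mD s1 fin; apply/integrableP; split.
    apply/measurable_EFinP; apply: measurable_weighted; apply: measurable_funTS.
    by apply: measurable_funD => //; apply: measurable_funM.
  apply: le_lt_trans fin; rewrite le_eqVlt; apply/orP; left; apply/eqP.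
  rewrite (integral_ae (aeD D s)); apply: eq_integral => c _.
  rewrite gee0_abs // lee_fin divr_ge0 ?(ltW (weight_gt0 c)) //.
  have : `|s * r c| <= 1 by rewrite normrM mulr_ile1.
  by rewrite ler_norml => /andP[]; lra.
have mm : measurable (`]-oo, 0[%classic : set (measurableTypeR R)) by exact: measurable_itv.
have mp : measurable (`[0, +oo[%classic : set (measurableTypeR R)) by exact: measurable_itv.
have Im : rintegrable `]-oo, 0[%classic (fun c => (1 + 1 * r c) / (1 + `|c|)).
  apply: (@integrableS _ _ _ mu `]-oo, 0]%classic) => //.
    by move=> x; rewrite /= !in_itv /=; exact: ltW.
  apply: I; [exact: measurable_itv|by rewrite normr1|].
  by under eq_integral do rewrite mul1r.
have Ip : rintegrable `[0, +oo[%classic (fun c => (1 + (- 1) * r c) / (1 + `|c|)).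
  apply: I; [exact: measurable_itv|by rewrite normrN1|].
  by under eq_integral do rewrite mulN1r.
(* The density is half of [1 + r] on the negative half-line and minus half of [1 - r] on the
   other. *)
have := rintegrableB measurableT (rintegrableZ 2^-1 measurableT (rintegrable_patch mm Im))
  (rintegrableZ 2^-1 measurableT (rintegrable_patch mp Ip)).
congr (rintegrable setT _); apply/funext => c; rewrite /Rayleigh_density indicE.
have -> : (c \in `]-oo, 0[%classic) = (c < 0) by apply/idP/idP; rewrite inE /= in_itv.
have -> : (c \in `[0, +oo[%classic) = (0 <= c) by apply/idP/idP; rewrite inE /= in_itv /= andbT.
have w0 := lt0r_neq0 (weight_gt0 c).
by have [c0|c0] := ltP c 0; rewrite /= ?mul1r ?mulN1r; field.
Qed.

(* The two integral conditions hold as soon as the integrals of [1 + g'] over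
   [[-n, 0]] and of [1 - g'] over [[0, n]] are bounded in [n]. *)
Lemma profile_bounded g (C : R) : 1.-lipschitz g ->
  (forall n : nat, g 0 - g (- n%:R) + n%:R <= C) -> (forall n : nat, n%:R - (g n%:R - g 0) <= C) ->
  profile g.
Proof.
move=> lg gm gp.
have [r [mr r1 rae rE]] := lipschitz_density (lipschitz1P lg).
have aeD D (s : R) : {ae mu, forall x, D x ->
    ((1 + s * derive1 g x) / (1 + `|x|))%:E = ((1 + s * r x) / (1 + `|x|))%:E}.
  by apply: (@filterS _ _ (ae_filter_ringOfSetsType mu) _ _ _ rae) => x [_ ->].
(* [s = 1] serves the negative half-line, [s = - 1] the positive one. The weight is at most 1 and is
   dropped, and monotone convergence passes from the [F n] to their union. *)
have I (s : R) (F : nat -> set (measurableTypeR R)) D : `|s| <= 1 -> measurable D -> D = \bigcup_n F n ->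
    {homo F : n m / (n <= m)%N >-> (n <= m)%O} -> (forall n, measurable (F n)) ->
    (forall n, rintegrable (F n) (fun c => 1 + s * r c)) ->
    (forall n, \int[mu]_(c in F n) (1 + s * r c) <= C) ->
    (\int[mu]_(c in D) ((1 + s * derive1 g c) / (1 + `|c|))%:E < +oo)%E.
  move=> s1 mD DE ndF mF iF FC; rewrite (integral_ae (aeD D s)).
  have pos c : 0 <= 1 + s * r c.
    have : `|s * r c| <= 1 by rewrite normrM mulr_ile1.
    by rewrite ler_norml => /andP[]; lra.
  have mh (A : set (measurableTypeR R)) : measurable_fun A (fun c => 1 + s * r c).
    apply: measurable_funTS.
    by apply: measurable_funD => //; apply: measurable_funM.
  apply: (@le_lt_trans _ _ (\int[mu]_(c in D) (1 + s * r c)%:E)%E).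
    apply: ge0_le_integral => //.
    - by move=> c _; rewrite lee_fin divr_ge0 // ltW.
    - by apply/measurable_EFinP; exact: measurable_weighted.
    - exact/measurable_EFinP.
    - move=> c _; rewrite lee_fin ler_pdivrMr // ler_peMr // lerDl //.
  apply: (@le_lt_trans _ _ C%:E); last exact: ltry.
  have cv : (\int[mu]_(c in F n) (1 + s * r c)%:E)%E @[n --> \oo] -->
      (\int[mu]_(c in \bigcup_n F n) (1 + s * r c)%:E)%E.
    apply: ge0_nondecreasing_set_cvg_integral => //.
    - by move=> n; exact/measurable_EFinP.
    - by move=> n x _; rewrite lee_fin.
  rewrite DE -(cvg_lim _ cv) //; apply: lime_le; first exact: cvgP cv.
  apply: nearW => n; have := FC n; rewrite -lee_fin /Rintegral fineK //.
  exact: integrable_fin_num (iF n).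
have ir (a b : R) : rintegrable `[a, b]%classic r.
  apply: (@rintegrable_le R _ _ (fun=> 1)) => //; first exact: measurable_funTS.
  by apply: rintegrable_continuous; exact: cst_continuous.
have i1 (a b : R) : rintegrable `[a, b]%classic (fun=> 1 : R).
  by apply: rintegrable_continuous; exact: cst_continuous.
have Ji (s a b : R) : rintegrable `[a, b]%classic (fun c => 1 + s * r c).
  by apply: rintegrableD => //; exact: rintegrableZ.
have J (s a b : R) : a <= b -> \int[mu]_(c in `[a, b]) (1 + s * r c) = b - a + s * (g b - g a).
  move=> ab; rewrite RintegralD; [|exact: measurable_itv|exact: i1|exact: rintegrableZ].
  rewrite RintegralZl; last first; [exact: ir|exact: measurable_itv|]; congr (_ + _); last by congr (_ * _); exact: rE.
  have := @Rintegral_FTC R (fun=> 1) (fun x => 1 * x) a b ab (@cst_continuous _ _ _) (is_derive_linear 1).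
  by rewrite !mul1r.
have nat_bound (x : R) : exists n : nat, - n%:R <= x <= n%:R.
  exists (Num.truncn `|x|).+1; have := truncnS_gt `|x|.
  by rewrite ltr_norml => /andP[/ltW -> /ltW ->].
split=> //.
- under eq_integral do rewrite -[derive1 g _]mul1r.
  apply: (I 1 (fun n : nat => `[- n%:R, 0]%classic)); rewrite ?normr1 //.
  + rewrite eqEsubset; split=> x /=; rewrite ?in_itv /=.
      by move=> x0; have [n /andP[nx _]] := nat_bound x; exists n => //=; rewrite in_itv /= x0 nx.
    by case=> n _ /=; rewrite in_itv /= => /andP[].
  + move=> n m nm; apply/subsetPset => x /=; rewrite !in_itv /= => /andP[nx ->]; rewrite andbT.
    by apply: le_trans nx; rewrite lerN2 ler_nat.
  + by move=> n; rewrite J ?oppr_le0 //; have := gm n; lra.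
- under eq_integral do rewrite -mulN1r.
  apply: (I (- 1) (fun n : nat => `[0, n%:R]%classic)); rewrite ?normrN1 //.
  + rewrite eqEsubset; split=> x /=; rewrite ?in_itv /= ?andbT.
      by move=> x0; have [n /andP[_ nx]] := nat_bound x; exists n => //=; rewrite in_itv /= x0 nx.
    by case=> n _ /=; rewrite in_itv /= => /andP[].
  + move=> n m nm; apply/subsetPset => x /=; rewrite !in_itv /= => /andP[-> xn].
    by apply: le_trans xn _; rewrite ler_nat.
  + by move=> n; rewrite J //; have := gp n; lra.
Qed.

End ProfileDensity.

(** * The observable of the zigzag *)

Section ZigzagObservable.
Context {R : realType} (eps : R) (eps_gt0 : 0 < eps).
Local Notation mu := (@lebesgue_measure R).
Local Notation "x %:C" := (real_complex R x).
Local Notation q := (qlim eps_gt0).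
Local Notation pole := (pole eps_gt0).
Local Notation zero := (zero eps_gt0).
Local Notation tterm := (tterm eps_gt0).
Variable f : R -> R.
Hypothesis zf : zigzag eps_gt0 f.

Lemma pole0_ge0 : 0 <= pole 0.
Proof. by rewrite /pole mul0r subr0 qlim_ge0. Qed.

Let contract_from (a : R) := forall x y, a <= x -> x <= y -> - (y - x) <= f y - f x <= y - x.

(** Slopes 1 and -1 propagate the Lipschitz bound leftwards from the ray, one segment at a time; any
    point is reached because there is a pole below it. *)
Let contract_extend a b m k : m = 1 \/ m = - 1 -> b <= a ->
  (forall z, b <= z <= a -> f z = m * z + k) -> contract_from a -> contract_from b.
Proof.
move=> m1 ba fE ca x y bx xy.
have seg s t : b <= s -> s <= t -> t <= a -> - (t - s) <= f t - f s <= t - s.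
  move=> bs st ta; rewrite !fE ?bs ?(le_trans bs st) ?(le_trans st ta) //.
  by case: m1 => ->; lra.
have [ax|/ltW xa] := leP a x; first exact: ca.
have [ya|/ltW ay] := leP y a; first exact: seg.
by have := seg x a bx xa (lexx a); have := ca a y (lexx a) ay; lra.
Qed.

Lemma zigzag_contract x y : `|f x - f y| <= `|x - y|.
Proof.
wlog xy : x y / x <= y => [H|].
  have [/H//|/ltW/H] := leP x y; by rewrite distrC (distrC y).
have H : contract_from (pole (xchoose (poles_below eps_gt0 x))).
  elim: (xchoose _) => [|n IH].
    by move=> s t ps st; rewrite !(zigzag_ray zf) ?(le_trans ps) //; lra.
  apply: (@contract_extend (zero n) _ 1 (2 * n.+1%:R * eps)); first by left.
  - exact: pole_le_zero.
  - by move=> z /(zigzag_up zf) ->; rewrite mul1r.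
  apply: (@contract_extend (pole n) _ (- 1) (2 * q n)) => //; first by right.
  - by rewrite ltW // zero_lt_pole.
  - by move=> z /(zigzag_down zf) ->; rewrite mulN1r.
rewrite distrC (distrC x) ler_norml (ger0_norm (_ : 0 <= y - x)) ?subr_ge0 //.
by apply: H => //; apply: ltW; exact: (xchooseP (poles_below eps_gt0 x)).
Qed.

(** With the constant [f 0], both conditions of [profile_bounded] say that [f c >= |c|] at the
    integers. *)
Lemma zigzag_profile : profile f.
Proof.
apply: (@profile_bounded _ _ (f 0)).
- by move=> [x y] _ /=; rewrite mul1r; exact: zigzag_contract.
- move=> n; have : - n%:R <= pole 0 by apply: le_trans pole0_ge0; rewrite oppr_le0.
  by move=> /(zigzag_left_bound zf) /andP[] + _; lra.
- move=> n; have f1 : f (Num.max n%:R (pole 0)) = Num.max n%:R (pole 0).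
    by rewrite (zigzag_ray zf) // le_max lexx orbT.
  have := zigzag_contract (Num.max n%:R (pole 0)) n%:R; rewrite f1.
  have nm : 0 <= Num.max n%:R (pole 0) - n%:R by rewrite subr_ge0 le_max lexx.
  by rewrite (ger0_norm nm) ler_norml => /andP[]; lra.
Qed.

Lemma cint_patch (D : set (measurableTypeR R)) (F : R -> complex R) :
  cint D F = cint setT (fun x => if x \in D then F x else 0).
Proof.
by rewrite /cint; congr complex.Complex; rewrite /Rintegral integral_mkcond; congr fine;
  apply: eq_integral => x _; rewrite patchE; case: ifP.
Qed.

Lemma cint_point (a : R) (F : R -> complex R) : cint `[a, a] F = 0.
Proof. by rewrite /cint set_itv1 !Rintegral_set1. Qed.

Section Observable.
Variables (r : R -> R) (u : complex R).
Hypotheses (mr : measurable_fun setT r) (r1 : forall x, `|r x| <= 1).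
Hypothesis rae : {ae mu, forall x, derivable f x 1 /\ derive1 f x = r x}.
Hypothesis u0 : complex.Im u != 0.

Lemma zigzag_density_ae : {ae mu, forall c, [/\ pole 0 <= c -> r c = 1,
  forall i, zero i <= c <= pole i -> r c = - 1 & forall i, pole i.+1 <= c <= zero i -> r c = 1]}.
Proof.
have nb : {ae mu, forall c, ~ breaks eps_gt0 c}.
  by apply: negligibleS (breaks_null eps_gt0) => c /= H; apply: contrapT.
apply: (@filterS2 _ _ (ae_filter_ringOfSetsType mu) _ _ _ _ rae nb) => c [_ <-] nc.
have nz i : c != zero i by apply/eqP => ci; apply: nc; right; exists i.
have np i : c != pole i by apply/eqP => ci; apply: nc; left; exists i.
split=> [pc|i /andP[zc cp]|i /andP[pc cz]].
- apply: (@affine_near _ f 1 0 (pole 0) (c + 1) c _ _).2.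
    by rewrite lt_neqAle eq_sym np pc ltrDl /= ltr01.
  by move=> x /andP[px _]; rewrite (zigzag_ray zf) ?mul1r ?addr0.
- apply: (@affine_near _ f (- 1) (2 * q i) (zero i) (pole i) c _ _).2.
    by rewrite !lt_neqAle np cp eq_sym nz zc.
  by move=> x /(zigzag_down zf) ->; rewrite mulN1r.
- apply: (@affine_near _ f 1 (2 * i.+1%:R * eps) (pole i.+1) (zero i) c _ _).2.
    by rewrite !lt_neqAle nz cz eq_sym np pc.
  by move=> x /(zigzag_up zf) ->; rewrite mul1r.
Qed.

Let k (c : R) : complex R := (u - c%:C)^-1.
Let rho (c : R) : R := 2^-1 * (1 + r c).

Lemma kernel_cintegrable_itv (s : R -> R) a b : measurable_fun setT s -> (forall c, `|s c| <= 1) ->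
  cintegrable `[a, b]%classic (fun c => (s c)%:C * k c).
Proof.
move=> ms s1; have [C C0 uC] := kernel_bound u0.
apply: (@cintegrable_le _ _ _ (fun=> C)).
- exact: measurable_itv.
- rewrite (_ : (fun c => _) = (fun c => s c * complex.Re (u - c%:C)^-1)).
    apply: measurable_funTS; apply: measurable_funM => //.
    by apply: continuous_measurable_fun; exact: continuous_ReK.
  by apply/funext => c; rewrite Re_mul /= mul0r subr0.
- rewrite (_ : (fun c => _) = (fun c => s c * complex.Im (u - c%:C)^-1)).
    apply: measurable_funTS; apply: measurable_funM => //.
    by apply: continuous_measurable_fun; exact: continuous_ImK.
  by apply/funext => c; rewrite Im_mul /= mul0r addr0.
- move=> c _; rewrite normcM normcR; apply: (@le_trans _ _ (1 * (C / (1 + `|c|)))).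
    by apply: ler_pM => //; exact: uC.
  by rewrite mul1r ler_pdivrMr ?ltr_pwDl // ler_peMr ?(ltW C0) // lerDl.
- by apply: rintegrable_continuous; exact: cst_continuous.
Qed.

Let mrho : measurable_fun setT rho.
Proof. by apply: measurable_funM => //; apply: measurable_funD. Qed.

Let rho1 c : `|rho c| <= 1.
Proof. by have := r1 c; rewrite /rho !ler_norml => /andP[]; lra. Qed.

(** [rho] is 1 on the ascending segments and 0 on the descending ones. Each ascending segment
    [pole (n+1), zero n] contributes, by [cexp_kernel], the quotient (u - zero n) / (u - pole
    (n+1)), which is [1 + tterm u n]. *)
Lemma cexp_rho n : cexp (- cint `[pole n, pole 0] (fun c => (rho c)%:C * k c)) = cprodn (tterm u) n.
Proof.
elim: n => [|n IH]; first by rewrite cint_point oppr0 cexp0 /cprodn big_ord0.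
have pz := pole_le_zero eps_gt0 n; have zp := ltW (zero_lt_pole eps_gt0 n).
have p0 m : pole m <= pole 0 by case: m => // m; exact/ltW/pole_lt.
rewrite (@cint_split _ _ (zero n)) ?(le_trans zp) //; last exact: kernel_cintegrable_itv.
rewrite (@cint_split _ (zero n) (pole n)) //; last exact: kernel_cintegrable_itv.
have -> : cint `[pole n.+1, zero n] (fun c => (rho c)%:C * k c) = cint `[pole n.+1, zero n] k.
  apply: cint_ae; apply: (@filterS _ _ (ae_filter_ringOfSetsType mu) _ _ _ zigzag_density_ae).
  move=> c [_ _ H] /=; rewrite in_itv /= => /H E.
  by rewrite /rho E (_ : 2^-1 * (1 + 1) = 1) ?mul1r //; field.
have -> : cint `[zero n, pole n] (fun c => (rho c)%:C * k c) = cint `[zero n, pole n] (fun=> 0).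
  apply: cint_ae; apply: (@filterS _ _ (ae_filter_ringOfSetsType mu) _ _ _ zigzag_density_ae).
  move=> c [_ H _] /=; rewrite in_itv /= => /H E.
  by rewrite /rho E subrr mulr0 mul0r.
rewrite cint0 add0r opprD cexpD IH mulrC cprodnS; congr (_ * _).
rewrite cexp_kernel // /tterm.
have up : u - (pole n.+1)%:C != 0 by rewrite subr_eq0; exact: nonreal_not_pole.
have -> : zero n = pole n.+1 + gap eps_gt0 n by rewrite pole_zero subrK.
by rewrite rmorphD /=; field.
Qed.

(** On [pole n, +oo[ the density is [rho] up to [pole 0], minus the indicator of [0, pole 0], since
    [rho] cancels the indicator of the half-line beyond [pole 0]. That correction contributes u / (u
    - pole 0), turning the prefactor 1/u into the first factor of [T]. *)
Lemma zigzag_observable : T_up f u = T eps_gt0 u.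
Proof.
have mh := measurable_Rayleigh mr.
have wh := profile_weighted zigzag_profile mr r1 rae.
set h := Rayleigh_density r in mh wh.
rewrite (T_up_density u rae) -/h.
(* Cutting the density at [pole n] leaves finitely many segments; dominated convergence and
   continuity of [cexp] then let [n] tend to infinity. *)
pose hn n (c : R) : R := if pole n <= c then h c else 0.
have hnE n c : hn n c = h c * \1_(`[pole n, +oo[) c.
  rewrite /hn indicE (_ : (c \in _) = (pole n <= c)); first by case: (_ <= _); rewrite ?mulr1 ?mulr0.
  by apply/idP/idP; rewrite inE /= in_itv /= andbT.
have mhn n : measurable_fun setT (hn n).
  rewrite (_ : hn n = fun c => h c * \1_(`[pole n, +oo[) c); last by apply/funext.
  by apply: measurable_funM => //; apply: measurable_indic; exact: measurable_itv.
have hn_le n c : `|hn n c| <= `|h c| by rewrite /hn; case: ifP => // _; rewrite normr0.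
have whn n : weighted (hn n).
  apply: (@rintegrable_le R _ _ (fun c => `|h c / (1 + `|c|)|)) => //.
  - exact: (measurable_weighted (mhn n)).
  - by move=> c Tc; rewrite [leLHS]normrM [leRHS]normrM ler_wpM2r.
  - by have := integrable_norm wh.
have [C C0 uC] := kernel_bound u0.
have iw : rintegrable setT (fun c => `|h c / (1 + `|c|)|) by have := integrable_norm wh.
have lim : ccvg (fun n => cint setT (fun c => (hn n c)%:C * k c)) (cint setT (fun c => (h c)%:C * k c)).
  apply: (@cint_dominated _ _ _ _ (fun c => C * `|h c / (1 + `|c|)|)) => //.
  - by move=> n; exact: kernel_cintegrable.
  - exact: kernel_cintegrable.
  - move=> c _; have [N Nc] := poles_below eps_gt0 c.
    apply/ccvgP => e e0; near=> n.
    have Nn : (N <= n)%N by near: n; exact: nbhs_infty_ge.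
    have nN : pole n <= pole N by move: Nn; rewrite leq_eqVlt => /predU1P[->//|/(pole_lt eps_gt0)/ltW].
    by rewrite /hn (le_trans nN (ltW Nc)) subrr normc0.
  - exact: rintegrableZ.
  - move=> n c _; rewrite normcM normcR normrM mulrCA ler_pM //.
    rewrite normfV (ger0_norm (_ : 0 <= 1 + `|c|)) ?addr_ge0 //; exact: uC.
have piece n : pole n <= 0 -> cint setT (fun c => (hn n c)%:C * k c) =
    cint `[pole n, pole 0] (fun c => (rho c)%:C * k c) - cint `[0, pole 0] k.
  move=> n0.
  have k1 : k = (fun c => ((fun=> 1) c)%:C * k c) by apply/funext => c; rewrite mul1r.
  have pc (s : R -> R) a b : measurable_fun setT s -> (forall c, `|s c| <= 1) ->
      cintegrable setT (fun c => if c \in `[a, b]%classic then (s c)%:C * k c else 0).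
    move=> ms s1; have [iR iI] := kernel_cintegrable_itv a b ms s1.
    have mI : measurable (`[a, b]%classic : set (measurableTypeR R)) by exact: measurable_itv.
    split; [have := rintegrable_patch mI iR|have := rintegrable_patch mI iI];
      by congr (rintegrable setT _); apply/funext => c; case: ifP.
  rewrite (cint_patch `[pole n, pole 0]%classic) (cint_patch `[0, pole 0]%classic) -cintB //; last 2 first.
  - exact: pc.
  - by rewrite k1; apply: (pc (fun=> 1)) => // c; rewrite normr1.
  apply: cint_ae; apply: (@filterS _ _ (ae_filter_ringOfSetsType mu) _ _ _ zigzag_density_ae).
  move=> c [H _ _] _.
  have -> : (c \in `[pole n, pole 0]%classic) = (pole n <= c <= pole 0).
    by apply/idP/idP; rewrite inE /= in_itv.
  have -> : (c \in `[0, pole 0]%classic) = (0 <= c <= pole 0).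
    by apply/idP/idP; rewrite inE /= in_itv.
  rewrite /hn /h /Rayleigh_density -/(rho c) indicE.
  have -> : (c \in `[0, +oo[%classic) = (0 <= c).
    by apply/idP/idP; rewrite inE /= in_itv /= andbT.
  have [nc|cn] := leP (pole n) c; last first.
    by rewrite /= mul0r leNgt (lt_le_trans cn n0) subrr.
  have [cp|p0c] := leP c (pole 0); rewrite ?andbT ?andbF /=.
    by case: (0 <= c) => /=; rewrite ?subr0 // rmorphB /= mulrBl mul1r.
  rewrite (le_trans pole0_ge0 (ltW p0c)) /rho H ?(ltW p0c) //.
  by rewrite (_ : 2^-1 * (1 + 1) = 1) ?subrr ?mul0r //; field.
have [N N0] := poles_below eps_gt0 0.
have u00 : u != 0 by apply: contra_neq u0 => ->.
have up : u - (pole 0)%:C != 0 by rewrite subr_eq0; exact: nonreal_not_pole.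
have E : cexp (- cint setT (fun c => (h c)%:C * k c)) = cprod (tterm u) * (u / (u - (pole 0)%:C)).
  apply: (@ccvg_unique _ (fun n => cexp (- cint setT (fun c => (hn n c)%:C * k c)))).
    by apply: ccvg_cexp; exact: ccvgN.
  have [d d0 du] := not_pole_dist (nonreal_not_pole eps_gt0 u0).
  have S n : \sum_(i < n) normc (tterm u i) <= q 0%N / d.
    by apply: (@tterm_sum _ _ eps_gt0 u 0) => // j _; exact: du.
  have := ccvgM (cprod_cvg S) (ccvg_cst (u / (u - (pole 0)%:C))).
  move=> /ccvgP H; apply/ccvgP => e e0; near=> n.
  have Nn : (N <= n)%N by near: n; exact: nbhs_infty_ge.
  have nN : pole n <= 0.
    by apply: le_trans (ltW N0); move: Nn; rewrite leq_eqVlt => /predU1P[->//|/(pole_lt eps_gt0)/ltW].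
  rewrite piece // opprB cexpD cexp_rho -[cint `[0, _] _]opprK cexpN cexp_kernel //; last exact: pole0_ge0.
  rewrite subr0 invf_div [_ * cprodn _ _]mulrC.
  by near: n; exact: H.
by rewrite E /T; field; rewrite up u00.
Unshelve. all: by end_near. Qed.

End Observable.
End ZigzagObservable.

(** * Uniqueness *)

Section Poghossian.
Context {R : realType}.
Local Notation "x %:C" := (real_complex R x).
Implicit Types (u z : complex R) (S : complex R -> complex R).

(** Subtracting the two equations gives S1(u) - S2(u) = S1(u) S2(u) (S1(u + eps) - S2(u + eps)).
    Both factors are at most 1/2 in a half-plane preserved by the real shift, so iterating yields
    4^-n. *)
Lemma Poghossian_unique (eps : R) S1 S2 : 0 < eps ->
  Poghossian_eq eps S1 -> asymp_inv S1 -> Poghossian_eq eps S2 -> asymp_inv S2 ->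
  exists2 M : R, 0 < M & forall u, M < complex.Im u -> [/\ S1 u = S2 u & S1 u != 0].
Proof.
move=> eps0 P1 A1 P2 A2.
have half : 0 < 2^-1 :> R by rewrite invr_gt0.
have [M1 H1] := A1 _ half; have [M2 H2] := A2 _ half.
(* For |u| >= 3 and u S(u) within 1/2 of 1, |S(u)| is at most (3/2)/3 = 1/2. *)
pose M := Num.max 3 (Num.max M1 M2).
have near (S : complex R -> complex R) u : 3 <= normc u -> normc (u * S u - 1) < 2^-1 -> normc (S u) <= 2^-1 /\ S u != 0.
  move=> u3 Su; have [S0|S0] := eqVneq (S u) 0.
    by move: Su; rewrite S0 mulr0 sub0r normcNE normc1; lra.
  split=> //; have := normcD_le (u * S u - 1) 1; rewrite subrK normc1 normcM => L.
  have : 3 * normc (S u) <= normc u * normc (S u) by rewrite ler_wpM2r.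
  by lra.
have big u : M < complex.Im u -> [/\ normc (S1 u) <= 2^-1, S1 u != 0, normc (S2 u) <= 2^-1 & S2 u != 0].
  rewrite !gt_max => /and3P[u3 uM1 uM2].
  have u3' : 3 <= normc u by have := Im_le_normc u; have := ler_norm (complex.Im u); lra.
  by have [] := near S1 u u3' (H1 u uM1); have [] := near S2 u u3' (H2 u uM2).
have step u : M < complex.Im u ->
    normc (S1 u - S2 u) <= 4^-1 * normc (S1 (u + eps%:C) - S2 (u + eps%:C)).
  move=> uM; have [a1 n1 a2 n2] := big u uM.
  have u0 : complex.Im u != 0 by rewrite gt_eqF //; apply: lt_trans uM; rewrite lt_max ltr0n.
  have -> : S1 u - S2 u = S1 u * S2 u * (S1 (u + eps%:C) - S2 (u + eps%:C)).
    have E1 : S1 (u + eps%:C) = u - (S1 u)^-1 by apply/eqP; rewrite -subr_eq0 opprB addrCA; apply/eqP; rewrite -[RHS](P1 u u0); ring.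
    have E2 : S2 (u + eps%:C) = u - (S2 u)^-1 by apply/eqP; rewrite -subr_eq0 opprB addrCA; apply/eqP; rewrite -[RHS](P2 u u0); ring.
    by rewrite E1 E2; field; rewrite n1 n2.
  rewrite !normcM ler_wpM2r // (_ : 4^-1 = 2^-1 * 2^-1); first exact: ler_pM.
  by field.
have iter n u : M < complex.Im u -> normc (S1 u - S2 u) <= 4^-1 ^+ n.
  elim: n u => [|n IH] u uM.
    have [a1 _ a2 _] := big u uM; have := normcD_le (S1 u) (- S2 u); rewrite normcNE expr0; lra.
  apply: le_trans (step u uM) _; rewrite exprS ler_wpM2l ?invr_ge0 //; apply: IH.
  by rewrite Im_add /= addr0.
exists M => [|u uM]; first by rewrite lt_max ltr0n.
have [_ n1 _ _] := big u uM; split=> //.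
apply/eqP; rewrite -subr_eq0 -normc_eq0 eq_le normc_ge0 andbT.
have g : (4^-1 ^+ n) @[n --> \oo] --> (0 : R).
  by apply: cvg_expr; rewrite ger0_norm ?invr_ge0 // invf_lt1 // ltr1n.
rewrite -(cvg_lim _ g) //; apply: limr_ge; first exact: cvgP g.
by apply: nearW => n; exact: iter.
Qed.

(** The modulus being below pi, no non-zero multiple of 2 pi i is possible. *)
Lemma cexp_eq1 z : cexp z = 1 -> normc z < 1 -> z = 0.
Proof.
rewrite /cexp => E z1.
have := congr1 (@complex.Im R) E; rewrite Im_mul /= mul0r addr0 => /eqP.
rewrite mulf_eq0 gt_eqF ?expR_gt0 //= => /eqP s0.
have iz : complex.Im z = 0.
  have zi : `|complex.Im z| < pi.
    by apply: le_lt_trans (Im_le_normc _) (lt_le_trans z1 _); have := @pi_ge2 R; lra.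
  apply/eqP; case: (ltgtP (complex.Im z) 0) => // z0; move: zi s0.
  - rewrite ltr0_norm // => zp s0; have : 0 < sin (- complex.Im z) by rewrite sin_gt0_pi // oppr_gt0 z0.
    by rewrite sinN s0 oppr0 ltxx.
  - rewrite gtr0_norm // => zp s0; have : 0 < sin (complex.Im z) by rewrite sin_gt0_pi // z0.
    by rewrite s0 ltxx.
have := congr1 (@complex.Re R) E; rewrite Re_mul /= mul0r subr0 iz cos0 mulr1 => e1.
by apply: complex_eq => //=; apply: expR_inj; rewrite e1 expR0.
Qed.

End Poghossian.

(** * Newton interpolation of a Cauchy transform *)

Section CauchyTransform.
Context {R : realType}.
Local Notation mu := (@lebesgue_measure R).
Local Notation "x %:C" := (real_complex R x).
Implicit Types (u v z : complex R).
Implicit Type (n : nat).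
Variable h : R -> R.
Hypotheses (mh : measurable_fun setT h) (wh : weighted h).

Definition cauchy u := cint setT (fun c => (h c)%:C / (u - c%:C)).

Definition node (n : nat) : complex R := complex.Complex 0 n.+1%:R.

Let abs_weighted : rintegrable setT (fun c => `|h c / (1 + `|c|)|).
Proof. by have := integrable_norm wh. Qed.

Let node_kernel n c : normc (node n - c%:C)^-1 <= 2 / (1 + `|c|).
Proof.
have n0 : complex.Im (node n) != 0 by rewrite /= pnatr_eq0.
apply: le_trans (kernel_le n0 c) _; rewrite ler_wpM2r // ?invr_ge0 ?addr_ge0 //=.
rewrite normr0 addr0 mul1r ger0_norm // -lerBrDr (_ : 2 - 1 = 1); last by ring.
by rewrite invf_le1 // ler1n.
Qed.

Let node_kernel_norm n c : normc (node n - c%:C)^-1 <= n.+1%:R^-1.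
Proof.
rewrite normcV lef_pV2 ?posrE //.
  by have := Im_le_normc (node n - c%:C); rewrite Im_sub /= subr0 ger0_norm.
rewrite normc_gt0; apply/eqP => /(congr1 (@complex.Im R)); rewrite Im_sub /= subr0.
by move/eqP; rewrite pnatr_eq0.
Qed.

Lemma cauchy_vanish : ccvg (fun n => cauchy (node n)) 0.
Proof.
rewrite -(cint0 (setT : set (measurableTypeR R))).
apply: (@cint_dominated _ _ _ _ (fun c => 2 * `|h c / (1 + `|c|)|)) => //.
- by move=> n; apply: kernel_cintegrable => //; rewrite /= pnatr_eq0.
- by split; [exact: integrable0|exact: integrable0].
- move=> c _; apply: (@ccvg_le _ _ _ (fun n => `|h c| * n.+1%:R^-1)).
    have : (`|h c| * n.+1%:R^-1) @[n --> \oo] --> `|h c| * 0.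
      by apply: cvgM; [exact: cvg_cst|exact: cvg_harmonic].
    by rewrite mulr0.
  by apply: nearW => n; rewrite subr0 normcM normcR ler_wpM2l.
- exact: rintegrableZ.
- move=> n c _; rewrite normcM normcR normrM mulrCA ler_pM //.
  rewrite normfV (ger0_norm (_ : 0 <= 1 + `|c|)) ?addr_ge0 //; exact: node_kernel.
Qed.

Let cmeasurable (F : R -> complex R) :=
  measurable_fun setT (fun c => complex.Re (F c)) /\ measurable_fun setT (fun c => complex.Im (F c)).

Let cmeasurableM F K : cmeasurable F -> cmeasurable K -> cmeasurable (fun c => F c * K c).
Proof.
move=> [fr fi] [kr ki]; split.
  rewrite (_ : (fun c => _) = (fun c => complex.Re (F c) * complex.Re (K c) - complex.Im (F c) * complex.Im (K c))).
    by apply: measurable_funB; apply: measurable_funM.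
  by apply/funext => c; rewrite Re_mul.
rewrite (_ : (fun c => _) = (fun c => complex.Re (F c) * complex.Im (K c) + complex.Im (F c) * complex.Re (K c))).
  by apply: measurable_funD; apply: measurable_funM.
by apply/funext => c; rewrite Im_mul.
Qed.

Let cmeasurable_kernel u : complex.Im u != 0 -> cmeasurable (fun c => (u - c%:C)^-1).
Proof.
by move=> u0; split; apply: continuous_measurable_fun; [exact: continuous_ReK|exact: continuous_ImK].
Qed.

Variable N : nat.
Hypothesis cauchy0 : forall n, (N <= n)%N -> cauchy (node n) = 0.

Let nodes k c : complex R := \prod_(i < k) (node (N + i) - c%:C)^-1.

Let node0 n : complex.Im (node n) != 0.
Proof. by rewrite /= pnatr_eq0. Qed.

Let cmeasurable_nodes k : cmeasurable (nodes k).
Proof.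
elim: k => [|k IH].
  by rewrite (_ : nodes 0 = fun=> 1); [split|apply/funext => c; rewrite /nodes big_ord0].
rewrite (_ : nodes k.+1 = fun c => nodes k c * (node (N + k) - c%:C)^-1).
  by apply: cmeasurableM => //; exact: cmeasurable_kernel.
by apply/funext => c; rewrite /nodes big_ord_recr.
Qed.

Let nodes_norm k c : normc (nodes k c) <= \prod_(i < k) (N + i).+1%:R^-1.
Proof.
by rewrite /nodes normc_prod; apply: ler_prod => i _; rewrite normc_ge0 node_kernel_norm.
Qed.

Let term k u c : complex R := (h c)%:C * nodes k c * (u - c%:C)^-1.

Let term_norm k u (C : R) c : normc (u - c%:C)^-1 <= C / (1 + `|c|) ->
  normc (term k u c) <= (\prod_(i < k) (N + i).+1%:R^-1 * C) * `|h c / (1 + `|c|)|.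
Proof.
move=> uC; rewrite /term !normcM normcR normrM normfV (ger0_norm (_ : 0 <= 1 + `|c|)) ?addr_ge0 //.
apply: (@le_trans _ _ (`|h c| * (\prod_(i < k) (N + i).+1%:R^-1) * (C / (1 + `|c|)))).
  by apply: ler_pM; rewrite ?mulr_ge0 // ler_wpM2l.
by rewrite le_eqVlt; apply/orP; left; apply/eqP; ring.
Qed.

Let term_cintegrable k u : complex.Im u != 0 -> cintegrable setT (term k u).
Proof.
move=> u0; have [C C0 uC] := kernel_bound u0.
have [m1 m2] : cmeasurable (term k u).
  apply: cmeasurableM; last exact: cmeasurable_kernel.
  by apply: cmeasurableM => //; split.
apply: (@cintegrable_le _ _ _ (fun c => (\prod_(i < k) (N + i).+1%:R^-1 * C) * `|h c / (1 + `|c|)|)) => //.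
  by move=> c _; exact: term_norm.
exact: rintegrableZ.
Qed.

Let nonreal_sub0 u c : complex.Im u != 0 -> u - c%:C != 0.
Proof. by apply: contra_neq => /(congr1 (@complex.Im R)); rewrite Im_sub /= subr0. Qed.

(* Newton interpolation of the Cauchy kernel at the nodes:
   [1 / (u - c) = 1 / (w - c) + (w - u) / ((w - c) (u - c))]. *)
Let term_rec k u : complex.Im u != 0 ->
  cint setT (term k u) = cint setT (term k (node (N + k))) + (node (N + k) - u) * cint setT (term k.+1 u).
Proof.
move=> u0; have nk := node0 (N + k).
rewrite -cintZ //; last exact: term_cintegrable.
rewrite -cintD //; [|exact: term_cintegrable|by apply: cintegrableZ => //; exact: term_cintegrable].
apply: eq_cint => c _; rewrite /term /nodes big_ord_recr /=.
by field; rewrite !nonreal_sub0.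
Qed.

(** These integrals are divided differences of the transform at the nodes. In [term_rec] at the node
    [N + j] with [j > k], both integrals with [k] factors vanish, while the difference of the two
    nodes does not. *)
Let term_node k j : (k <= j)%N -> cint setT (term k (node (N + j))) = 0.
Proof.
elim: k j => [|k IH] j kj.
  rewrite -(cauchy0 (leq_addr j N)); apply: eq_cint => c _.
  by rewrite /term /nodes big_ord0 mulr1.
have := term_rec k (node0 (N + j)); rewrite !IH // ?(ltnW kj) // add0r => /esym/eqP.
rewrite mulf_eq0 => /orP[|/eqP//].
rewrite subr_eq0 => /eqP/(congr1 (@complex.Im R)) /= /eqP; rewrite eqr_nat eqSS eqn_add2l => /eqP kj'.
by move: kj; rewrite -kj' ltnn.
Qed.

Let cauchy_newton n u : complex.Im u != 0 ->
  cauchy u = (\prod_(k < n) (node (N + k) - u)) * cint setT (term n u).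
Proof.
move=> u0; elim: n => [|n IH].
  by rewrite big_ord0 mul1r; apply: eq_cint => c _; rewrite /term /nodes big_ord0 mulr1.
by rewrite IH (term_rec _ u0) term_node // add0r big_ord_recr /= mulrA.
Qed.

(** With M = N + k + 1 and y = Im u, the squared factor is 1 - 2y/M + |u|^2/M^2 <= 1 - y/M <= exp(-
    y/M). Its power p, where p y >= 1, is at most exp(- 1/M) <= M/(M + 1), and these bounds
    telescope. Divergence of the harmonic series, that is failure of the Blaschke condition at the
    nodes, is what makes the interpolation work. *)
Let ratio_le u k (p : nat) : 0 < complex.Im u -> normc u ^+ 2 <= complex.Im u * N.+1%:R ->
  1 <= p%:R * complex.Im u ->
  (normc (node (N + k) - u) * (N + k).+1%:R^-1) ^+ (2 * p) <= (N + k).+1%:R / (N + k).+2%:R.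
Proof.
set y := complex.Im u => y0 uN py; set M : R := (N + k).+1%:R.
have M0 : 0 < M by rewrite ltr0n.
have sq : (normc (node (N + k) - u) * M^-1) ^+ 2 <= 1 - y / M.
  rewrite exprMn normc_sqr Re_sub Im_sub /= -/M -/y exprVn ler_pdivrMr ?exprn_gt0 //.
  have -> : (1 - y / M) * M ^+ 2 = M ^+ 2 - y * M by field; rewrite gt_eqF.
  move: uN; rewrite normc_sqr -/y => uN.
  have : y * N.+1%:R <= y * M by rewrite ler_wpM2l ?(ltW y0) // ler_nat ltnS leq_addr.
  rewrite sub0r sqrrN; lra.
have /= e1 := expR_ge1Dx (- (y / M)).
have e2 := expR_ge1Dx M^-1.
rewrite exprM; apply: (@le_trans _ _ (expR (- (y / M)) ^+ p)).
  by rewrite lerXn2r ?nnegrE ?exprn_ge0 ?expR_ge0 ?mulr_ge0 ?invr_ge0 ?(ltW M0) //; apply: le_trans sq _.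
rewrite -expRM_natl; apply: (@le_trans _ _ (expR (- M^-1))).
  rewrite ler_expR mulrN lerN2 mulrA ler_pdivlMr // mulVf ?gt_eqF //.
rewrite expRN -[leRHS]invf_div lef_pV2 ?posrE ?expR_gt0 ?divr_gt0 ?ltr0n //.
by apply: le_trans e2; rewrite -natr1 -/M mulrDl divff ?gt_eqF // mul1r.
Qed.

Let prod_ratio n : \prod_(k < n) ((N + k).+1%:R / (N + k).+2%:R) = N.+1%:R / (N + n).+1%:R :> R.
Proof.
elim: n => [|n IH]; first by rewrite big_ord0 addn0 divff ?pnatr_eq0.
by rewrite big_ord_recr /= IH addnS mulrA divfK ?pnatr_eq0.
Qed.

(** The remainder of Newton's formula, raised to the power 2p, gives |I|^(2p) (N + n + 1) <= B^(2p)
    (N + 1) for all n, where I is the transform at u and B does not depend on n. The condition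
    linking u and N is met afterwards by enlarging N. *)
Lemma cauchy_eq0_node u : 0 < complex.Im u -> normc u ^+ 2 <= complex.Im u * N.+1%:R -> cauchy u = 0.
Proof.
move=> y0 uN; have u0 : complex.Im u != 0 by rewrite gt_eqF.
have [C C0 uC] := kernel_bound u0.
have [B B0 P_le] : exists2 B, 0 <= B & forall n, normc (cauchy u) <=
    (\prod_(k < n) (normc (node (N + k) - u) * (N + k).+1%:R^-1)) * B.
  exists (2 * (C * \int[mu]_(c in setT) `|h c / (1 + `|c|)|)).
    by rewrite !mulr_ge0 ?(ltW C0) //; apply: Rintegral_ge0.
  move=> n; rewrite (cauchy_newton n u0) normcM normc_prod big_split /= -mulrA ler_wpM2l ?prodr_ge0 //.
  apply: le_trans (cint_normc_le measurableT (term_cintegrable n u0) _ (fun c _ => term_norm n (uC c))) _.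
    exact: rintegrableZ.
  rewrite RintegralZl //; rewrite le_eqVlt; apply/orP; left; apply/eqP; ring.
have [p py] : exists p : nat, 1 <= p%:R * complex.Im u.
  exists (Num.truncn (complex.Im u)^-1).+1; rewrite -ler_pdivrMr // mul1r ltW //; exact: truncnS_gt.
have A_le n : normc (cauchy u) ^+ (2 * p) * (N + n).+1%:R <= B ^+ (2 * p) * N.+1%:R.
  have P0 : 0 <= \prod_(k < n) (normc (node (N + k) - u) * (N + k).+1%:R^-1).
    by apply: prodr_ge0 => k _; rewrite mulr_ge0.
  rewrite -ler_pdivlMr ?ltr0n //; apply: (@le_trans _ _ ((\prod_(k < n) (normc (node (N + k) - u) * (N + k).+1%:R^-1) * B) ^+ (2 * p))).
    by rewrite lerXn2r ?nnegrE ?(mulr_ge0 P0 B0).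
  rewrite exprMn mulrC -mulrA ler_wpM2l ?exprn_ge0 // -prod_ratio -prodrXl.
  by apply: ler_prod => k _; rewrite exprn_ge0 ?mulr_ge0 //=; exact: ratio_le.
apply/eqP; rewrite -normc_eq0 eq_le normc_ge0 andbT leNgt; apply/negP => A0.
have A2 : 0 < normc (cauchy u) ^+ (2 * p) by rewrite exprn_gt0.
pose n := Num.truncn (B ^+ (2 * p) * N.+1%:R / normc (cauchy u) ^+ (2 * p)).
have := A_le n; rewrite mulrC -ler_pdivlMr // leNgt => /negP; apply.
by apply: lt_le_trans (truncnS_gt _) _; rewrite ler_nat ltnS leq_addl.
Qed.

End CauchyTransform.

Section AtanKernel.
Context {R : realType}.
Implicit Types (a b c s t y : R).

Let atan_lip s t : s <= t -> 0 <= atan t - atan s /\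
  (0 < s -> atan t - atan s <= (t - s) / (2 * s)).
Proof.
rewrite le_eqVlt => /predU1P[->|st]; first by rewrite !subrr mul0r lexx.
have cat : {within `[s, t], continuous (@atan R)}.
  by apply: continuous_subspaceT => x; exact: continuous_atan.
have [x] := @MVT R atan (fun x => (1 + x ^+ 2)^-1) s t st (fun x _ => is_derive1_atan x) cat.
rewrite in_itv /= => /andP[sx xt] ->; split.
  by rewrite mulr_ge0 ?subr_ge0 ?(ltW st) // invr_ge0 addr_ge0 ?sqr_ge0.
move=> s0; rewrite mulrC ler_pM2l ?subr_gt0 // lef_pV2 ?posrE ?mulr_gt0 //; last by rewrite ltr_pwDl ?sqr_ge0.
(* 1 + x^2 >= 2x >= 2s bounds the derivative of the arctangent on [s, t]. *)
have : 0 <= (x - 1) ^+ 2 by exact: sqr_ge0.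
rewrite sqrrB mulr1 expr1n; lra.
Qed.

(** The bound must be uniform in [y] for the limit [y -> 0]. For [c] near [a, b] the difference is
    at most pi; far away the mean value theorem is scale invariant, and [y] cancels. *)
Lemma atan_window_le a b : a <= b -> exists2 K, 0 < K & forall c y, 0 < y ->
  `|atan ((b - c) / y) - atan ((a - c) / y)| <= K / (1 + `|c|).
Proof.
move=> ab; set L := 2 + `|a| + `|b|; have L0 : 0 < L by rewrite /L -addrA ltr_pwDl ?addr_ge0.
exists (2 * pi * L + (b - a) * L).
  by rewrite ltr_pwDl ?mulr_gt0 ?pi_gt0 // mulr_ge0 ?subr_ge0 // ltW.
move=> c y y0; have c0 : 0 < 1 + `|c| by rewrite ltr_pwDl.
have c1 := ltW c0.
have ba0 : 0 <= b - a by rewrite subr_ge0.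
have acy : (a - c) / y <= (b - c) / y by rewrite ler_pM2r ?invr_gt0 // lerB.
have [d0 _] := atan_lip acy; rewrite ger0_norm // ler_pdivlMr //.
have piL : 0 <= pi * L by rewrite mulr_ge0 ?pi_ge0 // ltW.
have bL : 0 <= (b - a) * L by rewrite mulr_ge0 // ltW.
(* Here [s] is the distance from [c] to the nearer endpoint and [t] to the farther one; the case of
   [c] to the right of the interval is brought to this form by oddness of the arctangent. *)
have far s t : 0 < s -> s <= t -> t - s = b - a -> 1 + `|c| <= s * L ->
    (atan (t / y) - atan (s / y)) * (1 + `|c|) <= (b - a) * L.
  move=> s0 st E cs; have sty : s / y <= t / y by rewrite ler_pM2r ?invr_gt0.
  have sy : 0 < s / y by rewrite divr_gt0.
  have [e0 /(_ sy) e1] := atan_lip sty.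
  apply: (@le_trans _ _ ((b - a) / (2 * s) * (s * L))).
    apply: ler_pM => //.
    apply: le_trans e1 _; rewrite -mulrBl E le_eqVlt; apply/orP; left; apply/eqP.
    by field; rewrite !gt_eqF.
  have -> : (b - a) / (2 * s) * (s * L) = (b - a) * L / 2 by field; rewrite gt_eqF.
  by rewrite ler_pdivrMr //; lra.
have near s (d : R) : 1 <= s -> `|d| + s >= `|c| -> `|d| = `|a| \/ `|d| = `|b| -> 1 + `|c| <= s * L.
  move=> s1 ds dE; have sa : `|a| <= s * `|a| by rewrite ler_peMl.
  have sb : `|b| <= s * `|b| by rewrite ler_peMl.
  have := normr_ge0 a; have := normr_ge0 b; rewrite /L !mulrDr.
  by case: dE => dE; rewrite dE in ds; lra.
have [ca|ac] := ltP c (a - 1).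
  apply: (@le_trans _ _ ((b - a) * L)); last by rewrite -mulrA; lra.
  apply: far; [lra|lra|ring|]; apply: (near _ a); [lra| |by left].
  by have := ler_normB a (a - c); rewrite subKr (ger0_norm (_ : 0 <= a - c)) //; lra.
have [bc|cb] := ltP (b + 1) c.
  apply: (@le_trans _ _ ((b - a) * L)); last by rewrite -mulrA; lra.
  rewrite -(opprB c b) -(opprB c a) !mulNr !atanN opprK addrC.
  apply: far; [lra|lra|ring|]; apply: (near _ b); [lra| |by right].
  by have := ler_normD b (c - b); rewrite subrKC (ger0_norm (_ : 0 <= c - b)) //; lra.
apply: (@le_trans _ _ (pi * (2 * L))); last by rewrite mulrCA -!mulrA; lra.
apply: ler_pM => //.
  by have := atan_ltpi2 ((b - c) / y); have := atan_gtNpi2 ((a - c) / y); lra.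
have : `|c| <= `|a| + `|b| + 1.
  by rewrite ler_norml; have := ler_norm b; have := ler_norm (- a); rewrite normrN => nna; have := normr_ge0 a; have := normr_ge0 b; lra.
by rewrite /L; have := normr_ge0 a; have := normr_ge0 b; lra.
Qed.

End AtanKernel.

(** * Inversion of the Cauchy transform *)

Section PoissonWindow.
Context {R : realType}.
Local Notation mu := (@lebesgue_measure R).
Local Notation "x %:C" := (real_complex R x).
Implicit Types (a b c x y : R) (u : complex R).
Variable h : R -> R.
Hypotheses (mh : measurable_fun setT h) (wh : weighted h).

Lemma cauchy_eq0 (N : nat) u : (forall n, (N <= n)%N -> cauchy h (node n) = 0) ->
  0 < complex.Im u -> cauchy h u = 0.
Proof.
move=> h0 u0; pose M := maxn N (Num.truncn (normc u ^+ 2 / complex.Im u)).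
apply: (@cauchy_eq0_node _ _ mh wh M) => // [n|].
  by rewrite geq_max => /andP[/h0].
rewrite mulrC -ler_pdivrMr // ltW //; apply: lt_le_trans (truncnS_gt _) _.
by rewrite ler_nat ltnS leq_maxr.
Qed.

Hypothesis cauchy0 : forall u, 0 < complex.Im u -> cauchy h u = 0.

(** The Poisson kernel [y / ((x - c)^2 + y^2)], which is minus the imaginary part of 1/(x + iy - c),
    integrated in [x] from [a] to [b]. *)
Let window a b y c := atan ((b - c) / y) - atan ((a - c) / y).

Let abs_weighted : rintegrable setT (fun c => `|h c / (1 + `|c|)|).
Proof. by have := integrable_norm wh. Qed.

Let window_le a b : exists2 K, 0 < K & forall c y, 0 < y -> `|window a b y c| <= K / (1 + `|c|).
Proof.
have [/atan_window_le//|/ltW/atan_window_le[K K0 H]] := leP a b.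
by exists K => // c y y0; rewrite distrC; exact: H.
Qed.

Let window_continuous a b y : continuous (window a b y).
Proof.
have H s : continuous (fun c => atan ((s - c) / y)).
  move=> c; apply: (@continuous_comp R R R (fun c => (s - c) / y) atan); last exact: continuous_atan.
  by apply: cvgM; [apply: cvgB; [exact: cvg_cst|exact: cvg_id]|exact: cvg_cst].
by move=> c; apply: cvgB; exact: H.
Qed.

Let window_term_le K w c : `|w| <= K / (1 + `|c|) -> `|h c * w| <= K * `|h c / (1 + `|c|)|.
Proof.
move=> wK; rewrite !normrM mulrCA ler_wpM2l // normfV (ger0_norm (_ : 0 <= 1 + `|c|)) //.
Qed.

Let window_measurable a b y : measurable_fun setT (fun c => h c * window a b y c).
Proof. by apply: measurable_funM => //; exact: continuous_measurable_fun. Qed.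

Let window_integrable a b y : 0 < y -> rintegrable setT (fun c => h c * window a b y c).
Proof.
move=> y0; have [K K0 HK] := window_le a b.
apply: (@rintegrable_le R _ _ (fun c => K * `|h c / (1 + `|c|)|)) => //.
- exact: window_measurable.
- by move=> c Tc; apply: window_term_le; exact: HK.
- exact: rintegrableZ.
Qed.

Let point x y : complex R := complex.Complex x y.

Let window_derive a y x c : 0 < y ->
  is_derive x 1 (fun x => h c * window a x y c) (h c * - complex.Im (point x y - c%:C)^-1).
Proof.
move=> y0; have u0 : complex.Im (point x y) != 0 by rewrite gt_eqF.
have d1 : is_derive x 1 (fun x => (x - c) / y) y^-1.
  by apply: is_derive_eq; rewrite /GRing.scale /=; ring.
have d2 := @is_derive1_comp R (@atan R) (fun x => (x - c) / y) x _ _ (@is_derive1_atan R ((x - c) / y)) d1.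
have d3 := is_deriveZ (h c) (is_deriveB d2 (is_derive_cst (atan ((a - c) / y)) x 1)).
rewrite ImK; apply: is_derive_eq d3 _; rewrite /GRing.scale /= subr0 opprK; congr (_ * _).
have yy : (x - c) ^+ 2 + y ^+ 2 != 0.
  by rewrite gt_eqF // ltr_wpDl ?sqr_ge0 // exprn_gt0.
by field; rewrite yy gt_eqF //= ?andbT.
Qed.

(** As a function of the endpoint [b], the integral vanishes at [b = a] and has derivative minus the
    imaginary part of the transform at [b + iy], which is 0. Differentiation under the integral sign
    takes the place of Fubini's theorem. *)
Let window0 a b y : 0 < y -> \int[mu]_(c in setT) (h c * window a b y c) = 0.
Proof.
move=> y0; pose F x := \int[mu]_(c in setT) (h c * window a x y c).
have Fa : F a = 0.
  rewrite /F (_ : (fun c => _) = (fun=> 0)); first by rewrite /Rintegral integral0.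
  by apply/funext => c; rewrite /window subrr mulr0.
rewrite -Fa; apply: is_derive_0_is_cst => x.
have KC : exists2 C, 0 < C & forall z c, `]x - 1, x + 1[%classic z ->
    normc (point z y - c%:C)^-1 <= C / (1 + `|c|).
  exists ((2 + `|x|) / y + 1) => [|z c].
    by rewrite ltr_pwDr // divr_ge0 ?(ltW y0) // addr_ge0.
  rewrite /= in_itv /= => /andP[z1 z2]; have u0 : complex.Im (point z y) != 0 by rewrite gt_eqF.
  apply: le_trans (kernel_le u0 c) _; rewrite ler_wpM2r ?invr_ge0 ?addr_ge0 //= lerD2r.
  rewrite (gtr0_norm y0) ler_wpM2r ?invr_ge0 ?(ltW y0) //.
  have : `|z| <= `|x| + 1; last by lra.
  have := ler_normD x (z - x); rewrite subrKC => /le_trans; apply.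
  by rewrite lerD2l ler_norml; lra.
have [C C0 HC] := KC.
have p1 z c : partial1of2 (fun x c => h c * window a x y c) z c =
    h c * - complex.Im (point z y - c%:C)^-1.
  by rewrite /partial1of2 derive1E; have d := window_derive a z c y0; rewrite derive_val.
have Ix : (`]x - 1, x + 1[%classic : set R) x by rewrite /= in_itv /=; lra.
have iG : rintegrable setT (fun c => C * `|h c / (1 + `|c|)|) by exact: rintegrableZ.
have bound z c : `]x - 1, x + 1[%classic z -> setT c ->
    `|partial1of2 (fun x c => h c * window a x y c) z c| <= C * `|h c / (1 + `|c|)|.
  move=> Iz _; rewrite p1; apply: window_term_le; rewrite normrN.
  by apply: le_trans (Im_le_normc _) (HC _ _ Iz).
have G0 c : 0 <= C * `|h c / (1 + `|c|)| by rewrite mulr_ge0 // ltW.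
have inth z : `]x - 1, x + 1[%classic z -> mu.-integrable setT (EFin \o (fun c => h c * window a z y c)).
  by move=> _; exact: window_integrable.
have der z c : `]x - 1, x + 1[%classic z -> setT c -> derivable ((fun x c => h c * window a x y c) ^~ c) z 1.
  by move=> _ _; have d := window_derive a z c y0; exact: ex_derive.
split.
  exact: (derivable_under_integral measurableT Ix inth der G0 iG bound).
rewrite -derive1E (differentiation_under_integral measurableT Ix inth der G0 iG bound).
have E : \int[mu]_(c in setT) complex.Im ((h c)%:C / (point x y - c%:C)) = 0.
  have := congr1 (@complex.Im R) (@cauchy0 (point x y) y0); exact.
have u0 : complex.Im (point x y) != 0 by rewrite gt_eqF.
apply: etrans (_ : \int[mu]_(c in setT) (- 1 * complex.Im ((h c)%:C / (point x y - c%:C))) = 0).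
  by apply: eq_Rintegral => c _; rewrite p1 [in RHS]Im_mul mul0r addr0 mulrN mulN1r.
rewrite RintegralZl //; first by rewrite E mulr0.
exact: (kernel_cintegrable u0 mh wh).2.
Qed.

Let scaled_atan_cvg (t : R) : atan (t / n.+1%:R^-1) @[n --> \oo] --> pi / 2 * Num.sg t.
Proof.
have pos (s : R) : 0 < s -> atan (s / n.+1%:R^-1) @[n --> \oo] --> pi / 2.
  move=> s0; apply: (@cvg_comp _ _ _ (fun n : nat => s / n.+1%:R^-1) (@atan R) \oo +oo); last exact: cvgy_atan.
  apply/cvgryPge => A; near=> n; rewrite invrK -ler_pdivrMl //; apply: ltW.
  apply: (@lt_le_trans _ _ (Num.truncn (s^-1 * A)).+1%:R); first exact: truncnS_gt.
  by rewrite ler_nat ltnS; near: n; exact: nbhs_infty_ge.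
have [t0|t0|->] := ltgtP t 0.
- rewrite ltr0_sg // mulrN1.
  rewrite (_ : (fun n => _) = (fun n : nat => - atan (- t / n.+1%:R^-1))).
    by apply: cvgN; apply: pos; rewrite oppr_gt0.
  by apply/funext => n; rewrite mulNr atanN opprK.
- by rewrite gtr0_sg // mulr1; exact: pos.
- rewrite sgr0 mulr0; under eq_fun do rewrite mul0r atan0; exact: cvg_cst.
Unshelve. all: by end_near. Qed.

(** As [y] tends to 0, the window tends to pi times the indicator of [a, b] except at the two
    endpoints, where a sign vanishes; these form a null set. *)
Lemma cauchy0_integral a b : a < b -> rintegrable `[a, b]%classic h -> \int[mu]_(c in `[a, b]) h c = 0.
Proof.
move=> ab ih; have [K K0 HK] := window_le a b.
have lim : (\int[mu]_(c in setT) (h c * window a b n.+1%:R^-1 c)) @[n --> \oo] -->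
    \int[mu]_(c in setT) (h c * (pi / 2 * Num.sg (b - c) - pi / 2 * Num.sg (a - c))).
  have cv c : (h c * window a b n.+1%:R^-1 c) @[n --> \oo] -->
      h c * (pi / 2 * Num.sg (b - c) - pi / 2 * Num.sg (a - c)).
    by apply: cvgM; [exact: cvg_cst|apply: cvgB; exact: scaled_atan_cvg].
  apply: (@Rintegral_dominated _ _ _ _ (fun c => K * `|h c / (1 + `|c|)|)).
  - exact: measurableT.
  - by move=> n; exact: window_measurable.
  - apply: (@measurable_fun_cvg _ _ _ _ (fun n c => h c * window a b n.+1%:R^-1 c)).
      by move=> n; exact: window_measurable.
    by move=> c Tc; exact: cv.
  - by move=> c Tc; exact: cv.
  - exact: rintegrableZ.
  - by move=> n c Tc; apply: window_term_le; apply: HK.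
have lim0 : \int[mu]_(c in setT) (h c * (pi / 2 * Num.sg (b - c) - pi / 2 * Num.sg (a - c))) = 0.
  rewrite -(cvg_lim _ lim) // (_ : (fun n => _) = (fun=> 0)); first exact: lim_cst.
  by apply/funext => n; exact: window0.
have mI : measurable (`[a, b]%classic : set (measurableTypeR R)) by exact: measurable_itv.
have : pi * \int[mu]_(c in `[a, b]) h c = 0.
  rewrite -[RHS]lim0 -RintegralZl // /Rintegral integral_mkcond; congr fine; apply: integral_ae.
  have ae x : {ae mu, forall c, c != x}.
    exists [set x]; split=> //; first exact: lebesgue_measure_set1.
    by move=> c /= /negP; rewrite negbK => /eqP.
  apply: (@filterS2 _ _ (ae_filter_ringOfSetsType mu) _ _ _ _ (ae a) (ae b)) => c ca cb _.
  rewrite patchE (_ : (c \in _) = (a <= c <= b)); last by apply/idP/idP; rewrite inE /= in_itv.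
  case: (ltgtP a c) ca => // ac _; case: (ltgtP c b) cb => // cb' _ /=.
  - have [s1 s2] : 0 < b - c /\ a - c < 0 by split; lra.
    by rewrite (gtr0_sg s1) (ltr0_sg s2) mulr1 mulrN1 opprK -splitr mulrC.
  - have [s1 s2] : b - c < 0 /\ a - c < 0 by split; lra.
    by rewrite (ltr0_sg s1) (ltr0_sg s2) subrr mulr0.
  - have [s1 s2] : 0 < b - c /\ 0 < a - c by split; lra.
    by rewrite (gtr0_sg s1) (gtr0_sg s2) subrr mulr0.
  - by exfalso; lra.
by move/eqP; rewrite mulf_eq0 gt_eqF ?pi_gt0 //= => /eqP.
Qed.

End PoissonWindow.

Section Uniqueness.
Context {R : realType}.
Local Notation mu := (@lebesgue_measure R).
Local Notation "x %:C" := (real_complex R x).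
Implicit Types (f g : R -> R) (u : complex R).

(** [T_up] depends on a profile only through its derivative, so an additive constant remains
    free. *)
Lemma profile_unique (eps : R) f g : 0 < eps -> profile f -> profile g ->
  Poghossian_eq eps (T_up f) -> asymp_inv (T_up f) ->
  Poghossian_eq eps (T_up g) -> asymp_inv (T_up g) ->
  exists k : R, forall c, g c = f c + k.
Proof.
move=> eps0 pf pg Pf Af Pg Ag.
have [lf lg] : 1.-lipschitz f /\ 1.-lipschitz g by case: pf; case: pg.
have [r [mr r1 rae rE]] := lipschitz_density (lipschitz1P lf).
have [s [ms s1 sae sE]] := lipschitz_density (lipschitz1P lg).
have wr := profile_weighted pf mr r1 rae; have ws := profile_weighted pg ms s1 sae.
pose h c := 2^-1 * (s c - r c).
have hE c : h c = Rayleigh_density s c - Rayleigh_density r c by rewrite /h /Rayleigh_density; ring.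
have mh : measurable_fun setT h by apply: measurable_funM => //; apply: measurable_funB.
have wh : weighted h.
  have := rintegrableB measurableT ws wr; congr (rintegrable setT _).
  by apply/funext => c; rewrite hE -mulrBl.
have [M M0 HM] := Poghossian_unique eps0 Pf Af Pg Ag.
have c1 u : M < complex.Im u -> cexp (cauchy h u) = 1.
  move=> uM; have u0 : complex.Im u != 0 by rewrite gt_eqF // (lt_trans M0).
  have [E T0] := HM u uM; move: E T0.
  rewrite (T_up_density u rae) (T_up_density u sae) mulf_eq0 invr_eq0 negb_or => E /andP[uu e0].
  have {}E := mulfI (invr_neq0 uu) E.
  have -> : cauchy h u = cauchy (Rayleigh_density s) u - cauchy (Rayleigh_density r) u.
    rewrite -cintB; last 3 first.
    - exact: measurableT.
    - by apply: kernel_cintegrable => //; exact: measurable_Rayleigh.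
    - by apply: kernel_cintegrable => //; exact: measurable_Rayleigh.
    by apply: eq_cint => c _; rewrite hE rmorphB mulrBl.
  by rewrite cexpD E -cexpD subrr cexp0.
have [N HN] : exists N : nat, forall n, (N <= n)%N -> cauchy h (node n) = 0.
  have /ccvgP /(_ 1 ltr01) [N _ HN] := cauchy_vanish mh wh.
  exists (maxn N (Num.truncn M)) => n; rewrite geq_max => /andP[Nn Mn].
  apply: cexp_eq1; last by have := HN n Nn; rewrite subr0.
  by apply: c1; apply: lt_le_trans (truncnS_gt _) _; rewrite ler_nat ltnS.
have bounded (t : R -> R) a b : measurable_fun setT t -> (forall c, `|t c| <= 1) -> rintegrable `[a, b]%classic t.
  move=> mt t1; apply: (@rintegrable_le R _ _ (fun=> 1)) => //; first exact: measurable_funTS.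
  by apply: rintegrable_continuous; exact: cst_continuous.
have incr a b : a < b -> g b - g a = f b - f a.
  move=> ab; have ir := bounded r a b mr r1; have is_ := bounded s a b ms s1.
  have ih : rintegrable `[a, b]%classic h by apply: rintegrableZ => //; apply: rintegrableB.
  have := cauchy0_integral mh wh (fun u => cauchy_eq0 mh wh HN) ab ih.
  rewrite RintegralZl //; last exact: rintegrableB.
  rewrite RintegralB // => /eqP; rewrite mulf_eq0 invr_eq0 pnatr_eq0 /= subr_eq0 => /eqP E.
  by rewrite -(sE _ _ (ltW ab)) -(rE _ _ (ltW ab)); exact: E.
exists (g 0 - f 0) => c.
by have [/incr|/incr|->] := ltgtP c 0; lra.
Qed.

End Uniqueness.

Theorem proposition7p1p1 (R : realType) (eps : R) (heps : 0 < eps) :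
  (exists f : R -> R, dispersive_action_profile (@v_star R) eps f) /\
  forall f : R -> R, dispersive_action_profile (@v_star R) eps f ->
    [/\ profile f,
        Poghossian_eq eps (T_up f),
        asymp_inv (T_up f) &
        forall g : R -> R, profile g ->
          Poghossian_eq eps (T_up g) -> asymp_inv (T_up g) ->
          exists k : R, forall c : R, g c = f c + k].
Proof.
split.
  by have [f zf] := ex_zigzag heps; exists f; apply/(action_profile_zigzag heps).
move=> f /(action_profile_zigzag heps) zf; have pf := zigzag_profile zf.
have lf : 1.-lipschitz f by case: pf.
have [r [mr r1 rae _]] := lipschitz_density (lipschitz1P lf).
have TE u : complex.Im u != 0 -> T_up f u = T heps u by move=> u0; exact: (zigzag_observable zf mr r1 rae u0).
have Pf : Poghossian_eq eps (T_up f).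
  move=> u u0; have ue : complex.Im (u + real_complex R eps) != 0 by rewrite Im_add /= addr0.
  rewrite !TE //; apply: T_rec; [exact: nonreal_regular|exact: nonreal_not_pole|exact: nonreal_not_pole].
have Af : asymp_inv (T_up f).
  (* The maximum with 0 ensures that [u] is not real, where the two functions are known to agree. *)
  move=> e e0; have [M HM] := T_asymp heps e0; exists (Num.max M 0) => u.
  by rewrite gt_max => /andP[uM u0]; rewrite TE ?gt_eqF //; exact: HM.
by split=> // g pg Pg Ag; exact: profile_unique pf pg Pf Af Pg Ag.
Qed.
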